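(* Let $H$, $\tau_\varepsilon$, $k$, $\gamma_\varepsilon$ be as in the context, and for each $\varepsilon$ let $\rho_\varepsilon:[0,\infty)\times\mathbb R\to[0,\infty)$ be a solution of $$\tau_\varepsilon\partial_t\rho_\varepsilon=\partial_x\big(\partial_x\rho_\varepsilon+\varepsilon^{-2}\rho_\varepsilon H'\big),\qquad x\in\mathbb R,\ t>0,$$ with initial datum $\rho_\varepsilon^0$. Moreover, suppose that the initial data $\rho_\varepsilon^0$ are probability measures on $\mathbb R$ (with densities, also denoted $\rho_\varepsilon^0$) that converge weakly$\star$ as $\varepsilon\to0$ to some probability measure $\rho^0$, and satisfy $$\int_{\mathbb R}\gamma_\varepsilon|u_\varepsilon^0|^2\,dx+\int_{\mathbb R}\frac{\gamma_\varepsilon|\partial_xu_\varepsilon^0|^2}{\tau_\varepsilon}\,dx\le C,\qquad u_\varepsilon^0(x)=\rho_\varepsilon^0(x)/\gamma_\varepsilon(x)\ge c>0\quad\forall x\in\mathbb R,$$ with constants $C$ and $c$ independent of $\varepsilon$. Then, for all $t\ge0$, $$\rho_\varepsilon(t,\cdot)\ \rightharpoonup\ \tfrac12\Big(u(t)\,\delta_{+1}+\big(2-u(t)\big)\,\delta_{-1}\Big)\qquad\text{as }\varepsilon\to0$$ weakly$\star$ in the space of probability measures, where the function $u:[0,\infty)\to[0,\infty)$ satisfies $$\dot u=-k\,(u-1),\qquad u(0)=u_0,$$ with $u_0=2\int_0^\infty\rho^0\,dx$ (i.e. $u_0=2\rho^0((0,\infty))$).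
   Context: **Potential.** $H:\mathbb R\to\mathbb R$ is a smooth, nonnegative, even function with $xH'(x)<0$ for $0<|x|<1$, $xH'(x)>0$ for $|x|>1$, $H(\pm1)=H'(\pm1)=H'(0)=0$, $H(0)=H(\pm2)=1$, $H''(0)<0<H''(\pm1)$. **Constants and invariant measure.** $\varepsilon>0$ is a small parameter, and $e^{-H/\varepsilon^2}$ is assumed integrable on $\mathbb R$ for the values of $\varepsilon$ considered. Put $$\tau_\varepsilon:=\varepsilon^{-2}e^{-1/\varepsilon^2},\quad k:=\pi^{-1}\sqrt{|H''(0)|\,H''(1)},\quad Z_\varepsilon:=\int_{\mathbb R}e^{-H(y)/\varepsilon^2}dy,\quad \gamma_\varepsilon(x):=Z_\varepsilon^{-1}e^{-H(x)/\varepsilon^2}.$$ The measure $\gamma_\varepsilon\,dx$ is the invariant probability measure of the equation. **Solutions.** $\rho_\varepsilon(t,\cdot)$ is a probability density on $\mathbb R$ for each $t$, i.e. $\rho_\varepsilon\ge0$ and $\int_{\mathbb R}\rho_\varepsilon(t,x)\,dx=1$. **Notation.** $\delta_{\pm1}$ is the Dirac measure at $\pm1$. *)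

(* Defs.v *)
From HB Require Import structures.
From mathcomp Require Import all_boot all_order all_algebra.
From mathcomp Require Import all_classical all_reals all_analysis.

Set Implicit Arguments.
Unset Strict Implicit.
Unset Printing Implicit Defensive.

Import Order.TTheory GRing.Theory Num.Theory.
Import numFieldNormedType.Exports.

Local Open Scope ring_scope.
Local Open Scope classical_set_scope.

Definition smooth (R : realType) (f : R -> R) : Prop :=
  forall (n : nat) (x : R), derivable (derive1n n f) x 1.

Definition test_function (R : realType) (phi : R -> R) : Prop :=
  smooth phi /\ exists M : R, forall x : R, M < `|x| -> phi x = 0.

Record double_well (R : realType) (H : R -> R) : Prop := DoubleWell {
  dw_smooth : smooth H;
  dw_ge0 : forall x : R, 0 <= H x;
  dw_even : forall x : R, H (- x) = H x;
  dw_inner : forall x : R, 0 < `|x| -> `|x| < 1 -> x * derive1 H x < 0;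
  dw_outer : forall x : R, 1 < `|x| -> 0 < x * derive1 H x;
  dw_wells : H 1 = 0 /\ H (-1) = 0;
  dw_critical : [/\ derive1 H 1 = 0, derive1 H (-1) = 0 & derive1 H 0 = 0];
  dw_level1 : [/\ H 0 = 1, H 2 = 1 & H (-2) = 1];
  dw_hessian : [/\ derive1n 2 H 0 < 0, 0 < derive1n 2 H 1 &
                    0 < derive1n 2 H (-1)]
}.

Definition tau (R : realType) (eps : R) : R := eps ^- 2 * expR (- eps ^- 2).

Definition kramers (R : realType) (H : R -> R) : R :=
  pi^-1 * Num.sqrt (`|derive1n 2 H 0| * derive1n 2 H 1).

Definition gibbs (R : realType) (H : R -> R) (eps x : R) : R :=
  expR (- (H x / eps ^+ 2)).

Definition Zpart (R : realType) (H : R -> R) (eps : R) : R :=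
  \int[@lebesgue_measure R]_y gibbs H eps y.

Definition gamma (R : realType) (H : R -> R) (eps x : R) : R :=
  (Zpart H eps)^-1 * gibbs H eps x.

Definition probability_density (R : realType) (rho : R -> R) : Prop :=
  [/\ measurable_fun setT rho, forall x : R, 0 <= rho x &
      (\int[@lebesgue_measure R]_x (rho x)%:E = 1)%E].

Definition density_measure (R : realType) (rho : R -> R) :
    set (measurableTypeR R) -> \bar R :=
  fun A => (\int[@lebesgue_measure R]_(x in A) (rho x)%:E)%E.

(* (1/2) (u delta_{+1} + (2 - u) delta_{-1}); it is a probability measure
   when 0 <= u <= 2. *)
Definition two_wells (R : realType) (u : R) :
    set (measurableTypeR R) -> \bar R :=
  fun A => ((2^-1)%:E *
    (u%:E * @dirac _ (measurableTypeR R) 1%R R A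
     + (2 - u)%:E * @dirac _ (measurableTypeR R) (-1)%R R A))%E.

(* Probability measures are represented by their underlying set functions.
   The test functions are the bounded continuous ones; when the limit is a
   probability measure, testing against C_0(R) gives the same convergence. *)
Definition weakstar_cvg (R : realType) (I : Type) (F : set_system I)
    (mu : I -> set (measurableTypeR R) -> \bar R)
    (nu : set (measurableTypeR R) -> \bar R) : Prop :=
  forall f : R -> R, continuous f ->
    (exists M : R, forall x : R, `|f x| <= M) ->
    (\int[mu i]_x (f x)%:E)%E @[i --> F] --> (\int[nu]_x (f x)%:E)%E.

(* Solutions, on [0, +oo), of
     tau d_t rho = d_x (d_x rho + eps^-2 rho H')    (t > 0)
   with initial datum rho0, in the sense of distributions in x: weakly*
   continuous curves of probability densities satisfying the equation tested
   against every phi in C_c^oo(R).  No regularity of rho is required. *)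
Definition solution (R : realType) (H : R -> R) (eps : R)
    (rho : R -> R -> R) (rho0 : R -> R) : Prop :=
  [/\ forall t : R, 0 <= t -> probability_density (rho t),
      forall x : R, rho 0 x = rho0 x,
      forall t : R, 0 <= t ->
        weakstar_cvg (within [set s : R | 0 <= s] (nbhs t))
          (fun s => density_measure (rho s)) (density_measure (rho t)) &
      forall phi : R -> R, test_function phi -> forall t : R, 0 < t ->
        is_derive t 1
          (fun s : R => tau eps * \int[@lebesgue_measure R]_x (phi x * rho s x))
          (\int[@lebesgue_measure R]_x
             ((derive1n 2 phi x - eps ^- 2 * derive1 H x * derive1 phi x)
              * rho t x))].

Definition weak_derivative (R : realType) (u v : R -> R) : Prop :=
  [/\ locally_integrable setT u, locally_integrable setT v &
      forall phi : R -> R, test_function phi ->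
        \int[@lebesgue_measure R]_x (u x * derive1 phi x) =
        - \int[@lebesgue_measure R]_x (v x * phi x)].

(* Main.v *)
Require Import Defs.
From HB Require Import structures.
From mathcomp Require Import all_boot all_order all_algebra.
From mathcomp Require Import all_classical all_reals all_analysis.
From mathcomp Require Import measurable_realfun.
From mathcomp Require Import ring lra.

(** The proof is by duality: the solution is tested against functions adapted
    to eps. On a test function phi the equation reads tau d/dt int phi rho =
    int (L phi) rho with L phi = phi'' - eps ^- 2 H' phi' = exp (H / eps ^+ 2)
    (exp (-H / eps ^+ 2) phi')', so that a test function with a prescribed
    image under L is obtained by integrating twice. Three families are used,
    each constant near both ends of the line.

    No escape to infinity. Since H exceeds the barrier height H 0 = 1 beyond
    |x| = 2, there is a function psi rising from 0 near the wells to 1 far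
    away with L psi <= o (tau) ([tail_function]): on the time scale of the
    equation the mass far away cannot increase noticeably.

    Concentration. A modification f of H ^+ 2 satisfies L f <= -lam f + o (1)
    except far away ([concentration_function]). As the equation has the factor
    1 / tau, its average exceeds its initial value by at most o (1), uniformly
    in time ([confinement_bound]): all the mass sits at the two wells, and its
    limit is determined by the single number u (t).

    Exchange between the wells. The committor is the odd function phi with
    flux exp (-H / eps ^+ 2) phi' whose derivative is -tau k exp (-H / eps ^+
    2) on the right well and the opposite on the left one, so that L phi is
    -tau k times the sign of the well. Laplace's method at the well and at the
    barrier top shows that phi tends to 1 at the right well and to -1 at the
    left one exactly because k is the Kramers constant ([committor_cvg]).
    Hence L phi = -tau k phi + tau o (1) as far as averages against
    concentrated densities are concerned, and the average of phi decays like
    exp (-k t). As phi has different values at the two ends of the line, it is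
    corrected by a multiple of psi on one side; L psi being only bounded
    above, this gives an inequality, and the two signs together give the
    equality ([signed_drift], [dynamics]).

    Initial data. The energy bound and the concentration of gamma imply that
    the initial data concentrate at the wells ([initial_concentration]), so
    that the initial averages of phi converge to 2 rho^0 (]0, +oo[) - 1
    ([initial_limit]). Finally the average of a bounded continuous function
    is, in the limit, an affine function of that of phi ([observable_bound]),
    which yields u (t) = 1 + (2 rho^0 (]0, +oo[) - 1) exp (-k t). *)

Set Implicit Arguments.
Unset Strict Implicit.
Unset Printing Implicit Defensive.

Import Order.TTheory GRing.Theory Num.Theory.
Import numFieldNormedType.Exports.

Local Open Scope ring_scope.
Local Open Scope classical_set_scope.

(** * Smooth functions and primitives *)

(** The successive derivatives are carried existentially, so that closure under
    sums, products and composition follows by induction on [n] from the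
    corresponding rule for [is_derive]; [smoothP] transfers it to [smooth]. *)
Fixpoint Ck {R : realType} (n : nat) (f : R -> R) : Prop :=
  if n is m.+1 then
    exists2 g, (forall x : R, is_derive x (1 : R) f (g x)) & Ck m g
  else True.

Lemma is_derive_derive1 {R : realType} (f g : R -> R) :
  (forall x : R, is_derive x (1 : R) f (g x)) -> derive1 f = g.
Proof. by move=> fg; apply/funext => x; rewrite derive1E (@derive_val _ _ _ _ _ _ _ (fg x)). Qed.

Lemma derive_unique {R : realType} (f : R -> R) (x a b : R) :
  is_derive x (1 : R) f a -> is_derive x (1 : R) f b -> a = b.
Proof. by move=> [_ <-] [_ <-]. Qed.

Lemma is_derive_cont {R : realType} (f g : R -> R) :
  (forall x : R, is_derive x (1 : R) f (g x)) -> continuous f.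
Proof.
by move=> fg x; apply/differentiable_continuous/derivable1_diffP; case: (fg x).
Qed.

Lemma smoothP {R : realType} (f : R -> R) : smooth f <-> forall n, Ck n f.
Proof.
split=> [sf n|cf n].
  elim: n f sf => // n IH f sf; exists (derive1 f).
    by move=> x; rewrite derive1E; apply/derivableP; exact: (sf 0%N).
  by apply: IH => m x; have := sf m.+1 x; rewrite derive1Sn.
have : Ck n.+1 f by [].
elim: n f {cf} => [|n IH] f [g fg cg] x; first by case: (fg x).
by rewrite derive1Sn (is_derive_derive1 fg); exact: IH.
Qed.

Lemma smooth_derivative {R : realType} (f : R -> R) : smooth f ->
  smooth (derive1 f) /\ forall x : R, is_derive x (1 : R) f (derive1 f x).
Proof.
move=> sf; split; first by move=> m x; have := sf m.+1 x; rewrite derive1Sn.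
by move=> x; rewrite derive1E; apply/derivableP; exact: (sf 0%N).
Qed.

Lemma smooth_primitive {R : realType} (f g : R -> R) :
  (forall x : R, is_derive x (1 : R) f (g x)) -> smooth g -> smooth f.
Proof. by move=> fg /smoothP sg; apply/smoothP => -[|n] //; exists g. Qed.

Lemma smooth_cont {R : realType} (f : R -> R) : smooth f -> continuous f.
Proof. by move=> /smooth_derivative[_ /is_derive_cont]. Qed.

Lemma CkW {R : realType} n (f : R -> R) : Ck n.+1 f -> Ck n f.
Proof.
by elim: n f => // n IH f [g fg cg]; exists g => //; exact: IH.
Qed.

Lemma Ck_cst {R : realType} n (c : R) : Ck n (fun=> c).
Proof.
elim: n c => // n IH c; exists (fun=> 0) => // x; exact: is_derive_cst.
Qed.

Lemma CkD {R : realType} n (f g : R -> R) : Ck n f -> Ck n g ->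
  Ck n (fun x => f x + g x).
Proof.
elim: n f g => // n IH f g [f' ff' cf] [g' gg' cg].
exists (fun x => f' x + g' x); last exact: IH.
by move=> x; exact: is_deriveD.
Qed.

Lemma CkM {R : realType} n (f g : R -> R) : Ck n f -> Ck n g ->
  Ck n (fun x => f x * g x).
Proof.
elim: n f g => // n IH f g cf cg.
have [f' ff' cf'] := cf; have [g' gg' cg'] := cg.
exists (fun x => f x * g' x + g x * f' x).
  by move=> x; exact: is_deriveM.
by apply: CkD; apply: IH => //; exact: CkW.
Qed.

Lemma Ck_exp {R : realType} n (f : R -> R) : Ck n f ->
  Ck n (fun x => expR (f x)).
Proof.
elim: n f => // n IH f cf; have [f' ff' cf'] := cf.
exists (fun x => expR (f x) * f' x).
  by move=> x; apply: (@is_derive1_comp _ expR f).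
by apply: CkM => //; apply: IH; exact: CkW.
Qed.

Lemma Ck_affine {R : realType} n (a b : R) (f : R -> R) : Ck n f ->
  Ck n (fun x => f (a * x + b)).
Proof.
elim: n f => // n IH f [f' ff' cf'].
exists (fun x => f' (a * x + b) * a); last by apply: CkM; [exact: IH|exact: Ck_cst].
move=> x; apply: (@is_derive1_comp _ f (fun x => a * x + b)) => //.
have -> : (fun x => a * x + b) = (a *: (id : R -> R) + cst b)%R by [].
by apply: is_derive_eq; rewrite addr0 /GRing.scale /= mulr1.
Qed.

Lemma smooth_cst {R : realType} (c : R) : smooth (fun _ : R => c).
Proof. by apply/smoothP => n; exact: Ck_cst. Qed.

Lemma smoothD {R : realType} (f g : R -> R) : smooth f -> smooth g ->
  smooth (fun x => f x + g x).
Proof. by move=> /smoothP sf /smoothP sg; apply/smoothP => n; exact: CkD. Qed.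

Lemma smoothM {R : realType} (f g : R -> R) : smooth f -> smooth g ->
  smooth (fun x => f x * g x).
Proof. by move=> /smoothP sf /smoothP sg; apply/smoothP => n; exact: CkM. Qed.

Lemma smoothZ {R : realType} (c : R) (f : R -> R) : smooth f ->
  smooth (fun x => c * f x).
Proof. by move=> sf; exact (smoothM (@smooth_cst R c) sf). Qed.

Lemma smoothN {R : realType} (f : R -> R) : smooth f -> smooth (fun x => - f x).
Proof.
move=> /(smoothZ (c := -1)); congr smooth.
by apply/funext => x; rewrite mulN1r.
Qed.

Lemma smooth_exp {R : realType} (f : R -> R) : smooth f ->
  smooth (fun x => expR (f x)).
Proof. by move=> /smoothP sf; apply/smoothP => n; exact: Ck_exp. Qed.

Lemma smooth_affine {R : realType} (a b : R) (f : R -> R) : smooth f ->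
  smooth (fun x => f (a * x + b)).
Proof. by move=> /smoothP sf; apply/smoothP => n; exact: Ck_affine. Qed.

Lemma smooth_reflect {R : realType} (f : R -> R) : smooth f ->
  smooth (fun x => f (- x)).
Proof.
move=> /(smooth_affine (a := -1) (b := 0)); congr smooth.
by apply/funext => x; rewrite mulN1r addr0.
Qed.

Lemma is_derive_reflect {R : realType} (f f' : R -> R) :
  (forall x : R, is_derive x (1 : R) f (f' x)) ->
  forall x : R, is_derive x (1 : R) (fun y => f (- y)) (- f' (- x)).
Proof.
move=> ff' x.
have hN : is_derive x (1 : R) (fun y : R => - y) (- 1) by exact: is_deriveN.
by rewrite -mulrN1; exact: (@is_derive1_comp _ f (fun y => - y)).
Qed.

(** The base point lies below both [0] and [x], so that two integrals over
    genuine intervals give the oriented integral from [0] to [x] for either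
    sign of [x]; by [primE] any other low base point gives the same value. *)
Definition prim {R : realType} (g : R -> R) (x : R) : R :=
  \int[@lebesgue_measure R]_(y in `[- `|x| - 1, x]) g y
  - \int[@lebesgue_measure R]_(y in `[- `|x| - 1, 0]) g y.

Lemma cont_integrable {R : realType} (g : R -> R) (a b : R) : continuous g ->
  (@lebesgue_measure R).-integrable `[a, b] (EFin \o g).
Proof.
move=> cg; apply: continuous_compact_integrable; first exact: segment_compact.
by apply: continuous_subspaceT.
Qed.

Lemma primE {R : realType} (g : R -> R) (x a : R) : continuous g ->
  a < x -> a < 0 ->
  prim g x = \int[@lebesgue_measure R]_(y in `[a, x]) g y
             - \int[@lebesgue_measure R]_(y in `[a, 0]) g y.
Proof.
move=> cg; rewrite /prim; set a0 := - `|x| - 1.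
have a0x : a0 < x.
  by rewrite /a0; have := ler_norm (- x); rewrite normrN; lra.
have a00 : a0 < 0 by rewrite /a0; have := normr_ge0 x; lra.
have key (b c : R) : b <= c -> c < x -> c < 0 ->
    \int[@lebesgue_measure R]_(y in `[b, x]) g y
    - \int[@lebesgue_measure R]_(y in `[b, 0]) g y =
    \int[@lebesgue_measure R]_(y in `[c, x]) g y
    - \int[@lebesgue_measure R]_(y in `[c, 0]) g y.
  move=> bc cx c0.
  have Hs (z : R) : c < z -> \int[@lebesgue_measure R]_(y in `[b, z]) g y =
      \int[@lebesgue_measure R]_(y in `[b, c]) g y +
      \int[@lebesgue_measure R]_(y in `[c, z]) g y.
    move=> cz; apply/eqP; rewrite addrC -subr_eq; apply/eqP.
    rewrite Rintegral_itvB; last 3 first.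
    - exact: cont_integrable.
    - by rewrite bnd_simp.
    - by rewrite bnd_simp ltW.
    rewrite Rintegral_itv_obnd_cbnd//.
    apply: integrableS (cont_integrable c z cg) => //.
    by apply: subset_itvr; rewrite bnd_simp.
  by rewrite (Hs x)// (Hs 0)//; lra.
move=> ax al0; have [h|h] := leP a a0; last by apply: key => //; exact: ltW.
by apply/esym; apply: key.
Qed.

Lemma prim_derive {R : realType} (g : R -> R) : continuous g ->
  forall x : R, is_derive x (1 : R) (prim g) (g x).
Proof.
move=> cg x; set a := - `|x| - 2.
have ax : a < x - 1.
  by rewrite /a; have := ler_norm (- x); rewrite normrN; lra.
have a0 : a < 0 by rewrite /a; have := normr_ge0 x; lra.
have x1 : x < x + 1 by lra.
have ax' : a < x by lra.
(* With a base point fixed on a neighbourhood of x, [prim g] is there an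
   integral with variable upper end plus a constant. *)
have [dF eF] := continuous_FTC1_closed x1 (cont_integrable a (x + 1) cg) ax' (cg x).
set F := (fun x => _) in dF eF.
set c := \int[@lebesgue_measure R]_(y in `[a, 0]) g y.
have hF : is_derive x (1 : R) F (g x) by rewrite -eF derive1E; exact/derivableP.
have hD : is_derive x (1 : R) (F - cst c) (g x - 0) by exact: is_deriveB.
rewrite -[g x]subr0; apply: near_eq_is_derive hD.
near=> y; rewrite (primE (a := a))//.
near: y; apply: (@lt_nbhsr R); lra.
Unshelve. all: by end_near. Qed.

Lemma prim0 {R : realType} (g : R -> R) : prim g 0 = 0.
Proof. by rewrite /prim normr0 subrr. Qed.

(** * Comparison by derivatives, and smooth cutoffs *)

Lemma derive_ler {R : realType} (f f' : R -> R) (a b : R) :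
  (forall x : R, is_derive x (1 : R) f (f' x)) -> a <= b ->
  (forall x, a < x < b -> 0 <= f' x) -> f a <= f b.
Proof.
move=> ff' ab f'0; have cf : {within `[a, b], continuous f}.
  by apply: continuous_subspaceT; exact: is_derive_cont ff'.
move: ab; rewrite le_eqVlt => /predU1P[->//|ab].
have [c cab] := MVT ab (fun x _ => ff' x) cf.
rewrite -subr_ge0 => ->; rewrite mulr_ge0 ?subr_ge0 ?(ltW ab)//.
by apply: f'0; move: cab; rewrite in_itv.
Qed.

Lemma derive_ltr {R : realType} (f f' : R -> R) (a b : R) :
  (forall x : R, is_derive x (1 : R) f (f' x)) -> a < b ->
  (forall x, a < x < b -> 0 < f' x) -> f a < f b.
Proof.
move=> ff' ab f'0; have cf : {within `[a, b], continuous f}.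
  by apply: continuous_subspaceT; exact: is_derive_cont ff'.
have [c cab] := MVT ab (fun x _ => ff' x) cf.
rewrite -subr_gt0 => ->; rewrite mulr_gt0 ?subr_gt0//.
by apply: f'0; move: cab; rewrite in_itv.
Qed.

Lemma derive_ler2 {R : realType} (f f' g g' : R -> R) (a b : R) :
  (forall x : R, is_derive x (1 : R) f (f' x)) ->
  (forall x : R, is_derive x (1 : R) g (g' x)) -> a <= b ->
  (forall x, a < x < b -> f' x <= g' x) -> f b - f a <= g b - g a.
Proof.
move=> ff' gg' ab fg.
have h (x : R) : is_derive x (1 : R) (fun y => g y - f y) (g' x - f' x).
  exact: is_deriveB.
suff : g a - f a <= g b - f b by lra.
by apply: (derive_ler h ab) => x /fg; rewrite subr_ge0.
Qed.

Lemma derive_eqr {R : realType} (f f' g g' : R -> R) (a b : R) :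
  (forall x : R, is_derive x (1 : R) f (f' x)) ->
  (forall x : R, is_derive x (1 : R) g (g' x)) -> a <= b ->
  (forall x, a < x < b -> f' x = g' x) -> f b - f a = g b - g a.
Proof.
move=> ff' gg' ab fg; apply/eqP; rewrite eq_le.
by apply/andP; split;
  [apply: (derive_ler2 ff' gg')|apply: (derive_ler2 gg' ff')] => // x /fg ->.
Qed.

Lemma derive_cst_itv {R : realType} (f f' : R -> R) (a b : R) :
  (forall x : R, is_derive x (1 : R) f (f' x)) -> a <= b ->
  (forall x, a < x < b -> f' x = 0) -> f b = f a.
Proof.
move=> ff' ab f0; apply/eqP; rewrite -subr_eq0; apply/eqP.
have h0 (x : R) : is_derive x (1 : R) (fun=> 0 : R) (0 : R) by exact: is_derive_cst.
by rewrite (derive_eqr ff' h0)// subrr.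
Qed.

(** The functions x ^- j * exp (-1 / x), extended by zero to x <= 0. The whole
    family is needed because the derivative of the j-th one combines the
    members of index j + 1 and j + 2 ([flat_derive]): smoothness at 0 of the
    classical function exp (-1 / x) is then an induction over the family. *)
Definition flat {R : realType} (j : nat) (x : R) : R :=
  if 0 < x then x ^- j * expR (- x^-1) else 0.

Lemma flat_ge0 {R : realType} j (x : R) : 0 <= flat j x.
Proof.
rewrite /flat; case: ifPn => // x0.
by rewrite mulr_ge0 ?expR_ge0// invr_ge0 exprn_ge0// ltW.
Qed.

Lemma flat_gt0 {R : realType} j (x : R) : 0 < x -> 0 < flat j x.
Proof.
by move=> x0; rewrite /flat x0 mulr_gt0 ?expR_gt0// invr_gt0 exprn_gt0.
Qed.

Lemma flat0_le1 {R : realType} (x : R) : flat 0 x <= 1.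
Proof.
rewrite /flat; case: ifPn => // x0.
by rewrite expr0 invr1 mul1r -expR0 ler_expR oppr_le0 invr_ge0 ltW.
Qed.

(** Keeping one term of the exponential series, exp y >= y ^+ (j + 2) / (j +
    2)! at y = 1 / x, shows that [flat j] is quadratically small at 0; this is
    what makes its derivative there vanish. *)
Lemma flat_le {R : realType} j (x : R) : flat j x <= (j.+2)`!%:R * x ^+ 2.
Proof.
rewrite /flat; case: ifPn => x0; last by rewrite mulr_ge0// sqr_ge0.
set y := x^-1; have y0 : 0 < y by rewrite invr_gt0.
have xE : x = y^-1 by rewrite invrK.
clearbody y; subst x.
have := expR_ge1Dxn j.+1 (ltW y0).
have f0 : 0 < (j.+2)`!%:R :> R by rewrite ltr0n fact_gt0.
move=> h; have {h} : y ^+ j.+2 / (j.+2)`!%:R <= expR y by apply: le_trans h; lra.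
rewrite ler_pdivrMr// => h; rewrite expRN !exprVn invrK.
by rewrite ler_pdivrMr ?expR_gt0// mulrAC ler_pdivlMr ?exprn_gt0// -exprD addn2 mulrC.
Qed.

Lemma is_derive0_quadratic {R : realType} (f : R -> R) (K : R) :
  (forall x, `|f x| <= K * x ^+ 2) -> is_derive (0 : R) (1 : R) f 0.
Proof.
move=> fK; have f0 : f 0 = 0.
  by apply/eqP; rewrite -normr_le0 (le_trans (fK 0))// expr0n /= mulr0.
have K0 : 0 <= K by have := le_trans (normr_ge0 _) (fK 1); rewrite expr1n mulr1.
have h : h^-1 *: (f (h *: (1 : R) + 0) - f 0) @[h --> 0^'] --> (0 : R).
  apply/cvgr0Pnorm_le => e e0; near=> h.
  have h0 : h != 0 by near: h; exact: nbhs_dnbhs_neq.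
  rewrite f0 subr0 addr0 /GRing.scale /= mulr1 normrM normfV.
  rewrite mulrC ler_pdivrMr ?normr_gt0//.
  apply: (le_trans (fK h)); rewrite -real_normK ?num_real// expr2 mulrA.
  rewrite ler_wpM2r//.
  have : `|h| <= e / (K + 1).
    near: h; apply: dnbhs0_le; rewrite divr_gt0//; lra.
  rewrite ler_pdivlMr; last lra.
  by move=> ?; have := normr_ge0 h; nra.
split; first by apply/cvg_ex; exists 0.
exact/cvg_lim.
Unshelve. all: by end_near. Qed.

Lemma flat_derive {R : realType} j (x : R) :
  is_derive x (1 : R) (flat j) (flat j.+2 x - j%:R * flat j.+1 x).
Proof.
have [x0|x0|->] := ltgtP x 0.
- rewrite {2 3}/flat ltNge (ltW x0)/= mulr0 subr0.
  apply: (@near_eq_is_derive _ _ _ (cst 0)).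
  near=> y; rewrite /flat /= ifF//; apply/negbTE; rewrite -leNgt.
  by near: y; exact: lt_le_nbhsl.
- apply: (@near_eq_is_derive _ _ _ (fun y : R => y^-1 ^+ j * expR (- y^-1))).
    near=> y; rewrite /flat /= ifT ?exprVn//.
    by near: y; exact: lt_nbhsr.
  have xn0 : x != 0 by rewrite gt_eqF.
  have hV : is_derive x (1 : R) (fun y : R => y^-1) (- x ^- 2).
    by have := @is_deriveV _ id x 1 1 xn0 (is_derive_id _ _); rewrite /GRing.scale /= mulr1.
  have hX := @is_deriveX _ _ (fun y : R => y^-1) j x (1 : R) _ hV.
  rewrite exprfctE in hX.
  have hN : is_derive x (1 : R) (fun y : R => - y^-1) (- - x ^- 2) by exact: is_deriveN.
  have hE := @is_derive1_comp _ expR (fun y : R => - y^-1) x _ _ (is_derive_expR _) hN.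
  have := is_deriveM hX hE.
  move=> hM; apply: is_derive_eq hM _.
  rewrite /flat x0 /GRing.scale /=.
  case: j {hX} => [|j] /=.
    by rewrite !expr0 !mul0r mulr0 subr0 addr0 opprK mul1r mulrC.
  rewrite !exprVn opprK !exprS.
  set E := expR _; set X := x ^+ j.
  have Xn0 : X != 0 by rewrite expf_neq0.
  rewrite -mulr_natl; field.
  by rewrite xn0 Xn0.
- rewrite {2 3}/flat ltxx mulr0 subr0.
  apply: (@is_derive0_quadratic _ _ (j.+2)`!%:R) => y.
  by rewrite ger0_norm ?flat_ge0// flat_le.
Unshelve. all: by end_near. Qed.

Lemma smooth_flat {R : realType} j : smooth (@flat R j).
Proof.
apply/smoothP => n; elim: n j => // n IH j.
exists (fun x => flat j.+2 x - j%:R * flat j.+1 x); first exact: flat_derive.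
apply: CkD => //.
have -> : (fun x : R => - (j%:R * flat j.+1 x)) = fun x => (- j%:R) * flat j.+1 x.
  by apply/funext => x; rewrite mulNr.
by apply: CkM => //; exact: Ck_cst.
Qed.

Definition bell {R : realType} (x : R) : R := flat 0 x * flat 0 (1 - x).

Lemma smooth_bell {R : realType} : smooth (@bell R).
Proof.
apply: smoothM; first exact: smooth_flat.
have := smooth_affine (a := -1) (b := 1) (@smooth_flat R 0); congr smooth.
by apply/funext => x; congr flat; lra.
Qed.

Lemma bell_ge0 {R : realType} (x : R) : 0 <= bell x.
Proof. by rewrite mulr_ge0// flat_ge0. Qed.

Lemma bell_le1 {R : realType} (x : R) : bell x <= 1.
Proof. by rewrite mulr_ile1 ?flat_ge0 ?flat0_le1. Qed.

Lemma bell_eq0 {R : realType} (x : R) : (x <= 0) || (1 <= x) -> bell x = 0.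
Proof.
rewrite /bell /flat => /orP[x0|x1].
  by rewrite ltNge x0 mul0r.
by rewrite subr_gt0 [x < 1]ltNge x1/= mulr0.
Qed.

Lemma bell_mass_gt0 {R : realType} : 0 < prim (@bell R) 1.
Proof.
rewrite -[ltLHS](prim0 (@bell R)).
apply: (derive_ltr (prim_derive (smooth_cont smooth_bell))) => // x /andP[x0 x1].
by rewrite mulr_gt0// flat_gt0 ?subr_gt0.
Qed.

(** A smooth nondecreasing transition from 0 on x <= 0 to 1 on x >= 1; the
    cutoffs below are built from affine reparametrisations of it. *)
Definition step {R : realType} (x : R) : R := prim bell x / prim (@bell R) 1.

Lemma step_derive {R : realType} (x : R) :
  is_derive x (1 : R) step (bell x / prim (@bell R) 1).
Proof.
have h := prim_derive (smooth_cont (@smooth_bell R)) x.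
have -> : @step R = (fun y => (prim (@bell R) 1)^-1 * prim bell y).
  by apply/funext => y; rewrite mulrC.
by rewrite mulrC; exact: is_deriveZ.
Qed.

Lemma smooth_step {R : realType} : smooth (@step R).
Proof.
apply: (smooth_primitive step_derive).
by apply: (@smoothM _ bell (fun=> _)); [exact: smooth_bell|exact: smooth_cst].
Qed.

Lemma step_eq0 {R : realType} (x : R) : x <= 0 -> step x = 0.
Proof.
move=> x0; rewrite -(derive_cst_itv step_derive x0).
  by rewrite /step prim0 mul0r.
by move=> y /andP[_ y0]; rewrite bell_eq0 ?mul0r ?(ltW y0).
Qed.

Lemma step_eq1 {R : realType} (x : R) : 1 <= x -> step x = 1.
Proof.
move=> x0; rewrite (derive_cst_itv step_derive x0).
  by rewrite /step divff// gt_eqF// bell_mass_gt0.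
by move=> y /andP[y0 _]; rewrite bell_eq0 ?mul0r ?(ltW y0) ?orbT.
Qed.

Lemma step_le {R : realType} (x y : R) : x <= y -> step x <= step y.
Proof.
move=> xy; apply: (derive_ler step_derive xy) => z _.
by rewrite divr_ge0 ?bell_ge0// ltW// bell_mass_gt0.
Qed.

Lemma step_ge0 {R : realType} (x : R) : 0 <= step x.
Proof.
have [x0|x0] := leP x 0; first by rewrite step_eq0.
by rewrite -[leLHS](@step_eq0 R 0)// step_le// ltW.
Qed.

Lemma step_le1 {R : realType} (x : R) : step x <= 1.
Proof.
have [x0|x0] := leP 1 x; first by rewrite step_eq1.
by rewrite -[leRHS](@step_eq1 R 1)// step_le// ltW.
Qed.

(** * Laplace's method *)

(** Identifies the primitive with the integral over [0, x] whose square is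
    known to converge to pi / 4. *)
Lemma gauss_primE {R : realType} (x : R) : 0 < x ->
  prim (@gauss_fun R) x = gauss_integral_proof.integral0_gauss x.
Proof.
move=> x0; have cg : continuous (@gauss_fun R) by exact: continuous_gauss_fun.
have N0 : -1 < 0 :> R by rewrite ltrN10.
rewrite (primE cg (lt_trans N0 x0) N0) Rintegral_itvB; last 3 first.
- exact: cont_integrable.
- by rewrite bnd_simp lerN10.
- by rewrite bnd_simp ltW.
rewrite Rintegral_itv_obnd_cbnd//.
by apply: integrableS (cont_integrable 0 x cg) => //; apply: subset_itvr; rewrite bnd_simp.
Qed.

Lemma gauss_prim_cvg {R : realType} :
  prim (@gauss_fun R) x @[x --> +oo] --> Num.sqrt pi / 2.
Proof.
have h : Num.sqrt (@gauss_integral_proof.integral0_gauss R x ^+ 2) @[x --> +oo]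
    --> Num.sqrt (pi / 4).
  apply: continuous_cvg; [exact: sqrt_continuous|].
  exact: gauss_integral_proof.cvg_integral0_gauss_sqr.
have -> : Num.sqrt pi / 2 = Num.sqrt (pi / 4) :> R.
  rewrite sqrtrM ?pi_ge0// sqrtrV//; congr (_ / _).
  by rewrite (_ : 4 = 2 ^+ 2) ?sqrtr_sqr ?ger0_norm//; lra.
apply: cvg_trans h; apply: near_eq_cvg.
near=> x; rewrite gauss_primE//.
by rewrite sqrtr_sqr ger0_norm// gauss_integral_proof.integral0_gauss_ge0.
Unshelve. all: by end_near. Qed.

Lemma gauss_prim_le {R : realType} (x y : R) : x <= y ->
  prim (@gauss_fun R) x <= prim (@gauss_fun R) y.
Proof.
move=> xy; apply: (derive_ler (prim_derive (@continuous_gauss_fun R)) xy) => z _.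
exact: gauss_fun_ge0.
Qed.

Lemma gauss_prim_ub {R : realType} (x : R) : prim gauss_fun x <= Num.sqrt pi / 2.
Proof.
rewrite -(cvg_lim (@Rhausdorff R) (@gauss_prim_cvg R)).
apply: limr_ge; first by apply/cvg_ex; eexists; exact: gauss_prim_cvg.
by near=> y; apply: gauss_prim_le.
Unshelve. all: by end_near. Qed.

(** With y = m / eps ^+ 2, one term of the exponential series bounds exp (-y)
    by (n + 1)! / y ^+ (n + 1), that is by a multiple of eps ^+ (2 n + 2). *)
Lemma exp_beats_power {R : realType} n (m : R) : 0 < m ->
  (eps ^- n * expR (- (m / eps ^+ 2))) @[eps --> 0^'+] --> (0 : R).
Proof.
move=> m0; set K := (n.+1)`!%:R / m ^+ n.+1.
have K0 : 0 <= K by rewrite divr_ge0// exprn_ge0// ltW.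
have hK : K * eps @[eps --> 0^'+] --> (0 : R).
  rewrite -[X in _ --> X](mulr0 K); apply: cvgMr.
  exact: (cvg_at_right_filter cvg_id).
apply: (squeeze_cvgr _ (cvg_cst 0) hK).
near=> e.
have e0 : 0 < e by near: e; exact: nbhs_right_gt.
have e1 : e <= 1 by near: e; apply: nbhs_right_le; exact: ltr01.
rewrite mulr_ge0 ?expR_ge0 ?invr_ge0 ?exprn_ge0 ?(ltW e0)//=.
set y := m / e ^+ 2; have y0 : 0 < y by rewrite divr_gt0// exprn_gt0.
have := expR_ge1Dxn n (ltW y0).
have f0 : 0 < (n.+1)`!%:R :> R by rewrite ltr0n fact_gt0.
move=> h; have {h} : y ^+ n.+1 / (n.+1)`!%:R <= expR y by apply: le_trans h; lra.
move=> h; rewrite expRN ler_pdivrMr ?expR_gt0//.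
have en0 : e ^+ n != 0 by rewrite expf_neq0// gt_eqF.
apply: (@le_trans _ _ (K * e * (y ^+ n.+1 / (n.+1)`!%:R))); last first.
  by rewrite ler_wpM2l// mulr_ge0// ltW.
have -> : K * e * (y ^+ n.+1 / (n.+1)`!%:R) = e ^- n * (e ^- n.+1).
  have mn0 : m ^+ n != 0 by rewrite expf_neq0// gt_eqF.
  rewrite /K /y expr_div_n exprAC !(exprS _ n); field.
  by rewrite en0 !gt_eqF// exprn_gt0.
rewrite ler_peMr ?invr_ge0 ?exprn_ge0 ?(ltW e0)//.
by rewrite invf_ge1 ?exprn_gt0// exprn_ile1// ltW.
Unshelve. all: by end_near. Qed.

(** The primitive of the Gaussian exp (-(s x / eps) ^+ 2) vanishing at 0. *)
Definition gauss_scaled {R : realType} (s eps x : R) : R :=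
  eps / s * prim gauss_fun (s / eps * x).

Lemma gauss_scaled_derive {R : realType} (s eps : R) : 0 < s -> 0 < eps ->
  forall x : R, is_derive x (1 : R) (gauss_scaled s eps)
    (expR (- (s ^+ 2 * x ^+ 2 / eps ^+ 2))).
Proof.
move=> s0 e0 x.
have h1 : is_derive x (1 : R) (fun x => s / eps * x) (s / eps).
  by have := @is_deriveZ _ _ _ id (s / eps) x 1 1 (is_derive_id _ _); rewrite /GRing.scale /= mulr1.
have h2 := @is_derive1_comp _ (prim gauss_fun) _ x _ _
  (prim_derive (@continuous_gauss_fun R) (s / eps * x)) h1.
have h3 := @is_deriveZ _ _ _ _ (eps / s) _ _ _ h2.
apply: is_derive_eq h3 _.
rewrite /GRing.scale /= mulrCA -[X in _ * (_ * X)]invf_div mulfV ?mulr1; last first.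
  by rewrite mulf_neq0 ?invr_eq0 ?gt_eqF.
by congr expR; rewrite !exprMn exprVn; congr (- _); rewrite mulrAC.
Qed.

Lemma gauss_scaled0 {R : realType} (s eps : R) : gauss_scaled s eps 0 = 0.
Proof. by rewrite /gauss_scaled mulr0 prim0 mulr0. Qed.

(** One-sided Laplace asymptotics at a quadratic minimum. On a short interval
    [0, d] the exponent lies between (q - eta) x ^+ 2 and (q + eta) x ^+ 2, so
    the integral lies between two rescaled Gaussian integrals, whose limits
    differ little when eta is small; beyond d the exponent stays above some m >
    0 and the contribution is exponentially small. *)
Lemma laplace {R : realType} (h : R -> R) (q r : R) :
  continuous h -> 0 < q -> 0 < r ->
  (forall eta : R, 0 < eta -> exists2 d : R, 0 < d &
    forall x, 0 <= x <= d -> `|h x - q * x ^+ 2| <= eta * x ^+ 2) ->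
  (forall x, 0 < x <= r -> 0 < h x) ->
  prim (fun x => expR (- (h x / eps ^+ 2))) r / eps @[eps --> 0^'+]
    --> Num.sqrt pi / (2 * Num.sqrt q).
Proof.
move=> ch q0 r0 hq hpos.
have sq0 : 0 < Num.sqrt q by rewrite sqrtr_gt0.
have cE eps : continuous (fun x => expR (- (h x / eps ^+ 2))).
  move=> x; apply: continuous_comp; last exact: continuous_expR.
  by apply: cvgN; apply: cvgMl; exact: ch.
pose L : R := Num.sqrt pi / 2.
have L0 : 0 < L by rewrite divr_gt0// sqrtr_gt0 pi_gt0.
have cs : L / Num.sqrt a @[a --> q] --> L / Num.sqrt q.
  apply: cvgM; first exact: cvg_cst.
  by apply: cvgV; [rewrite gt_eqF|exact: sqrt_continuous].
have -> : Num.sqrt pi / (2 * Num.sqrt q) = L / Num.sqrt q by rewrite invfM mulrA.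
apply/cvgrPdist_le => e e0; have e20 : 0 < e / 2 by rewrite divr_gt0.
move/cvgrPdist_le : cs => /(_ _ e20)[eta0 /= eta00 heta].
pose eta := Num.min (eta0 / 2) (q / 2).
have eta_gt0 : 0 < eta by rewrite lt_min !divr_gt0.
have eta_lt : eta < eta0 by rewrite gt_min; apply/orP; left; lra.
have eta_q : eta < q by rewrite gt_min; apply/orP; right; lra.
have [d0 d00 hd0] := hq _ eta_gt0.
pose d := Num.min d0 r.
have d_gt0 : 0 < d by rewrite lt_min d00.
have dr : d <= r by rewrite ge_min lexx orbT.
have hd x : 0 <= x <= d -> `|h x - q * x ^+ 2| <= eta * x ^+ 2.
  by move=> /andP[x0 xd]; apply: hd0; rewrite x0 (le_trans xd)// ge_min lexx.
have [m m0 hm] : exists2 m : R, 0 < m & forall x, d <= x <= r -> m <= h x.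
  have [c + hc] := EVT_min dr (continuous_subspaceT ch).
  rewrite in_itv /= => /andP[dc cr]; exists (h c).
    by apply: hpos; rewrite cr andbT (lt_le_trans d_gt0).
  by move=> x hx; apply: hc; rewrite in_itv.
set s1 := Num.sqrt (q - eta); set s2 := Num.sqrt (q + eta).
have s10 : 0 < s1 by rewrite sqrtr_gt0 subr_gt0.
have s20 : 0 < s2 by rewrite sqrtr_gt0 addr_gt0.
have s1q : s1 ^+ 2 = q - eta by rewrite sqr_sqrtr// subr_ge0 ltW.
have s2q : s2 ^+ 2 = q + eta by rewrite sqr_sqrtr// addr_ge0 ?ltW.
have b1 : `|L / Num.sqrt q - L / s1| <= e / 2.
  by apply: heta; rewrite /= opprB addrC subrK gtr0_norm.
have b2 : `|L / Num.sqrt q - L / s2| <= e / 2.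
  by apply: heta; rewrite /= opprD addNKr normrN gtr0_norm.
have lim1 : L / s1 + r * (eps ^- 1 * expR (- (m / eps ^+ 2))) @[eps --> 0^'+] --> L / s1.
  rewrite -[X in _ --> X]addr0; apply: cvgD; first exact: cvg_cst.
  by rewrite -[X in _ --> X](mulr0 r); apply: cvgMr; exact: exp_beats_power.
have lim2 : s2^-1 * prim gauss_fun (s2 / eps * d) @[eps --> 0^'+] --> s2^-1 * L.
  apply: cvgMr; apply: cvg_comp gauss_prim_cvg.
  apply: gt0_cvgMly => //.
  apply: gt0_cvgMry => //.
  apply/cvgrVy.
    exact: nbhs_right_gt.
  exact: (cvg_at_right_filter cvg_id).
near=> eps.
have eps0 : 0 < eps by near: eps; exact: nbhs_right_gt.
have B1 : `|L / s1 - (L / s1 + r * (eps ^- 1 * expR (- (m / eps ^+ 2))))| <= e / 2.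
  by near: eps; move/cvgrPdist_le : lim1; apply.
have B2 : `|s2^-1 * L - s2^-1 * prim gauss_fun (s2 / eps * d)| <= e / 2.
  by near: eps; move/cvgrPdist_le : lim2; apply.
have hP := prim_derive (cE eps).
have up1 : prim (fun x => expR (- (h x / eps ^+ 2))) d <= eps / s1 * L.
  rewrite -[leLHS]subr0 -(prim0 (fun x => expR (- (h x / eps ^+ 2)))).
  apply: le_trans (derive_ler2 hP (gauss_scaled_derive s10 eps0) (ltW d_gt0) _) _.
    move=> x /andP[x0 xd]; rewrite ler_expR lerN2 s1q ler_pM2r ?invr_gt0 ?exprn_gt0//.
    have := hd x; rewrite (ltW x0) (ltW xd) => /(_ isT); rewrite ler_distl => /andP[+ _].
    by rewrite mulrBl.
  rewrite gauss_scaled0 subr0 /gauss_scaled ler_wpM2l ?divr_ge0 ?(ltW eps0) ?(ltW s10)//.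
  exact: gauss_prim_ub.
have low1 : gauss_scaled s2 eps d <= prim (fun x => expR (- (h x / eps ^+ 2))) d.
  have := derive_ler2 (gauss_scaled_derive s20 eps0) hP (ltW d_gt0).
  rewrite gauss_scaled0 prim0 !subr0; apply.
  move=> x /andP[x0 xd]; rewrite ler_expR lerN2 s2q ler_pM2r ?invr_gt0 ?exprn_gt0//.
  have := hd x; rewrite (ltW x0) (ltW xd) => /(_ isT); rewrite ler_distl => /andP[_].
  by rewrite mulrDl.
have low2 : prim (fun x => expR (- (h x / eps ^+ 2))) d <=
    prim (fun x => expR (- (h x / eps ^+ 2))) r.
  by apply: (derive_ler hP dr) => x _; exact: expR_ge0.
have up2 : prim (fun x => expR (- (h x / eps ^+ 2))) r -
    prim (fun x => expR (- (h x / eps ^+ 2))) d <= r * expR (- (m / eps ^+ 2)).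
  set E := expR (- (m / eps ^+ 2)).
  have hl (x : R) : is_derive x (1 : R) (fun y => E * y) E.
    have := @is_deriveZ _ _ _ id E x 1 1 (is_derive_id _ _).
    by rewrite /GRing.scale /= mulr1.
  apply: le_trans (derive_ler2 hP hl dr _) _.
    move=> x /andP[dx xr]; rewrite ler_expR lerN2 ler_pM2r ?invr_gt0 ?exprn_gt0//.
    by apply: hm; rewrite (ltW dx) (ltW xr).
  have : 0 <= E * d by rewrite mulr_ge0 ?expR_ge0// ltW.
  by lra.
set P := prim _ r in low2 up2 *; set Pd := prim _ d in low1 low2 up1 up2.
have upF : P / eps <= L / s1 + r * (eps ^- 1 * expR (- (m / eps ^+ 2))).
  rewrite ler_pdivrMr// mulrDl.
  rewrite (_ : r * _ * eps = r * expR (- (m / eps ^+ 2))); last first.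
    by rewrite expr1; field; rewrite gt_eqF.
  by rewrite (_ : L / s1 * eps = eps / s1 * L); [lra|ring].
have lowF : s2^-1 * prim gauss_fun (s2 / eps * d) <= P / eps.
  rewrite ler_pdivlMr//; apply: le_trans (le_trans low1 low2).
  by rewrite /gauss_scaled le_eqVlt; apply/orP; left; apply/eqP; ring.
rewrite (mulrC s2^-1 L) in B2.
clear -b1 b2 B1 B2 upF lowF.
move: b1 b2 B1 B2 upF lowF.
move: (L / Num.sqrt q) (L / s1) (L / s2) (P / eps) => l l1 l2 p.
move: (r * _) (s2^-1 * _) => u v; clear; rewrite !ler_distl.
move=> /andP[h1 h2] /andP[h3 h4] /andP[h5 h6] /andP[h7 h8] h9 h10.
by apply/andP; split; lra.
Unshelve. all: by end_near. Qed.

(** Second-order Taylor estimate from the differentiability of h' at 0 alone: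
    |h' y - c y| <= eta y for small y > 0, and integrating this bound gives the
    claim. *)
Lemma quadratic_approx {R : realType} (h h' : R -> R) (c : R) :
  (forall x : R, is_derive x (1 : R) h (h' x)) ->
  is_derive (0 : R) (1 : R) h' c -> h 0 = 0 -> h' 0 = 0 ->
  forall eta : R, 0 < eta -> exists2 d : R, 0 < d &
    forall x, 0 <= x <= d -> `|h x - c / 2 * x ^+ 2| <= eta * x ^+ 2.
Proof.
move=> hh' hc h0 h'0 eta eta0.
have [d /= d0 hd] : \forall y \near (0 : R)^', `|h' y - c * y| <= eta * `|y|.
  have [/cvg_ex[l hl] dc] := hc.
  have lc : l = c by rewrite -dc; apply/esym/cvg_lim.
  move: hl; rewrite lc => /cvgrPdist_le/(_ _ eta0); apply: filterS2 (nbhs_dnbhs_neq _) => y y0.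
  rewrite h'0 subr0 /= addr0 /GRing.scale /= mulr1 => hy.
  have -> : h' y - c * y = - (c - y^-1 * h' y) * y by field.
  by rewrite normrM normrN ler_pM2r ?normr_gt0.
exists (d / 2); first by rewrite divr_gt0.
move=> x /andP[x0 xd].
have hs (a : R) (y : R) : is_derive y (1 : R) (fun x => a * x ^+ 2) (2 * a * y).
  have := @is_deriveZ _ _ _ _ a _ _ _ (@is_deriveX _ _ id 2 y (1 : R) _ (is_derive_id _ _)).
  by move=> H; apply: is_derive_eq H _; rewrite /GRing.scale /= expr1 mulr1; ring.
have key y : 0 < y < x -> `|h' y - c * y| <= eta * y.
  move=> /andP[y0 yx]; rewrite -[in leRHS](gtr0_norm y0); apply: hd.
    rewrite /= sub0r normrN gtr0_norm//; lra.
  by rewrite gt_eqF.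
have ey0 y : 0 < y < x -> 0 <= eta * y.
  by move=> /andP[y0 _]; rewrite mulr_ge0 ?ltW.
have u := derive_ler2 hh' (hs (c / 2 + eta)) x0 _.
have l := derive_ler2 (hs (c / 2 - eta)) hh' x0 _.
move: u l; rewrite h0 expr0n /= !mulr0 !subr0 => u l.
rewrite ler_distl; apply/andP; split.
  rewrite -mulrBl; apply: l => y hy; have ey := ey0 y hy; have := key y hy.
  by rewrite ler_distl => /andP[+ _]; lra.
rewrite -mulrDl; apply: u => y hy; have ey := ey0 y hy; have := key y hy.
by rewrite ler_distl => /andP[_]; lra.
Qed.

(** * Averages against a density, and the weak equation *)

Definition mean {R : realType} (rho phi : R -> R) : R :=
  \int[@lebesgue_measure R]_x (phi x * rho x).

Definition bmeas {R : realType} (phi : R -> R) : Prop :=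
  measurable_fun setT phi /\ exists M : R, forall x, `|phi x| <= M.

Lemma bmeas_cst {R : realType} (c : R) : bmeas (fun _ : R => c).
Proof. by split; [exact: measurable_cst|exists `|c|]. Qed.

Lemma bmeasD {R : realType} (f g : R -> R) : bmeas f -> bmeas g ->
  bmeas (fun x => f x + g x).
Proof.
move=> [mf [M hM]] [mg [N hN]]; split; first exact: measurable_funD.
by exists (M + N) => x; rewrite (le_trans (ler_normD _ _))// lerD.
Qed.

Lemma bmeasZ {R : realType} (c : R) (f : R -> R) : bmeas f ->
  bmeas (fun x => c * f x).
Proof.
move=> [mf [M hM]]; split; first by apply: measurable_funM => //; exact: measurable_cst.
by exists (`|c| * M) => x; rewrite normrM ler_wpM2l.
Qed.

Lemma bmeas_continuous {R : realType} (f : R -> R) : continuous f ->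
  (exists M : R, forall x, `|f x| <= M) -> bmeas f.
Proof. by move=> cf bf; split => //; exact: continuous_measurable_fun. Qed.

Lemma mean_integrable {R : realType} (rho phi : R -> R) :
  probability_density rho -> bmeas phi ->
  (@lebesgue_measure R).-integrable setT (EFin \o (fun x => phi x * rho x)).
Proof.
move=> [mrho rho0 rho1] [mphi [M hM]].
have irho : (@lebesgue_measure R).-integrable setT (EFin \o rho).
  apply/integrableP; split; first exact/measurable_EFinP.
  apply: (@le_lt_trans _ _ (\int[@lebesgue_measure R]_x (rho x)%:E)%E); last first.
    by rewrite rho1 ltry.
  by rewrite le_eqVlt; apply/orP; left; apply/eqP/eq_integral => x _ /=; rewrite ger0_norm.
have iM : (@lebesgue_measure R).-integrable setT (fun x => (M%:E * (rho x)%:E)%E).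
  exact: integrableZl.
apply: le_integrable iM => //.
  by apply/measurable_EFinP; exact: measurable_funM.
move=> x _ /=; rewrite lee_fin !normrM ler_wpM2r//.
by rewrite (le_trans (hM x))// ler_norm.
Qed.

Lemma meanD {R : realType} (rho f g : R -> R) : probability_density rho ->
  bmeas f -> bmeas g -> mean rho (fun x => f x + g x) = mean rho f + mean rho g.
Proof.
move=> dr bf bg; rewrite /mean -RintegralD//; [|exact: mean_integrable..].
by apply: eq_Rintegral => x _; rewrite mulrDl.
Qed.

Lemma meanZ {R : realType} (rho f : R -> R) c : probability_density rho ->
  bmeas f -> mean rho (fun x => c * f x) = c * mean rho f.
Proof.
move=> dr bf; rewrite /mean -RintegralZl//; last exact: mean_integrable.
by apply: eq_Rintegral => x _; rewrite mulrA.
Qed.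

Lemma mean_cst {R : realType} (rho : R -> R) c : probability_density rho ->
  mean rho (fun=> c) = c.
Proof.
move=> dr; have [mrho rho0 rho1] := dr.
have h : mean rho (fun=> 1) = 1.
  rewrite /mean; transitivity (\int[@lebesgue_measure R]_x rho x).
    by apply: eq_Rintegral => x _; rewrite mul1r.
  by rewrite /Rintegral rho1.
transitivity (mean rho (fun=> c * 1)); first by rewrite mulr1.
by rewrite meanZ ?h ?mulr1//; exact: bmeas_cst.
Qed.

Lemma mean_le {R : realType} (rho f g : R -> R) : probability_density rho ->
  bmeas f -> bmeas g -> (forall x, f x <= g x) -> mean rho f <= mean rho g.
Proof.
move=> dr bf bg fg; apply: le_Rintegral => //; [exact: mean_integrable..|].
by move=> x _; case: dr => _ rho0 _; rewrite ler_wpM2r.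
Qed.

Lemma mean_ge0 {R : realType} (rho f : R -> R) : probability_density rho ->
  (forall x, 0 <= f x) -> 0 <= mean rho f.
Proof.
by move=> [_ r0 _] f0; apply: Rintegral_ge0 => x _; rewrite mulr_ge0.
Qed.

Lemma mean_norm_le {R : realType} (rho f g : R -> R) : probability_density rho ->
  bmeas f -> bmeas g -> (forall x, `|f x| <= g x) -> `|mean rho f| <= mean rho g.
Proof.
move=> dr bf bg fg; rewrite ler_norml; apply/andP; split.
  rewrite -mulN1r -meanZ//; apply: mean_le => //; first exact: bmeasZ.
  by move=> x; have := fg x; rewrite ler_norml mulN1r => /andP[].
by apply: mean_le => // x; have := fg x; rewrite ler_norml => /andP[].
Qed.

(** The same set function as [density_measure rho]; the proof that [rho] is a
    density is an argument so that the probability structure can be attached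
    canonically. *)
Definition density_prob {R : realType} (rho : R -> R)
    of probability_density rho : set (measurableTypeR R) -> \bar R :=
  density_measure rho.

Lemma density_prob0 {R : realType} (rho : R -> R) (dr : probability_density rho) :
  density_prob dr set0 = 0%E.
Proof. by rewrite /density_prob /density_measure integral_set0. Qed.

Lemma density_prob_ge0 {R : realType} (rho : R -> R) (dr : probability_density rho)
  A : (0 <= density_prob dr A)%E.
Proof.
by apply: integral_ge0 => x _; rewrite lee_fin; case: dr.
Qed.

Lemma density_prob_additive {R : realType} (rho : R -> R)
  (dr : probability_density rho) : semi_sigma_additive (density_prob dr).
Proof.
have [mrho rho0 rho1] := dr.
have irho : (@lebesgue_measure R).-integrable setT (EFin \o rho).
  have := mean_integrable dr (bmeas_cst 1); congr (integrable _ _ _).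
  by apply/funext => x /=; rewrite mul1r.
move=> /= A mA tA mUA; rewrite /density_prob /density_measure /=.
rewrite integral_bigcup//=; last exact: integrableS irho.
apply: is_cvg_ereal_nneg_natsum_cond => n _ _.
by apply: integral_ge0 => x _; rewrite lee_fin.
Qed.

HB.instance Definition _ (R : realType) (rho : R -> R)
    (dr : probability_density rho) :=
  isMeasure.Build _ _ _ (density_prob dr) (@density_prob0 R rho dr)
    (@density_prob_ge0 R rho dr) (@density_prob_additive R rho dr).

Lemma density_prob_setT {R : realType} (rho : R -> R)
  (dr : probability_density rho) : density_prob dr setT = 1%E.
Proof. by case: dr. Qed.

HB.instance Definition _ (R : realType) (rho : R -> R)
    (dr : probability_density rho) :=
  @Measure_isProbability.Build _ _ R (density_prob dr) (@density_prob_setT R rho dr).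

Lemma density_prob_dom {R : realType} (rho : R -> R)
  (dr : probability_density rho) : density_prob dr `<< @lebesgue_measure R.
Proof.
apply/null_content_dominatesP => A mA muA0; rewrite /density_prob /density_measure.
apply: null_set_integral => //.
by apply/measurable_funTS/measurable_EFinP; case: dr.
Qed.

Lemma bounded_integrable_prob {R : realType} (P : probability (measurableTypeR R) R)
  (f : R -> R) : bmeas f -> P.-integrable setT (EFin \o f).
Proof.
move=> [mf [M hM]]; apply: (@le_integrable _ _ _ _ _ measurableT _ (cst M%:E)).
- exact/measurable_EFinP.
- by move=> x _ /=; rewrite lee_fin (le_trans (hM x))// ler_norm.
- exact: finite_measure_integrable_cst.
Qed.

(** [rho] is, almost everywhere, the Radon-Nikodym derivative of the measure
    that it defines, so this is the change of variables formula for that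
    derivative. *)
Lemma density_measure_integral {R : realType} (rho f : R -> R) :
  probability_density rho -> bmeas f ->
  (\int[density_measure rho]_x (f x)%:E)%E = (mean rho f)%:E.
Proof.
move=> dr bf; rewrite -[density_measure rho]/(density_prob dr : set _ -> _).
have [mrho _ _] := dr; have [mf _] := bf.
rewrite -(Radon_Nikodym_change_of_variables (@density_prob_dom R rho dr))//=; last first.
  exact: (bounded_integrable_prob (density_prob dr)).
rewrite /mean /Rintegral fineK; last first.
  by apply: integrable_fin_num => //; exact: mean_integrable.
apply: ae_eq_integral => //.
- apply: emeasurable_funM; first exact/measurable_EFinP.
  apply: (measurable_int (@lebesgue_measure R)).
  by apply: Radon_Nikodym_integrable; exact: density_prob_dom.
- by apply/measurable_EFinP; exact: measurable_funM.
- rewrite (_ : (fun x => (f x * rho x)%:E) = (fun x => ((f x)%:E * (rho x)%:E)%E))//.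
  apply: ae_eqe_mul2l => /=.
  rewrite Radon_NikodymE//=; first exact: density_prob_dom.
  move=> abmu; case: cid => /= h [h1 h2 h3].
  apply: integral_ae_eq => //=.
  + exact/measurable_EFinP.
  + by move=> E _ mE; rewrite -h3.
Qed.

(** The function exp (lam t) (y t - g - del t) is nonincreasing: the error
    [del] enters without being divided by [lam], so that the case lam = 0 is
    included. *)
Lemma gronwall {R : realType} (y : R -> R) (lam g del T : R) :
  0 <= lam -> 0 <= del -> 0 <= T -> {within `[0, T], continuous y} ->
  (forall t, 0 < t < T -> exists2 y' : R, is_derive t (1 : R) y y' &
     y' <= - lam * (y t - g) + del) ->
  y T - g <= expR (- (lam * T)) * (y 0 - g) + del * T.
Proof.
move=> lam0 del0 T0 cy hy.
pose z t := expR (lam * t) * (y t - g - del * t).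
have dz t : 0 < t < T -> exists2 z' : R, is_derive t (1 : R) z z' & z' <= 0.
  move=> tT; have [y' dy y'le] := hy t tT.
  have h1 : is_derive t (1 : R) (fun s => lam * s) lam.
    by have := @is_deriveZ _ _ _ id lam t 1 1 (is_derive_id _ _); rewrite /GRing.scale /= mulr1.
  have h2 : is_derive t (1 : R) (fun s => del * s) del.
    by have := @is_deriveZ _ _ _ id del t 1 1 (is_derive_id _ _); rewrite /GRing.scale /= mulr1.
  have h3 := @is_derive1_comp _ expR _ t _ _ (is_derive_expR _) h1.
  have h4 := is_deriveB (is_deriveB dy (is_derive_cst g _ _)) h2.
  exists (expR (lam * t) * (y' - del) + (y t - g - del * t) * (expR (lam * t) * lam)).
    have := is_deriveM h3 h4; rewrite subr0; exact.
  rewrite (_ : _ + _ = expR (lam * t) * ((y' - del) + lam * (y t - g - del * t))); last by ring.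
  rewrite pmulr_rle0 ?expR_gt0//.
  have : 0 <= lam * (del * t) by rewrite !mulr_ge0// ltW//; case/andP: tT.
  by move: y'le; rewrite mulNr mulrBr; lra.
have cz : {within `[0, T], continuous z}.
  move=> x; apply: cvgM; last apply: cvgB; last 2 first.
  - by apply: cvgB; [exact: cy|exact: cvg_cst].
  - apply: continuous_subspaceT => {}x; apply: cvgMr; exact: cvg_id.
  apply: (continuous_subspaceT (f := fun s : R => expR (lam * s))) => {}x.
  apply: continuous_comp; last exact: continuous_expR.
  by apply: cvgMr; exact: cvg_id.
have : z T <= z 0.
  apply: (ler0_derive1_nincr _ _ cz) => //.
    by move=> t; rewrite in_itv /= => /dz[z' [? _]].
  move=> t; rewrite in_itv /= => /dz[z' dz' z'0].
  by rewrite derive1E (@derive_val _ _ _ _ _ _ _ dz').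
rewrite /z !mulr0 expR0 mul1r subr0 => h.
by rewrite expRN -lerBlDr [leRHS]mulrC ler_pdivlMr ?expR_gt0// mulrC.
Qed.

Lemma cst_outside_bounded {R : realType} (f : R -> R) (M : R) : 0 <= M ->
  continuous f -> (forall x, M < `|x| -> f x = f M \/ f x = f (- M)) ->
  exists K : R, forall x, `|f x| <= K.
Proof.
move=> M0 cf hf.
have cn : continuous (fun x => `|f x|).
  by move=> x; apply: continuous_comp; [exact: cf|exact: norm_continuous].
have MM : - M <= M by lra.
have [c _ hc] := EVT_max MM (continuous_subspaceT cn).
exists `|f c| => x; have [xM|/hf[]->] := leP `|x| M.
- by apply: hc; rewrite in_itv /= -ler_norml.
- by apply: hc; rewrite in_itv /= lexx MM.
- by apply: hc; rewrite in_itv /= lexx MM.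
Qed.

(** The weak equation only allows compactly supported test functions. A
    function taking the same constant value at both ends is such a test
    function plus that constant, and adding a constant changes the average by a
    constant because the total mass is conserved. *)
Lemma solution_derive {R : realType} (H : R -> R) (eps : R) rho rho0
    (phi w w' : R -> R) (M : R) :
  0 < eps -> solution H eps rho rho0 ->
  (forall x : R, is_derive x (1 : R) phi (w x)) ->
  (forall x : R, is_derive x (1 : R) w (w' x)) -> smooth w ->
  0 <= M -> (forall x, M <= `|x| -> w x = 0) -> phi M = phi (- M) ->
  forall t : R, 0 < t ->
    is_derive t (1 : R) (fun s => mean (rho s) phi)
      ((tau eps)^-1 *
       mean (rho t) (fun x => w' x - eps ^- 2 * derive1 H x * w x)).
Proof.
move=> eps0 [dens _ _ weak] dphi dw sw M0 w0 phiM t t0.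
have sphi : smooth phi by exact: smooth_primitive dphi sw.
have phi_out x : M < `|x| -> phi x = phi M.
  move=> Mx; have [x0|x0] := leP 0 x.
    have Mx' : M < x by rewrite ger0_norm in Mx.
    apply: (derive_cst_itv dphi (ltW Mx')) => y /andP[My _]; apply: w0.
    by rewrite (le_trans (ltW My))// ler_norm.
  have Mx' : x < - M by rewrite ltr0_norm// in Mx; lra.
  rewrite phiM; apply/esym; apply: (derive_cst_itv dphi (ltW Mx')) => y /andP[_ My].
  by apply: w0; rewrite -normrN (le_trans _ (ler_norm _))//; lra.
pose psi x := phi x + - phi M.
have tf : test_function psi.
  split; first exact (smoothD sphi (@smooth_cst R (- phi M))).
  by exists M => x /phi_out h; rewrite /psi h subrr.
have dpsi x : is_derive x (1 : R) psi (w x).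
  by rewrite -[w x]addr0; exact: is_deriveD.
have tau0 : tau eps != 0.
  by rewrite mulf_neq0 ?invr_eq0 ?expf_neq0 ?gt_eqF ?expR_gt0.
have bphi : bmeas phi.
  apply: bmeas_continuous; first exact: smooth_cont.
  by apply: (cst_outside_bounded M0 (smooth_cont sphi)) => x /phi_out ->; left.
have := weak _ tf t t0.
rewrite (_ : derive1n 2 psi = w'); last first.
  by rewrite /derive1n /= (is_derive_derive1 dpsi) (is_derive_derive1 dw).
rewrite (is_derive_derive1 dpsi) => h.
have h1 := @is_deriveZ _ _ _ _ (tau eps)^-1 _ _ _ h.
have h2 := is_deriveD h1 (is_derive_cst (phi M) t (1 : R)).
rewrite addr0 in h2.
apply: near_eq_is_derive h2.
near=> s.
have s0 : 0 < s by near: s; exact: lt_nbhsr.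
rewrite -[LHS]/((tau eps)^-1 * (tau eps * mean (rho s) psi) + phi M).
rewrite mulrA mulVf// mul1r /psi meanD ?mean_cst//; [|exact: dens (ltW s0)..|exact: bmeas_cst].
by rewrite subrK.
Unshelve. all: by end_near. Qed.

Lemma solution_continuous {R : realType} (H : R -> R) (eps : R) rho rho0
    (phi : R -> R) (T : R) :
  solution H eps rho rho0 -> continuous phi ->
  (exists M : R, forall x, `|phi x| <= M) ->
  {within `[0, T], continuous (fun s => mean (rho s) phi)}.
Proof.
move=> [dens _ cont _] cphi bphi.
have bm : bmeas phi by exact: bmeas_continuous.
apply/subspace_continuousP => t /=; rewrite in_itv /= => /andP[t0 tT].
have := cont t t0 phi cphi bphi.
rewrite density_measure_integral//; last exact: dens.
move=> h; apply: (@cvg_trans _ ((fun s => mean (rho s) phi) @ within [set s | 0 <= s] (nbhs t))).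
  apply: cvg_app => P; rewrite !nbhs_nearE !near_withinE; apply: filterS => s hs.
  by rewrite /= in_itv /= => /andP[s0 _]; exact: hs.
apply: cvg_trans (fine_cvg h); apply: near_eq_cvg.
rewrite near_withinE; near=> s => /= s0.
by rewrite density_measure_integral//; exact: dens.
Unshelve. all: by end_near. Qed.

(** * The double-well potential *)

Lemma is_derive_affine {R : realType} (f f' : R -> R) (a b : R) :
  (forall x : R, is_derive x (1 : R) f (f' x)) ->
  forall x : R, is_derive x (1 : R) (fun y => f (a * y + b)) (a * f' (a * x + b)).
Proof.
move=> ff' x.
have h : is_derive x (1 : R) (fun y : R => a * y + b) a.
  rewrite -[a in X in is_derive _ _ _ X]addr0; apply: is_deriveD.
  by have := @is_deriveZ _ _ _ id a x 1 1 (is_derive_id _ _); rewrite /GRing.scale /= mulr1.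
by rewrite mulrC; exact: (@is_derive1_comp _ f (fun y => a * y + b)).
Qed.

Lemma dw_derive {R : realType} (H : R -> R) : double_well H ->
  forall x : R, is_derive x (1 : R) H (derive1 H x).
Proof. by move=> /dw_smooth/smooth_derivative[]. Qed.

Lemma dw_smooth1 {R : realType} (H : R -> R) : double_well H -> smooth (derive1 H).
Proof. by move=> /dw_smooth/smooth_derivative[]. Qed.

Lemma dw_derive2 {R : realType} (H : R -> R) : double_well H ->
  forall x : R, is_derive x (1 : R) (derive1 H) (derive1n 2 H x).
Proof. by move=> /dw_smooth1/smooth_derivative[]. Qed.

Lemma dw_smooth2 {R : realType} (H : R -> R) : double_well H -> smooth (derive1n 2 H).
Proof. by move=> /dw_smooth1/smooth_derivative[]. Qed.

Lemma dw_derive_odd {R : realType} (H : R -> R) : double_well H ->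
  forall x, derive1 H (- x) = - derive1 H x.
Proof.
move=> dw x; have h := is_derive_reflect (dw_derive dw) x.
rewrite (_ : (fun y => H (- y)) = H) in h; last by apply/funext => y; exact: dw_even.
have := @derive_val _ _ _ _ _ _ _ h.
by rewrite -derive1E => ->; rewrite opprK.
Qed.

Lemma dw_derive2_even {R : realType} (H : R -> R) : double_well H ->
  forall x, derive1n 2 H (- x) = derive1n 2 H x.
Proof.
move=> dw x; have h := is_derive_reflect (dw_derive2 dw) x.
rewrite (_ : (fun y => derive1 H (- y)) = (fun y => - derive1 H y)) in h; last first.
  by apply/funext => y; exact: dw_derive_odd.
by apply: oppr_inj; exact: (derive_unique h (is_deriveN (dw_derive2 dw x))).
Qed.

Lemma dw_derive_lt0 {R : realType} (H : R -> R) : double_well H ->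
  forall x, 0 < x < 1 -> derive1 H x < 0.
Proof.
move=> dw x /andP[x0 x1]; have := dw_inner dw (x := x).
by rewrite !gtr0_norm// => /(_ x0 x1); rewrite pmulr_rlt0.
Qed.

Lemma dw_derive_gt0 {R : realType} (H : R -> R) : double_well H ->
  forall x, 1 < x -> 0 < derive1 H x.
Proof.
move=> dw x x1; have x0 : 0 < x by exact: lt_trans x1.
by have := dw_outer dw (x := x); rewrite !gtr0_norm// => /(_ x1); rewrite pmulr_rgt0.
Qed.

Lemma dw_incr {R : realType} (H : R -> R) : double_well H ->
  forall x y, 1 <= x -> x < y -> H x < H y.
Proof.
move=> dw x y x1 xy; apply: (derive_ltr (dw_derive dw) xy) => z /andP[xz _].
by apply: (dw_derive_gt0 dw); exact: le_lt_trans xz.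
Qed.

Lemma dw_decr {R : realType} (H : R -> R) : double_well H ->
  forall x y, 0 <= x -> x < y -> y <= 1 -> H y < H x.
Proof.
move=> dw x y x0 xy y1; rewrite -ltrN2.
have dN z : is_derive z (1 : R) (fun z => - H z) (- derive1 H z).
  by apply: is_deriveN; exact: dw_derive.
apply: (derive_ltr dN xy) => z /andP[xz zy].
rewrite oppr_gt0; apply: (dw_derive_lt0 dw).
by rewrite (le_lt_trans x0 xz) (lt_le_trans zy y1).
Qed.

Lemma dw_gt0 {R : realType} (H : R -> R) : double_well H ->
  forall x, 0 <= x -> x != 1 -> 0 < H x.
Proof.
move=> dw x x0; have [H1 _] := dw_wells dw.
rewrite neq_lt => /orP[x1|x1]; rewrite -H1; first exact: dw_decr.
exact: dw_incr.
Qed.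

Lemma dw_lt1 {R : realType} (H : R -> R) : double_well H ->
  forall x, 0 < x < 2 -> H x < 1.
Proof.
move=> dw x /andP[x0 x2]; have [H0 H2 _] := dw_level1 dw.
have [x1|x1] := leP x 1; first by rewrite -H0; exact: dw_decr.
by rewrite -H2; apply: dw_incr => //; exact: ltW.
Qed.

Lemma dw_le_max {R : realType} (H : R -> R) : double_well H ->
  forall a b x, 0 <= a -> a <= 1 -> 1 <= b -> a <= x <= b ->
  H x <= Num.max (H a) (H b).
Proof.
move=> dw a b x a0 a1 b1 /andP[ax xb]; rewrite le_max.
have [x1|x1] := leP x 1.
  move: ax; rewrite le_eqVlt => /predU1P[->|ax]; first by rewrite lexx.
  by rewrite (ltW (dw_decr dw a0 ax x1)).
move: xb; rewrite le_eqVlt => /predU1P[->|xb]; first by rewrite lexx orbT.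
by rewrite (ltW (dw_incr dw (ltW x1) xb)) orbT.
Qed.

(** Coefficient of the quadratic part of H at the wells; the integrals below
    are therefore asymptotic to Gaussian integrals with this parameter. *)
Definition well_quad {R : realType} (H : R -> R) : R := derive1n 2 H 1 / 2.
Definition barrier_quad {R : realType} (H : R -> R) : R := - derive1n 2 H 0 / 2.

Lemma laplace_barrier {R : realType} (H : R -> R) : double_well H ->
  prim (fun x => expR (- ((1 - H x) / eps ^+ 2))) (1/2) / eps @[eps --> 0^'+]
    --> Num.sqrt pi / (2 * Num.sqrt (barrier_quad H)).
Proof.
move=> dw; have [H0 _ _] := dw_level1 dw; have [_ _ H'0] := dw_critical dw.
have [H''0 _ _] := dw_hessian dw.
have cH := is_derive_cont (dw_derive dw).
apply: (@laplace _ (fun x => 1 - H x)).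
- by move=> x; apply: cvgB; [exact: cvg_cst|exact: cH].
- by rewrite divr_gt0// oppr_gt0.
- by rewrite divr_gt0.
- have d1 (x : R) : is_derive x (1 : R) (fun y => 1 - H y) (- derive1 H x).
    have := is_deriveB (is_derive_cst (1 : R) x (1 : R)) (dw_derive dw x).
    by rewrite sub0r.
  apply: (quadratic_approx d1); last 2 first.
  + by rewrite H0 subrr.
  + by rewrite H'0 oppr0.
  + by apply: is_deriveN; exact: dw_derive2.
- move=> x /andP[x0 x12]; rewrite subr_gt0; apply: (dw_lt1 dw); rewrite x0; lra.
Qed.

(** Each side of the well is treated separately, s = 1 for the right and s = -1
    for the left half. *)
Lemma laplace_well {R : realType} (H : R -> R) (s r : R) : double_well H ->
  s = 1 \/ s = -1 -> 0 < r < 1 ->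
  prim (fun x => expR (- (H (s * x + 1) / eps ^+ 2))) r / eps @[eps --> 0^'+]
    --> Num.sqrt pi / (2 * Num.sqrt (well_quad H)).
Proof.
move=> dw s1 /andP[r0 r1]; have [H1 _] := dw_wells dw; have [H'1 _ _] := dw_critical dw.
have [_ H''1 _] := dw_hessian dw.
have cH := is_derive_cont (dw_derive dw).
have d1 := is_derive_affine s 1 (dw_derive dw).
apply: (@laplace _ (fun x => H (s * x + 1))).
- exact: is_derive_cont d1.
- by rewrite divr_gt0.
- by [].
- apply: (quadratic_approx d1); last 2 first.
  + by rewrite mulr0 add0r.
  + by rewrite mulr0 add0r H'1 mulr0.
  + have := @is_deriveZ _ _ _ _ s _ _ _
      (is_derive_affine s 1 (dw_derive2 dw) 0).
    rewrite mulr0 add0r => h; apply: is_derive_eq h _.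
    by rewrite /GRing.scale /=; case: s1 => ->; lra.
- move=> x /andP[x0 xr]; apply: (dw_gt0 dw).
    by case: s1 => ->; lra.
  by rewrite -subr_eq0 addrK; case: s1 => ->; rewrite ?mulN1r ?mul1r ?oppr_eq0 gt_eqF.
Qed.

(** * The generator, and a barrier against escape to infinity *)

Lemma is_derive_scale {R : realType} (f : R -> R) (x c df : R) :
  is_derive x (1 : R) f df -> is_derive x (1 : R) (fun y => c * f y) (c * df).
Proof. exact: is_deriveZ. Qed.

(** The formal adjoint phi'' - eps ^- 2 H' phi' of the operator in the
    equation, as a function of the first two derivatives [w] and [w'] of
    phi. *)
Definition generator {R : realType} (H : R -> R) (eps : R) (w w' : R -> R) (x : R) : R :=
  w' x - eps ^- 2 * derive1 H x * w x.

Lemma tau_gt0 {R : realType} (eps : R) : 0 < eps -> 0 < tau eps.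
Proof. by move=> eps0; rewrite mulr_gt0 ?invr_gt0 ?exprn_gt0 ?expR_gt0. Qed.

Lemma smooth_weight {R : realType} (H : R -> R) (eps : R) : smooth H ->
  smooth (fun x => expR (H x / eps ^+ 2)).
Proof.
move=> sH; apply: smooth_exp.
by apply: (@smoothM _ H (fun=> _)) => //; exact: smooth_cst.
Qed.

(** The generator in divergence form: if phi' = P exp (H / eps ^+ 2), then it
    sends phi to P' exp (H / eps ^+ 2). Test functions are therefore built by
    choosing the flux P. *)
Lemma derive_weighted {R : realType} (H P P' : R -> R) (eps : R) : double_well H ->
  (forall x : R, is_derive x (1 : R) P (P' x)) ->
  forall x : R, is_derive x (1 : R) (fun x => P x * expR (H x / eps ^+ 2))
    ((P' x + eps ^- 2 * derive1 H x * P x) * expR (H x / eps ^+ 2)).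
Proof.
move=> dw dP x.
have h1 : is_derive x (1 : R) (fun x => H x / eps ^+ 2) (derive1 H x / eps ^+ 2).
  rewrite mulrC (_ : (fun x => _) = fun x => eps ^- 2 * H x).
    by apply: is_derive_scale; exact: dw_derive.
  by apply/funext => y; rewrite mulrC.
have h2 := @is_derive1_comp _ expR _ x _ _ (is_derive_expR _) h1.
have h3 := is_deriveM (dP x) h2; apply: is_derive_eq h3 _.
by rewrite /GRing.scale /=; ring.
Qed.

(** Mass far outside the wells cannot build up on the time scale tau, because
    the potential there exceeds the barrier height 1. Take psi' = chi exp (H /
    eps ^+ 2) / N with a cutoff chi rising on [a, a1], equal to 1 on [3, 4] and
    decreasing to 0 on [4, 5], and N normalising psi to 1 at infinity. By
    [derive_weighted] the generator sends psi to chi' exp (H / eps ^+ 2) / N,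
    which is positive only on [a, a1]. There it is at most of order exp (-(H 3
    - H a1) / eps ^+ 2), since N >= exp (H 3 / eps ^+ 2); this is o (tau)
    because H 3 - H a1 > 1. *)
Lemma tail_function {R : realType} (H : R -> R) : double_well H ->
  exists a m K : R, [/\ 1 < a < 5/4, 0 < m, 0 <= K &
    forall eps : R, 0 < eps -> exists psi w w' : R -> R,
    [/\ forall x : R, is_derive x (1 : R) psi (w x),
        forall x : R, is_derive x (1 : R) w (w' x),
        smooth w,
        forall x, (x <= a) || (5 <= x) -> w x = 0 &
    [/\ forall x, x <= a -> psi x = 0,
        forall x, 5 <= x -> psi x = 1,
        forall x, 0 <= psi x <= 1 &
        forall x, generator H eps w w' x <=
                  tau eps * (K * eps ^+ 2 * expR (- (m / eps ^+ 2)))]]].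
Proof.
move=> dw.
have cH := is_derive_cont (dw_derive dw).
have [H1 _] := dw_wells dw; have [_ H2 _] := dw_level1 dw.
have H3 : 1 < H 3 by rewrite -H2; apply: (dw_incr dw); lra.
(* H 3 > 1 while H 1 = 0, so a point a1 slightly beyond the well still
   satisfies H a1 < H 3 - 1. *)
have [a1 /andP[a11 a1l] Ha1] : exists2 a1 : R, 1 < a1 < 5/4 & H a1 < H 3 - 1.
  have : \forall y \near (1 : R), H y < H 3 - 1.
    by apply: (cvgr_lt _ (cH 1)); rewrite H1; lra.
  move=> [d /= d0 hd]; pose e := Num.min (d / 2) (1 / 8).
  have e0 : 0 < e by rewrite lt_min !divr_gt0.
  have e1 : e <= 1 / 8 by rewrite ge_min lexx orbT.
  have e2 : e <= d / 2 by rewrite ge_min lexx.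
  exists (1 + e); first by apply/andP; split; lra.
  by apply: hd; rewrite /= opprD addNKr normrN gtr0_norm//; lra.
pose a := (1 + a1) / 2; pose al := (a1 - a)^-1; pose be := - a * al.
have a1a : a < a1 by rewrite /a; lra.
have a_gt1 : 1 < a by rewrite /a; lra.
have al0 : 0 < al by rewrite invr_gt0 subr_gt0.
have arg_le0 x : x <= a -> al * x + be <= 0.
  by move=> xa; rewrite /be mulNr (mulrC a) -mulrBr pmulr_rle0// subr_le0.
have arg_ge1 x : a1 <= x -> 1 <= al * x + be.
  move=> xa; rewrite /be mulNr (mulrC a) -mulrBr /al mulrC ler_pdivlMr ?subr_gt0//.
  by rewrite mul1r lerD2r.
pose N0 := prim (@bell R) 1; have N0_gt0 : 0 < N0 := bell_mass_gt0.
pose ds (x : R) := bell x / N0.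
have ds_ge0 x : 0 <= ds x by rewrite divr_ge0 ?bell_ge0 ?(ltW N0_gt0).
have ds_le x : ds x <= N0^-1 by rewrite ler_pdivrMr// mulVf ?gt_eqF// bell_le1.
have ds_eq0 x : (x <= 0) || (1 <= x) -> ds x = 0.
  by move=> hx; rewrite /ds bell_eq0// mul0r.
pose chi x := step (al * x + be) * step (-1 * x + 5).
pose chi' x := step (al * x + be) * (-1 * ds (-1 * x + 5)) +
               step (-1 * x + 5) * (al * ds (al * x + be)).
have dchi x : is_derive x (1 : R) chi (chi' x).
  have h1 := is_derive_affine al be (@step_derive R) x.
  have h2 := is_derive_affine (-1) 5 (@step_derive R) x.
  exact: is_deriveM h1 h2.
have schi : smooth chi.
  by apply: smoothM; apply: smooth_affine; exact: smooth_step.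
have chi_ge0 x : 0 <= chi x by rewrite mulr_ge0// step_ge0.
have chi_eq0 x : (x <= a) || (5 <= x) -> chi x = 0.
  move=> /orP[/arg_le0 xa|x5]; first by rewrite /chi step_eq0// mul0r.
  by rewrite /chi [step (-1 * x + 5)]step_eq0 ?mulr0//; lra.
have chi_eq1 x : 3 <= x <= 4 -> chi x = 1.
  move=> /andP[x3 x4]; rewrite /chi !step_eq1 ?mulr1//; first by lra.
  by apply: arg_ge1; lra.
have chi'_le x : chi' x <= al / N0.
  rewrite /chi'; have h1 : 0 <= step (al * x + be) * ds (-1 * x + 5).
    by rewrite mulr_ge0// step_ge0.
  have h2 : step (-1 * x + 5) * (al * ds (al * x + be)) <= 1 * (al / N0).
    apply: ler_pM; rewrite ?step_ge0 ?step_le1//; first by rewrite mulr_ge0// ltW.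
    by rewrite ler_wpM2l// ltW.
  by lra.
have chi'_left x : x <= a -> chi' x = 0.
  move=> /arg_le0 xa; rewrite /chi' [step (al * x + be)]step_eq0// [ds (al * x + be)]ds_eq0 ?xa//.
  by rewrite mul0r !mulr0 addr0.
have chi'_right x : a1 <= x -> chi' x <= 0.
  move=> /arg_ge1 xa; rewrite /chi' [ds (al * x + be)]ds_eq0 ?xa ?orbT//.
  rewrite !mulr0 addr0 mulN1r mulrN oppr_le0 mulr_ge0// step_ge0//.
exists a, (H 3 - 1 - H a1), (al / N0); split.
- by rewrite a_gt1 /= /a; lra.
- by lra.
- by rewrite divr_ge0// ltW.
move=> eps eps0.
have eps2 : 0 < eps ^+ 2 by rewrite exprn_gt0.
pose E x := expR (H x / eps ^+ 2).
have sE : smooth E by exact: smooth_weight (dw_smooth dw).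
pose g x := chi x * E x.
have sg : smooth g by exact: smoothM.
have g_ge0 x : 0 <= g x by rewrite mulr_ge0// expR_ge0.
have dprim := prim_derive (smooth_cont sg).
have prim_mono x y : x <= y -> prim g x <= prim g y.
  by move=> xy; apply: (derive_ler dprim xy).
have prim_left x : x <= a -> prim g x = 0.
  move=> xa; rewrite -(prim0 g).
  rewrite -(derive_cst_itv dprim xa) => [|y /andP[_ ya]].
    apply: (derive_cst_itv dprim) => [|y /andP[_ ya]].
      by rewrite (le_trans ler01)// ltW.
    by rewrite /g chi_eq0 ?mul0r// ltW.
  by rewrite /g chi_eq0 ?mul0r// ltW.
pose N := prim g 5.
have prim_right x : 5 <= x -> prim g x = N.
  move=> x5; apply: (derive_cst_itv dprim x5) => y /andP[y5 _].
  by rewrite /g chi_eq0 ?mul0r// (ltW y5) orbT.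
have E_gt0 x : 0 < E x by exact: expR_gt0.
(* H is increasing beyond 1, so the integrand is at least E 3 on [3, 4], where
   chi = 1. *)
have NE : E 3 <= N.
  have d3 x : is_derive x (1 : R) (fun y => E 3 * y) (E 3).
    by rewrite -[X in is_derive _ _ _ X]mulr1; apply: is_derive_scale; exact: is_derive_id.
  have := derive_ler2 d3 dprim (_ : 3 <= 4) _.
  have -> : E 3 * 4 - E 3 * 3 = E 3 by ring.
  move=> h; have {h} : E 3 <= prim g 4 - prim g 3.
    apply: h; first by lra.
    move=> x /andP[x3 x4]; rewrite /g chi_eq1 ?mul1r ?(ltW x3) ?(ltW x4)//.
    rewrite ler_expR ler_pM2r ?invr_gt0//; apply/ltW/(dw_incr dw) => //; lra.
  have h3 : 0 <= prim g 3 by rewrite -(prim_left a)//; apply: prim_mono; lra.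
  have h4 : prim g 4 <= N by apply: prim_mono; lra.
  by lra.
have N_gt0 : 0 < N by exact: lt_le_trans NE.
have Nn0 : N != 0 by rewrite gt_eqF.
pose w x := N^-1 * g x.
exists (fun x => N^-1 * prim g x), w,
  (fun x => N^-1 * ((chi' x + eps ^- 2 * derive1 H x * chi x) * E x)).
split; [..|split].
- by move=> x; apply: is_derive_scale; exact: dprim.
- by move=> x; apply: is_derive_scale; exact: (derive_weighted _ dw dchi).
- exact: smoothZ.
- by move=> x hx; rewrite /w /g chi_eq0// mul0r mulr0.
- by move=> x xa; rewrite prim_left// mulr0.
- by move=> x x5; rewrite prim_right// mulVf.
- move=> x; have p0 : 0 <= prim g x.
    by have [xa|xa] := leP x a; [rewrite prim_left|rewrite -(prim_left a)//; apply/prim_mono/ltW].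
  have pN : prim g x <= N.
    by have [xa|xa] := leP 5 x; [rewrite prim_right|apply/prim_mono/ltW].
  by rewrite mulr_ge0// ?invr_ge0 ?(ltW N_gt0)//= mulrC ler_pdivrMr// mul1r.
move=> x; rewrite /generator /w /g.
rewrite (_ : _ - _ = N^-1 * (chi' x * E x)); last by ring.
have RHS0 : 0 <= tau eps * (al / N0 * eps ^+ 2 * expR (- ((H 3 - 1 - H a1) / eps ^+ 2))).
  rewrite mulr_ge0 ?(ltW (tau_gt0 eps0))// mulr_ge0 ?expR_ge0//.
  by rewrite mulr_ge0 ?(ltW eps2)// divr_ge0 ?(ltW al0) ?(ltW N0_gt0).
have [xa|xa] := leP x a; first by rewrite chi'_left// mul0r mulr0.
have [xa1|xa1] := leP a1 x.
  apply: le_trans RHS0; rewrite pmulr_rle0 ?invr_gt0//.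
  by rewrite pmulr_lle0//; exact: chi'_right.
apply: (@le_trans _ _ (N^-1 * (al / N0 * E a1))).
  rewrite ler_pM2l ?invr_gt0//; apply: (@le_trans _ _ (al / N0 * E x)).
    by rewrite ler_pM2r.
  rewrite ler_pM2l ?divr_gt0// ler_expR ler_pM2r ?invr_gt0//.
  by apply/ltW/(dw_incr dw) => //; lra.
apply: (@le_trans _ _ ((E 3)^-1 * (al / N0 * E a1))).
  apply: ler_wpM2r; last by rewrite lef_pV2 ?posrE.
  by rewrite mulr_ge0 ?divr_ge0 ?(ltW al0) ?(ltW N0_gt0) ?(ltW (E_gt0 _)).
rewrite /tau /E -expRN.
rewrite [leRHS](_ : _ = al / N0 *
  (expR (- eps ^- 2) * expR (- ((H 3 - 1 - H a1) / eps ^+ 2)))); last first.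
  by field; rewrite !gt_eqF.
rewrite mulrCA -!expRD le_eqVlt; apply/orP; left; apply/eqP.
congr (_ * expR _); ring.
Qed.

(** * A Lyapunov function for concentration at the wells *)

Lemma continuous_max {R : realType} (f g : R -> R) : continuous f -> continuous g ->
  continuous (fun x => Num.max (f x) (g x)).
Proof.
move=> cf cg x.
have -> : (fun x => Num.max (f x) (g x)) = (fun x => (f x + g x + `|f x - g x|) / 2).
  by apply/funext => y; rewrite maxr_absE.
apply: cvgMl; apply: cvgD; first by apply: cvgD; [exact: cf|exact: cg].
by apply: cvg_norm; apply: cvgB; [exact: cf|exact: cg].
Qed.

(** The maximum of the continuous functions G and delta - D is positive on a
    compact interval, hence bounded below by some m > 0. Where G >= m the
    penalty dominates for small eps, and elsewhere D itself is at most
    delta. *)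
Lemma penalised_bound {R : realType} (D G : R -> R) (a b delta : R) : a <= b ->
  continuous D -> continuous G ->
  (forall x, a <= x <= b -> 0 <= G x) ->
  (forall x, a <= x <= b -> 0 < G x \/ D x < delta) ->
  \forall eps \near 0^'+, forall x, a <= x <= b -> D x - eps ^- 2 * G x <= delta.
Proof.
move=> ab cD cG G0 GD.
have cm : continuous (fun x => Num.max (G x) (delta - D x)).
  apply: continuous_max => // x; apply: cvgB; [exact: cvg_cst|exact: cD].
have [c + hc] := EVT_min ab (continuous_subspaceT cm).
rewrite in_itv /= => cab; set m := Num.max _ _ in hc.
have m0 : 0 < m.
  by rewrite lt_max; case: (GD c cab) => [->//|?]; apply/orP; right; rewrite subr_gt0.
have [d _ hd] := EVT_max ab (continuous_subspaceT cD).
pose K := `|D d - delta| + 1; have K0 : 0 < K by rewrite ltr_wpDl.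
near=> eps => x xab.
have eps0 : 0 < eps by near: eps; exact: nbhs_right_gt.
have eps1 : eps <= 1 by near: eps; apply: nbhs_right_le; exact: ltr01.
have epsm : eps <= m / K by near: eps; apply: nbhs_right_le; rewrite divr_gt0.
have i1 : K / m <= eps ^- 2.
  rewrite -(invf_div m K) lef_pV2 ?posrE ?divr_gt0 ?exprn_gt0//.
  by apply: le_trans epsm; rewrite expr2 ler_piMr// ltW.
have xi : x \in `[a, b]%R by rewrite in_itv.
have := hc x xi; rewrite le_max => /orP[Gm|Dm].
  have h1 : K <= eps ^- 2 * G x.
    have -> : K = K / m * m by rewrite divfK// gt_eqF.
    by apply: ler_pM => //; rewrite ?divr_ge0// ltW.
  have := hd x xi; have := ler_norm (D d - delta); rewrite /K in h1; lra.
have : 0 <= eps ^- 2 * G x by rewrite mulr_ge0 ?G0// invr_ge0 sqr_ge0.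
by lra.
Unshelve. all: by end_near. Qed.

(** The Lyapunov function is H ^+ 2, modified beyond |x| = 5 and constant
    beyond |x| = 6 so that it can be tested. The square matters: the generator
    sends H ^+ 2 to 2 (H H'' + H' ^+ 2) - eps ^- 2 * 2 H H' ^+ 2, whose first
    part vanishes at the wells, whereas H itself would leave H'' > 0 there. At
    the barrier top, where the penalty degenerates as well, H'' 0 < 0 makes the
    first part negative. Everywhere else H H' ^+ 2 > 0 and the penalty wins as
    eps -> 0. Beyond |x| = 5 only a crude bound is available; the mass there is
    controlled by [tail_function]. *)
Lemma concentration_function {R : realType} (H : R -> R) : double_well H ->
  exists f w w' : R -> R, exists lam C : R,
  [/\ [/\ forall x : R, is_derive x (1 : R) f (w x),
          forall x : R, is_derive x (1 : R) w (w' x),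
          smooth w,
          forall x, 6 <= `|x| -> w x = 0 &
          f 6 = f (- 6)],
      [/\ 0 < lam, forall x, `|x| <= 5 -> f x = H x ^+ 2,
          forall x, 5 <= `|x| -> H 5 ^+ 2 <= f x &
          forall x, 0 <= f x <= C],
      forall eps, 0 < eps -> forall x, generator H eps w w' x <= C &
      forall delta, 0 < delta -> \forall eps \near 0^'+, forall x, `|x| <= 5 ->
        generator H eps w w' x <= - lam * f x + delta].
Proof.
move=> dw.
have dH := dw_derive dw; have dH' := dw_derive2 dw.
have cH := is_derive_cont dH; have cH' := is_derive_cont dH'.
have cH'' := smooth_cont (dw_smooth2 dw).
pose H' : R -> R := derive1 H; pose H'' : R -> R := derive1n 2 H.
pose N0 := prim (@bell R) 1; have N0_gt0 : 0 < N0 := bell_mass_gt0.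
pose ds (x : R) := bell x / N0.
have ds_eq0 x : (x <= 0) || (1 <= x) -> ds x = 0.
  by move=> hx; rewrite /ds bell_eq0// mul0r.
pose et (x : R) : R := step (-1 * x + 6) * step (1 * x + 6).
pose et' (x : R) : R := step (-1 * x + 6) * (1 * ds (1 * x + 6)) +
              step (1 * x + 6) * (-1 * ds (-1 * x + 6)).
have det x : is_derive x (1 : R) et (et' x).
  have h1 := is_derive_affine (-1) 6 (@step_derive R) x.
  have h2 := is_derive_affine 1 6 (@step_derive R) x.
  exact: is_deriveM h1 h2.
have smooth_et : smooth et by apply: smoothM; apply: smooth_affine; exact: smooth_step.
have et_ge0 x : 0 <= et x by rewrite mulr_ge0// step_ge0.
have et_eq1 x : `|x| <= 5 -> et x = 1.
  by rewrite ler_norml => /andP[x5 x5']; rewrite /et !step_eq1 ?mulr1//; lra.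
have et'_eq0 x : `|x| <= 5 -> et' x = 0.
  rewrite ler_norml => /andP[x5 x5'].
  by rewrite /et' !ds_eq0 ?mulr0 ?addr0//; apply/orP; right; lra.
have et_eq0 x : 6 <= `|x| -> et x = 0.
  rewrite ler_normr /et => /orP[h|h]; first by rewrite step_eq0 ?mul0r//; lra.
  by rewrite [step (1 * x + 6)]step_eq0 ?mulr0//; lra.
have et'_out x : 6 <= `|x| -> et' x = 0.
  rewrite ler_normr /et' => /orP[h|h].
    by rewrite [step (-1 * x + 6)]step_eq0 ?[ds (-1 * x + 6)]ds_eq0 ?mul0r ?mulr0 ?addr0//;
      try (apply/orP; left); lra.
  by rewrite [step (1 * x + 6)]step_eq0 ?[ds (1 * x + 6)]ds_eq0 ?mul0r ?mulr0 ?addr0//;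
    try (apply/orP; left); lra.
have et_even x : et (- x) = et x.
  by rewrite /et mulrC !mul1r !mulN1r opprK.
pose w (x : R) : R := 2 * (H x * H' x) * et x.
pose w' (x : R) : R := 2 * (H x * H' x) * et' x + et x * (2 * (H x * H'' x + H' x * H' x)).
have dHH' x : is_derive x (1 : R) (fun y => 2 * (H y * H' y)) (2 * (H x * H'' x + H' x * H' x)).
  by apply: is_derive_scale; exact: is_deriveM.
have dw' x : is_derive x (1 : R) w (w' x) by exact: is_deriveM.
have sw : smooth w.
  apply: smoothM => //; apply: smoothZ; apply: smoothM.
    exact: dw_smooth dw.
  exact: dw_smooth1.
have w_eq0 x : 6 <= `|x| -> w x = 0 by move=> /et_eq0 h; rewrite /w h mulr0.
have w_odd x : w (- x) = - w x.
  by rewrite /w et_even dw_even// /H' dw_derive_odd//; ring.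
have w_ge0 x : 1 <= x -> 0 <= w x.
  move=> x1; apply: mulr_ge0 => //; apply: mulr_ge0 => //; apply: mulr_ge0.
    exact: dw_ge0.
  move: x1; rewrite le_eqVlt => /predU1P[<-|x1].
    by have [h _ _] := dw_critical dw; rewrite /H' h.
  exact/ltW/(dw_derive_gt0 dw).
(* The constant makes f 0 = 1 = H 0 ^+ 2. *)
pose f (x : R) : R := prim w x + (1 - prim w 0).
have H0 : H 0 = 1 by have [] := dw_level1 dw.
have df x : is_derive x (1 : R) f (w x).
  rewrite -[w x]addr0.
  exact: (is_deriveD (prim_derive (smooth_cont sw) x) (is_derive_cst _ x (1 : R))).
have f_even x : f (- x) = f x.
  wlog x0 : x / 0 <= x.
    move=> h; have [x0|x0] := leP 0 x; first exact: h.
    by rewrite -{2}[x]opprK; apply/esym/h; rewrite oppr_ge0 ltW.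
  have dN := is_derive_reflect df.
  have dd y : is_derive y (1 : R) (fun y => f y - f (- y)) (w y - - w (- y)).
    by apply: is_deriveB.
  have := derive_cst_itv dd x0; rewrite oppr0 subrr => h.
  by apply/esym/eqP; rewrite -subr_eq0; apply/eqP/h => y _; rewrite w_odd opprK subrr.
have f_in x : `|x| <= 5 -> f x = H x ^+ 2.
  wlog x0 : x / 0 <= x.
    move=> h hx; have [x0|x0] := leP 0 x; first exact: h.
    by rewrite -f_even -(dw_even dw); apply: h; rewrite ?normrN// oppr_ge0 ltW.
  rewrite ger0_norm// => x5.
  have d2 y : is_derive y (1 : R) (fun y => H y ^+ 2) (2 * (H y * H' y)).
    have := is_deriveM (dH y) (dH y); rewrite /GRing.scale /= => h.
    by apply: is_derive_eq h _; rewrite -/(H' y); ring.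
  have f0 : f 0 = 1 by rewrite /f addrC subrK.
  have := derive_eqr df d2 x0; rewrite H0 f0 expr1n => h.
  suff : f x - 1 = H x ^+ 2 - 1 by lra.
  apply: h => y /andP[y0 yx]; rewrite /w et_eq1 ?mulr1// gtr0_norm//; lra.
have f_out x : 5 <= `|x| -> H 5 ^+ 2 <= f x.
  wlog x0 : x / 0 <= x.
    move=> h hx; have [x0|x0] := leP 0 x; first exact: h.
    by rewrite -f_even; apply: h; rewrite ?normrN// oppr_ge0 ltW.
  rewrite ger0_norm// => x5; rewrite -f_in; last by rewrite ger0_norm.
  by apply: (derive_ler df x5) => y /andP[y5 _]; apply: w_ge0; lra.
have f_ge0 x : 0 <= f x.
  have [h|h] := leP `|x| 5; first by rewrite f_in// sqr_ge0.
  by apply: le_trans (f_out _ (ltW h)); rewrite sqr_ge0.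
have [C1 fC] : exists C1 : R, forall x, `|f x| <= C1.
  apply: (@cst_outside_bounded _ _ 6) => //; first exact: is_derive_cont df.
  move=> x; rewrite lter_normr => /orP[x6|x6]; [left|right].
    by apply: (derive_cst_itv df (ltW x6)) => y /andP[y6 _];
      rewrite w_eq0// (le_trans (ltW y6))// ler_norm.
  have x6' : x <= - 6 by lra.
  apply/esym/(derive_cst_itv df x6') => y /andP[_ y6].
  by rewrite w_eq0// ler_normr; apply/orP; right; lra.
have [C2 w'C] : exists C2 : R, forall x, `|w' x| <= C2.
  apply: (@cst_outside_bounded _ _ 7) => //.
    by apply: smooth_cont; have [+ _] := smooth_derivative sw; rewrite (is_derive_derive1 dw').
  have w'_out x : 6 <= `|x| -> w' x = 0.
    by move=> x6; rewrite /w' et'_out// et_eq0// mulr0 mul0r addr0.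
  move=> x x7; left; rewrite !w'_out ?(le_trans _ (ltW x7))//; last by lra.
  by rewrite ger0_norm; lra.
(* Near 0 the first part is at most -c0 / 4 while lam * H ^+ 2 <= lam, hence
   the choice lam = c0 / 4. *)
pose c0 := - H'' 0; have c00 : 0 < c0 by rewrite oppr_gt0; have [] := dw_hessian dw.
pose lam := c0 / 4.
have lam0 : 0 < lam by rewrite divr_gt0.
pose D (x : R) : R := 2 * (H x * H'' x + H' x * H' x) + lam * H x ^+ 2.
pose G (x : R) : R := 2 * (H x * (H' x * H' x)).
have G_ge0 x : 0 <= G x.
  by apply: mulr_ge0 => //; apply: mulr_ge0; [exact: dw_ge0|rewrite -expr2 sqr_ge0].
have genE eps x : `|x| <= 5 ->
    generator H eps w w' x + lam * f x = D x - eps ^- 2 * G x.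
  move=> x5; rewrite /generator /w /w' f_in// et'_eq0// et_eq1// /D /G -/(H' x).
  by ring.
exists f, w, w', lam, (Num.max C1 C2); split => //.
- split=> // x; rewrite f_ge0 le_max; apply/orP; left.
  by rewrite (le_trans (ler_norm _)).
- move=> eps eps0 x; rewrite le_max; apply/orP; right.
  apply: le_trans (w'C x); apply: le_trans (ler_norm _).
  rewrite /generator gerBl /w -/(H' x).
  rewrite (_ : _ * _ = eps ^- 2 * (G x * et x)); last by rewrite /G; ring.
  by rewrite mulr_ge0 ?invr_ge0 ?sqr_ge0// mulr_ge0.
move=> delta delta0.
have [r0 /andP[r00 r01] hr0] : exists2 r0 : R, 0 < r0 < 1 & forall x, 0 <= x < r0 -> D x <= 0.
  have n1 : \forall y \near (0 : R), H'' y < - (c0 / 2).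
    by apply: (cvgr_lt _ (cH'' 0)); rewrite -/H'' /c0; rewrite /c0 in c00; lra.
  have n2 : \forall y \near (0 : R), 1 / 2 < H y.
    by apply: (cvgr_gt _ (cH 0)); rewrite H0; lra.
  have n3 : \forall y \near (0 : R), H' y * H' y < c0 / 8.
    have c3 : H' y * H' y @[y --> (0 : R)] --> H' 0 * H' 0.
      by apply: cvgM; exact: cH'.
    apply: (cvgr_lt _ c3); have [_ _ h0] := dw_critical dw.
    by rewrite /H' h0 mul0r divr_gt0.
  have [d /= d0 hd] := filterI n1 (filterI n2 n3).
  exists (Num.min d (1 / 2)).
    by rewrite lt_min d0 /= divr_gt0//= gt_min; apply/orP; right; lra.
  move=> x /andP[x0]; rewrite lt_min => /andP[xd x2].
  have [|h1 [h2 h3]] := hd x; first by rewrite /= sub0r normrN ger0_norm.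
  have h4 : H x <= 1.
    move: x0; rewrite le_eqVlt => /predU1P[<-|x0]; first by rewrite H0.
    by apply/ltW/(dw_lt1 dw); rewrite x0; lra.
  have h5 : H x * H'' x <= - (c0 / 4) by rewrite /= in h1 h2; nra.
  have h6 : lam * H x ^+ 2 <= c0 / 4.
    by rewrite /lam ler_piMr ?divr_ge0 ?(ltW c00)// expr_le1// dw_ge0.
  by rewrite /D; rewrite /= in h3; lra.
have r05 : r0 <= 5 by lra.
have cD : continuous D.
  move=> x; apply: cvgD.
    apply: cvgMr; apply: cvgD; apply: cvgM; [exact: cH|exact: cH''|exact: cH'|exact: cH'].
  by apply: cvgMr; apply: cvgM; exact: cH.
have cG : continuous G.
  by move=> x; apply: cvgMr; apply: cvgM; [exact: cH|apply: cvgM; exact: cH'].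
have hGD x : r0 <= x <= 5 -> 0 < G x \/ D x < delta.
  move=> /andP[rx x5]; have x0 : 0 < x by exact: lt_le_trans rx.
  have [->|x1] := eqVneq x 1.
    right; rewrite /D; have [-> _] := dw_wells dw.
    by have [h _ _] := dw_critical dw; rewrite /H' h expr0n /= !mul0r !mulr0 !addr0 mulr0.
  left; rewrite mulr_gt0// mulr_gt0//; first by apply: (dw_gt0 dw) => //; exact: ltW.
  rewrite -expr2 lt_def sqr_ge0 andbT sqrf_eq0.
  move: x1; rewrite neq_lt => /orP[x1|x1].
    by rewrite lt_eqF//; apply: (dw_derive_lt0 dw); rewrite x0.
  by rewrite gt_eqF//; apply: (dw_derive_gt0 dw).
have := penalised_bound r05 cD cG (fun x _ => G_ge0 x) hGD.
apply: filterS => eps heps x x5.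
suff : D x - eps ^- 2 * G x <= delta by rewrite -genE//; lra.
wlog x0 : x x5 / 0 <= x.
  move=> h; have [x0|x0] := leP 0 x; first exact: h.
  have <- : D (- x) = D x.
    by rewrite /D /H' /H'' dw_even// dw_derive_odd// dw_derive2_even// mulrNN.
  have <- : G (- x) = G x.
    by rewrite /G /H' dw_even// dw_derive_odd// mulrNN.
  by apply: h; rewrite ?normrN// oppr_ge0 ltW.
rewrite ger0_norm// in x5.
have [xr|xr] := leP r0 x; first by apply: heps; rewrite xr.
have : D x <= 0 by apply: hr0; rewrite x0.
have : 0 <= eps ^- 2 * G x by rewrite mulr_ge0 ?invr_ge0 ?sqr_ge0.
by lra.
Qed.

(** * The flux through the barrier *)

(** A cutoff localised at the right well: it equals 1 on [3/4, 5/4] and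
    vanishes outside [1/2, 3/2], an interval on which H < 1. *)
Definition bump {R : realType} (x : R) : R :=
  step (4 * x + (- 2)) * step ((- 4) * x + 6).

Lemma smooth_bump {R : realType} : smooth (@bump R).
Proof. by apply: smoothM; apply: smooth_affine; exact: smooth_step. Qed.

Lemma bump_itv {R : realType} (x : R) : 0 <= bump x <= 1.
Proof. by rewrite mulr_ge0 ?step_ge0//= mulr_ile1 ?step_ge0 ?step_le1. Qed.

Lemma bump_eq1 {R : realType} (x : R) : 3/4 <= x <= 5/4 -> bump x = 1.
Proof. by move=> /andP[x1 x2]; rewrite /bump !step_eq1 ?mulr1//; lra. Qed.

Lemma bump_eq0 {R : realType} (x : R) : (x <= 1/2) || (3/2 <= x) -> bump x = 0.
Proof.
move=> /orP[h|h]; rewrite /bump; first by rewrite step_eq0 ?mul0r//; lra.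
by rewrite [step (-4 * x + 6)]step_eq0 ?mulr0//; lra.
Qed.

(** Its total value, [well_mass H eps (3/2)], is the unnormalised equilibrium
    mass of the right well, smoothly localised. *)
Definition well_mass {R : realType} (H : R -> R) (eps x : R) : R :=
  prim (fun y => bump y * gibbs H eps y) x.

(** The even function vanishing for |x| >= 3/2 with derivative -tau k (bump x -
    bump (-x)) exp (-H / eps ^+ 2): by [derive_weighted] it is the flux for
    which the generator of the committor is -tau k on the right well and + tau
    k on the left one. *)
Definition flux {R : realType} (H : R -> R) (eps x : R) : R :=
  tau eps * kramers H *
  (well_mass H eps (3/2) - well_mass H eps x - well_mass H eps (- x)).

(** An approximate eigenfunction of the generator, for the exponentially small
    eigenvalue -tau k: it passes from about -1 at the left well to about + 1 at
    the right well (see [committor_cvg]), the transition taking place near the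
    barrier top. *)
Definition committor {R : realType} (H : R -> R) (eps : R) : R -> R :=
  prim (fun x => flux H eps x * expR (H x / eps ^+ 2)).

Lemma kramers_ge0 {R : realType} (H : R -> R) : 0 <= kramers H.
Proof. by rewrite mulr_ge0 ?sqrtr_ge0// invr_ge0 pi_ge0. Qed.

Lemma smooth_gibbs {R : realType} (H : R -> R) (eps : R) : smooth H ->
  smooth (gibbs H eps).
Proof.
move=> sH; apply: smooth_exp; apply: smoothN.
by apply: (@smoothM _ H (fun=> _)) => //; exact: smooth_cst.
Qed.

Lemma well_mass_derive {R : realType} (H : R -> R) (eps : R) : double_well H ->
  forall x : R, is_derive x (1 : R) (well_mass H eps) (bump x * gibbs H eps x).
Proof.
move=> dw; apply: prim_derive; apply: smooth_cont; apply: smoothM.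
  exact: smooth_bump.
exact: smooth_gibbs (dw_smooth dw).
Qed.

Lemma gibbs_ge0 {R : realType} (H : R -> R) (eps x : R) : 0 <= gibbs H eps x.
Proof. exact: expR_ge0. Qed.

Lemma well_mass_le {R : realType} (H : R -> R) (eps x y : R) : double_well H ->
  x <= y -> well_mass H eps x <= well_mass H eps y.
Proof.
move=> dw xy; apply: (derive_ler (well_mass_derive eps dw) xy) => z _.
by rewrite mulr_ge0 ?gibbs_ge0//; have /andP[] := bump_itv z.
Qed.

Lemma well_mass_left {R : realType} (H : R -> R) (eps x : R) : double_well H ->
  x <= 1/2 -> well_mass H eps x = 0.
Proof.
move=> dw x12; have h2 : (0 : R) <= 1/2 by lra.
have e1 := derive_cst_itv (well_mass_derive eps dw) x12.
have e2 := derive_cst_itv (well_mass_derive eps dw) h2.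
rewrite -e1 ?e2 ?/well_mass ?prim0// => y /andP[_ y12].
  by rewrite bump_eq0 ?mul0r// (ltW y12).
by rewrite bump_eq0 ?mul0r// (ltW y12).
Qed.

Lemma well_mass_right {R : realType} (H : R -> R) (eps x : R) : double_well H ->
  3/2 <= x -> well_mass H eps x = well_mass H eps (3/2).
Proof.
move=> dw x32; apply: (derive_cst_itv (well_mass_derive eps dw) x32) => y /andP[y32 _].
by rewrite bump_eq0 ?mul0r// (ltW y32) orbT.
Qed.

(** Where [bump] is 1 or merely at most 1 the two halves of the well are
    compared with Laplace integrals of range 1/4 and 1/2, which have the same
    limit. *)
Lemma well_mass_cvg {R : realType} (H : R -> R) : double_well H ->
  well_mass H eps (3/2) / eps @[eps --> 0^'+]
    --> Num.sqrt pi / Num.sqrt (well_quad H).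
Proof.
move=> dw; set L := Num.sqrt pi / _.
pose F (s r eps : R) := prim (fun x => expR (- (H (s * x + 1) / eps ^+ 2))) r.
have cF r : 0 < r < 1 -> (F 1 r eps + F (-1) r eps) / eps @[eps --> 0^'+] --> L.
  move=> r01; have -> : L = Num.sqrt pi / (2 * Num.sqrt (well_quad H)) +
      Num.sqrt pi / (2 * Num.sqrt (well_quad H)).
    by rewrite /L invfM mulrA; lra.
  rewrite (_ : (fun eps => _) = fun eps => F 1 r eps / eps + F (-1) r eps / eps); last first.
    by apply/funext => eps; rewrite mulrDl.
  by apply: cvgD; apply: laplace_well => //; [left|right].
have c1 : 0 < (1/4 : R) < 1 by apply/andP; split; lra.
have c2 : 0 < (1/2 : R) < 1 by apply/andP; split; lra.
have r4 : (0 : R) <= 1/4 by lra.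
have r2 : (0 : R) <= 1/2 by lra.
have le1 : 5/4 <= 3/2 :> R by lra.
have le2 : 1/2 <= 3/4 :> R by lra.
have e32 : 1 * (1/2) + 1 = 3/2 :> R by lra.
have e54 : 1 * (1/4) + 1 = 5/4 :> R by lra.
have e12 : -1 * (1/2) + 1 = 1/2 :> R by lra.
have e34 : -1 * (1/4) + 1 = 3/4 :> R by lra.
have one_r (x : R) : 0 < x < 1/4 -> 3/4 <= x + 1 <= 5/4.
  by move=> /andP[x0 x4]; apply/andP; split; lra.
have one_l (x : R) : 0 < x < 1/4 -> 3/4 <= - x + 1 <= 5/4.
  by move=> /andP[x0 x4]; apply/andP; split; lra.
apply: squeeze_cvgr (cF _ c1) (cF _ c2).
near=> eps; have eps0 : 0 < eps by near: eps; exact: nbhs_right_gt.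
rewrite !ler_pM2r ?invr_gt0//.
have dQ := well_mass_derive eps dw.
have dF s r : is_derive r (1 : R) (fun r => F s r eps) (gibbs H eps (s * r + 1)).
  apply: (prim_derive (g := fun x => expR (- (H (s * x + 1) / eps ^+ 2)))).
  exact/smooth_cont/(smooth_affine (f := gibbs H eps))/smooth_gibbs/dw_smooth.
have F0 s : F s 0 eps = 0 by rewrite /F prim0.
have dR := is_derive_affine 1 1 dQ.
have dL := is_derive_affine (-1) 1 dQ.
have W0 : well_mass H eps (1/2) = 0 by exact: well_mass_left.
have g0 := gibbs_ge0 H eps.
have dFn r : is_derive r (1 : R) (fun r => -1 * F (-1) r eps) (-1 * gibbs H eps (-1 * r + 1)).
  exact: is_derive_scale.
have RU : well_mass H eps (3/2) - well_mass H eps 1 <= F 1 (1/2) eps.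
  have := derive_ler2 dR (dF 1) r2; rewrite mulr0 add0r F0 subr0 e32; apply => x _.
  by rewrite mul1r ler_piMl//; have /andP[] := bump_itv (1 * x + 1).
have RL : F 1 (1/4) eps <= well_mass H eps (5/4) - well_mass H eps 1.
  have := derive_ler2 (dF 1) dR r4; rewrite mulr0 add0r F0 subr0 e54; apply => x hx.
  by rewrite mul1r bump_eq1 ?mul1r//; exact: one_r.
have LU : well_mass H eps 1 - well_mass H eps (1/2) <= F (-1) (1/2) eps.
  have := derive_ler2 dFn dL r2; rewrite !mulr0 add0r F0 mulr0 subr0 e12.
  rewrite -[well_mass H eps (1/2) - _]opprB mulN1r lerN2; apply => x _.
  by rewrite !mulN1r lerN2 ler_piMl//; have /andP[] := bump_itv (- x + 1).
have LL : F (-1) (1/4) eps <= well_mass H eps 1 - well_mass H eps (3/4).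
  have := derive_ler2 dL dFn r4; rewrite !mulr0 add0r F0 mulr0 subr0 e34.
  rewrite -[well_mass H eps (3/4) - _]opprB mulN1r lerN2; apply => x hx.
  by rewrite !mulN1r bump_eq1 ?mul1r//; exact: one_l.
have M1 : well_mass H eps (5/4) <= well_mass H eps (3/2) by exact: well_mass_le.
have M2 : well_mass H eps (1/2) <= well_mass H eps (3/4) by exact: well_mass_le.
rewrite W0 in LU M2; move: RU RL LU LL M1 M2; clear.
move: (F 1 _ eps) (F (-1) _ eps) (F 1 _ eps) (F (-1) _ eps) => a b c d.
move: (well_mass _ _ _) (well_mass _ _ _) (well_mass _ _ _) (well_mass _ _ _) => w1 w2 w3 w4.
by move=> *; apply/andP; split; lra.
Unshelve. all: by end_near. Qed.

Lemma flux_derive {R : realType} (H : R -> R) (eps : R) : double_well H ->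
  forall x : R, is_derive x (1 : R) (flux H eps)
    (tau eps * kramers H * (bump (- x) - bump x) * gibbs H eps x).
Proof.
move=> dw x; have d1 := well_mass_derive eps dw.
have d2 := is_derive_reflect d1 x.
have d3 := is_deriveB (is_derive_cst (well_mass H eps (3/2)) x (1 : R)) (d1 x).
have d4 := is_derive_scale (tau eps * kramers H) (is_deriveB d3 d2).
apply: is_derive_eq d4 _.
by rewrite /gibbs (dw_even dw); ring.
Qed.

Lemma smooth_flux {R : realType} (H : R -> R) (eps : R) : double_well H ->
  smooth (flux H eps).
Proof.
move=> dw; apply: (smooth_primitive (flux_derive eps dw)).
apply: smoothM; last exact: smooth_gibbs (dw_smooth dw).
apply: smoothZ; apply: smoothD; first exact/smooth_reflect/smooth_bump.
exact/smoothN/smooth_bump.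
Qed.

Lemma flux_even {R : realType} (H : R -> R) (eps x : R) : flux H eps (- x) = flux H eps x.
Proof. by rewrite /flux opprK; ring. Qed.

Lemma flux_eq0 {R : realType} (H : R -> R) (eps x : R) : double_well H ->
  3/2 <= `|x| -> flux H eps x = 0.
Proof.
move=> dw; wlog x0 : x / 0 <= x.
  move=> h hx; have [x0|x0] := leP 0 x; first exact: h.
  by rewrite -flux_even; apply: h; rewrite ?normrN// oppr_ge0 ltW.
rewrite ger0_norm// => x32; rewrite /flux well_mass_right// subrr.
by rewrite well_mass_left ?subr0 ?mulr0//; lra.
Qed.

Lemma flux_centre {R : realType} (H : R -> R) (eps x : R) : double_well H ->
  `|x| <= 1/2 -> flux H eps x = tau eps * kramers H * well_mass H eps (3/2).
Proof.
move=> dw; rewrite ler_norml => /andP[x1 x2]; rewrite /flux.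
rewrite (@well_mass_left _ _ _ x)// (@well_mass_left _ _ _ (- x)) ?subr0//; lra.
Qed.

Lemma flux_itv {R : realType} (H : R -> R) (eps x : R) : double_well H -> 0 < eps ->
  0 <= flux H eps x <= tau eps * kramers H * well_mass H eps (3/2).
Proof.
move=> dw eps0; wlog x0 : x / 0 <= x.
  move=> h; have [x0|x0] := leP 0 x; first exact: h.
  by rewrite -flux_even; apply: h; rewrite oppr_ge0 ltW.
have K0 : 0 <= tau eps * kramers H by rewrite mulr_ge0 ?kramers_ge0// ltW// tau_gt0.
have h12 : (0 : R) <= 1 / 2 by lra.
rewrite /flux (@well_mass_left _ _ _ (- x))//; last by lra.
rewrite subr0; apply/andP; split.
  rewrite mulr_ge0// subr_ge0; have [x32|x32] := leP x (3/2); first exact: well_mass_le.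
  by rewrite well_mass_right// ltW.
rewrite ler_wpM2l// gerBl -(well_mass_left eps dw h12).
have [h|h] := leP x (1/2); first by rewrite !well_mass_left.
by apply: well_mass_le => //; exact: ltW.
Qed.

(** * The committor *)

Lemma near_eq_lim {R : realType} (F : set_system R) (f g : R -> R) (l : R) :
  Filter F -> (\forall x \near F, f x = g x) ->
  f x @[x --> F] --> l -> g x @[x --> F] --> l.
Proof. by move=> FF fg; apply: cvg_trans; exact: near_eq_cvg. Qed.

Definition committor_slope {R : realType} (H : R -> R) (eps x : R) : R :=
  flux H eps x * expR (H x / eps ^+ 2).

(** The expression produced by [derive_weighted] for the derivative of
    [committor_slope]. *)
Definition committor_slope' {R : realType} (H : R -> R) (eps x : R) : R :=
  (tau eps * kramers H * (bump (- x) - bump x) * gibbs H eps x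
    + eps ^- 2 * derive1 H x * flux H eps x) * expR (H x / eps ^+ 2).

Lemma smooth_committor_slope {R : realType} (H : R -> R) (eps : R) :
  double_well H -> smooth (committor_slope H eps).
Proof.
move=> dw; apply: smoothM; first exact: smooth_flux.
exact: smooth_weight (dw_smooth dw).
Qed.

Lemma committor_derive {R : realType} (H : R -> R) (eps : R) : double_well H ->
  forall x : R, is_derive x (1 : R) (committor H eps) (committor_slope H eps x).
Proof.
by move=> dw; apply: prim_derive; apply: smooth_cont; exact: smooth_committor_slope.
Qed.

Lemma committor_slope_derive {R : realType} (H : R -> R) (eps : R) : double_well H ->
  forall x : R, is_derive x (1 : R) (committor_slope H eps) (committor_slope' H eps x).
Proof. by move=> dw; exact (derive_weighted eps dw (flux_derive eps dw)). Qed.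

Lemma committor_generator {R : realType} (H : R -> R) (eps x : R) :
  generator H eps (committor_slope H eps) (committor_slope' H eps) x =
  - (tau eps * kramers H * (bump x - bump (- x))).
Proof.
rewrite /generator /committor_slope /committor_slope' /gibbs expRN.
set E := expR _; have E0 : E != 0 by rewrite gt_eqF// expR_gt0.
by rewrite mulrDl -mulrA mulVf// [RHS]/=; ring.
Qed.

Lemma committor_slope_ge0 {R : realType} (H : R -> R) (eps x : R) : double_well H ->
  0 < eps -> 0 <= committor_slope H eps x.
Proof.
move=> dw eps0; apply: mulr_ge0; last exact: expR_ge0.
by have /andP[] := flux_itv x dw eps0.
Qed.

Lemma committor_slope_eq0 {R : realType} (H : R -> R) (eps x : R) : double_well H ->
  3/2 <= `|x| -> committor_slope H eps x = 0.
Proof. by move=> dw x32; rewrite /committor_slope flux_eq0// mul0r. Qed.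

Lemma committor_odd {R : realType} (H : R -> R) (eps x : R) : double_well H ->
  committor H eps (- x) = - committor H eps x.
Proof.
move=> dw; wlog x0 : x / 0 <= x.
  move=> h; have [x0|x0] := leP 0 x; first exact: h.
  have nx0 : 0 <= - x by rewrite oppr_ge0 ltW.
  by have := h (- x) nx0; rewrite opprK => ->; rewrite opprK.
have d1 := committor_derive eps dw.
have d2 (y : R) : is_derive y (1 : R) (fun y => committor H eps y + committor H eps (- y))
    (committor_slope H eps y + - committor_slope H eps (- y)).
  by apply: is_deriveD (d1 y) _; exact: is_derive_reflect.
have := derive_cst_itv d2 x0; rewrite oppr0 /committor prim0 addr0 => h.
apply/eqP; rewrite -addr_eq0 addrC; apply/eqP/h => y _.
by rewrite /committor_slope flux_even (dw_even dw) subrr.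
Qed.

Lemma committor_le {R : realType} (H : R -> R) (eps x y : R) : double_well H ->
  0 < eps -> x <= y -> committor H eps x <= committor H eps y.
Proof.
move=> dw eps0 xy; apply: (derive_ler (committor_derive eps dw) xy) => z _.
exact: committor_slope_ge0.
Qed.

Lemma committor_right {R : realType} (H : R -> R) (eps x : R) : double_well H ->
  3/2 <= x -> committor H eps x = committor H eps (3/2).
Proof.
move=> dw x32; apply: (derive_cst_itv (committor_derive eps dw) x32) => y /andP[y32 _].
by rewrite committor_slope_eq0// (le_trans (ltW y32))// ler_norm.
Qed.

Lemma committor_norm_le {R : realType} (H : R -> R) (eps x : R) : double_well H ->
  0 < eps -> `|committor H eps x| <= committor H eps (3/2).
Proof.
move=> dw eps0; have h y : committor H eps y <= committor H eps (3/2).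
  have [y32|y32] := leP y (3/2); first exact: committor_le.
  by rewrite committor_right// ltW.
by rewrite ler_norml h andbT lerNl -committor_odd.
Qed.

(** An upper bound for the slope of the committor on the interval [1/2, 3/2] of
    length 1, hence for its variation across the right well. *)
Definition committor_gap {R : realType} (H : R -> R) (eps : R) : R :=
  tau eps * kramers H * well_mass H eps (3/2) *
  expR (Num.max (H (1/2)) (H (3/2)) / eps ^+ 2).

Lemma committor_gap_ge0 {R : realType} (H : R -> R) (eps : R) : double_well H ->
  0 < eps -> 0 <= committor_gap H eps.
Proof.
move=> dw eps0; apply: mulr_ge0; last exact: expR_ge0.
by have /andP[/le_trans h /h] := flux_itv 0 dw eps0.
Qed.

Lemma committor_gapP {R : realType} (H : R -> R) (eps x : R) : double_well H ->
  0 < eps -> 1/2 <= x -> committor H eps (3/2) - committor_gap H eps <= committor H eps x.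
Proof.
move=> dw eps0 x12; have g0 := committor_gap_ge0 dw eps0.
have [x32|x32] := leP (3/2) x; first by rewrite (committor_right _ dw x32) gerBl.
have dl (y : R) : is_derive y (1 : R) (fun y => committor_gap H eps * y) (committor_gap H eps).
  by rewrite -[X in is_derive _ _ _ X]mulr1; apply: is_derive_scale; exact: is_derive_id.
have := derive_ler2 (committor_derive eps dw) dl (ltW x32).
move=> h; have {h} : committor H eps (3/2) - committor H eps x <=
    committor_gap H eps * (3/2) - committor_gap H eps * x.
  apply: h => y /andP[xy y32].
  rewrite /committor_slope /committor_gap; apply: ler_pM; rewrite ?expR_ge0//.
  - by have /andP[] := flux_itv y dw eps0.
  - by have /andP[] := flux_itv y dw eps0.
  rewrite ler_expR ler_pM2r ?invr_gt0 ?exprn_gt0//.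
  by apply: (dw_le_max dw) => //; try lra; apply/andP; split; lra.
have : committor_gap H eps * (1/2) <= committor_gap H eps * x by rewrite ler_wpM2l.
by lra.
Qed.

(** The factor tau contributes exp (-1 / eps ^+ 2) while the exponential in the
    gap has exponent h / eps ^+ 2 with h < 1. *)
Lemma committor_gap_cvg {R : realType} (H : R -> R) : double_well H ->
  committor_gap H eps @[eps --> 0^'+] --> (0 : R).
Proof.
move=> dw; have FF : Filter (0^'+ : set_system R) by apply: filter_filter.
set h := Num.max (H (1/2)) (H (3/2)).
have h1 : 0 < 1 - h.
  by rewrite subr_gt0 gt_max !(dw_lt1 dw)//; apply/andP; split; lra.
have e1 := @exp_beats_power R 1 _ h1.
have /(_ FF) e2 := cvgM (well_mass_cvg dw) e1; rewrite mulr0 in e2.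
have /(_ FF FF) e3 := cvgM (cvg_cst (kramers H)) e2; rewrite mulr0 in e3.
apply: (near_eq_lim FF _ e3); near=> eps.
have eps0 : 0 < eps by near: eps; exact: nbhs_right_gt.
rewrite /committor_gap /tau -/h /=.
rewrite (_ : - ((1 - h) / eps ^+ 2) = - eps ^- 2 + h / eps ^+ 2); last by ring.
rewrite expRD /=.
rewrite -[LHS]/(kramers H * (well_mass H eps (3/2) / eps * (eps ^- 1 *
  (expR (- eps ^- 2) * expR (h / eps ^+ 2))))).
by field; rewrite gt_eqF.
Unshelve. all: by end_near. Qed.

(** On [0, 1/2] the flux is constant, so the committor at 1/2 is k eps ^- 2
    times the well mass times the integral of exp (-(1 - H) / eps ^+ 2) over
    [0, 1/2]. Laplace's method applies to both factors, and the product of the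
    two limits with k is 1: this is the only place where the exact value of the
    Kramers constant enters. From 1/2 to 3/2 the committor varies by at most
    the gap. *)
Lemma committor_cvg {R : realType} (H : R -> R) : double_well H ->
  committor H eps (3/2) @[eps --> 0^'+] --> (1 : R).
Proof.
have half : (0 : R) <= 1/2 by rewrite divr_ge0.
have half32 : (1/2 : R) <= 3/2 by lra.
move=> dw; have [h0 h1 _] := dw_hessian dw; have [H0 _ _] := dw_level1 dw.
have FF : Filter (0^'+ : set_system R) by apply: filter_filter.
have e1 : committor H eps (1/2) @[eps --> 0^'+] --> (1 : R).
  have /(_ FF) e0 := cvgM (well_mass_cvg dw) (laplace_barrier dw).
  have /(_ FF FF) := cvgM (cvg_cst (kramers H)) e0.
  have -> : kramers H * (Num.sqrt pi / Num.sqrt (well_quad H) *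
      (Num.sqrt pi / (2 * Num.sqrt (barrier_quad H)))) = 1.
    have pi0 : pi != 0 :> R by rewrite gt_eqF// pi_gt0.
    have spi : Num.sqrt pi * Num.sqrt pi = pi :> R by rewrite -expr2 sqr_sqrtr// pi_ge0.
    have w0 : 0 < well_quad H by rewrite divr_gt0.
    have b0 : 0 < barrier_quad H by rewrite divr_gt0// oppr_gt0.
    have kE : kramers H = pi^-1 * (2 * (Num.sqrt (barrier_quad H) * Num.sqrt (well_quad H))).
      rewrite /kramers -sqrtrM ?(ltW b0)//.
      rewrite (_ : `|derive1n 2 H 0| * derive1n 2 H 1 =
        2 ^+ 2 * (barrier_quad H * well_quad H)); last first.
        rewrite ltr0_norm// /barrier_quad /well_quad.
        by move: (derive1n 2 H 0) (derive1n 2 H 1) => a b; field.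
      by rewrite [Num.sqrt (2 ^+ 2 * _)]sqrtrM ?sqr_ge0// sqrtr_sqr ger0_norm.
    have sw : Num.sqrt (well_quad H) != 0 by rewrite gt_eqF// sqrtr_gt0.
    have sb : Num.sqrt (barrier_quad H) != 0 by rewrite gt_eqF// sqrtr_gt0.
    rewrite kE.
    transitivity (pi^-1 * (Num.sqrt pi * Num.sqrt pi) : R); last by rewrite spi mulVf.
    by move: (pi^-1) (Num.sqrt pi) => P S; field; rewrite sb sw.
  move=> e1; apply: (near_eq_lim FF _ e1); near=> eps.
  have eps0 : 0 < eps by near: eps; exact: nbhs_right_gt.
  pose B x := prim (fun x => expR (- ((1 - H x) / eps ^+ 2))) x.
  have dB (x : R) : is_derive x (1 : R) B (expR (- ((1 - H x) / eps ^+ 2))).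
    apply: prim_derive => y; apply: continuous_comp; last exact: continuous_expR.
    apply: cvgN; apply: cvgMl; apply: cvgB; first exact: cvg_cst.
    exact: is_derive_cont (dw_derive dw) y.
  pose K := tau eps * kramers H * well_mass H eps (3/2) * expR (eps ^- 2).
  have dKB x := is_derive_scale K (dB x).
  have := derive_eqr (committor_derive eps dw) dKB half.
  rewrite /committor /B !prim0 mulr0 !subr0 -/(committor H eps _) => ->.
    rewrite /K /tau expRN -[LHS]/(kramers H * (well_mass H eps (3/2) / eps * (B (1/2) / eps))).
    by rewrite -/(B (1/2)); field; rewrite !gt_eqF// expR_gt0.
  move=> x /andP[x0 x12]; rewrite /committor_slope flux_centre//; last first.
    by rewrite gtr0_norm// ltW.
  rewrite /K -[RHS]mulrA -expRD; congr (_ * expR _).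
  by ring.
have /(_ FF) e2 := cvgD e1 (committor_gap_cvg dw); rewrite addr0 in e2.
apply: squeeze_cvgr e1 e2; near=> eps.
have eps0 : 0 < eps by near: eps; exact: nbhs_right_gt.
have g := @committor_gapP _ _ _ (1/2) dw eps0 (lexx _).
have l : committor H eps (1/2) <= committor H eps (3/2) by exact: committor_le.
by rewrite l /= -[leRHS]/(committor H eps (1/2) + committor_gap H eps) -lerBlDr.
Unshelve. all: by end_near. Qed.

(** * Test functions and the differential inequality along solutions *)

(** [phi] takes the same constant value at both ends of the line, which makes
    it usable in the weak equation, and [L] is its image under the
    generator. *)
Definition admissible {R : realType} (H : R -> R) (eps : R) (phi L : R -> R) : Prop :=
  exists w w' : R -> R, exists M : R,
  [/\ forall x : R, is_derive x (1 : R) phi (w x),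
      forall x : R, is_derive x (1 : R) w (w' x),
      smooth w,
      [/\ 0 <= M, forall x, M <= `|x| -> w x = 0 & phi M = phi (- M)] &
      forall x, L x = generator H eps w w' x].

Lemma admissible_bmeas {R : realType} (H : R -> R) (eps : R) (phi L : R -> R) :
  double_well H -> admissible H eps phi L ->
  [/\ continuous phi, exists M : R, forall x, `|phi x| <= M, bmeas phi & bmeas L].
Proof.
move=> dw [w [w' [M [dphi dw_ sw [M0 w0 phiM] LE]]]].
have cphi := is_derive_cont dphi.
have bphi : exists K : R, forall x, `|phi x| <= K.
  apply: (cst_outside_bounded M0 cphi) => x; rewrite lter_normr => /orP[Mx|Mx].
    left; apply: (derive_cst_itv dphi (ltW Mx)) => y /andP[My _].
    by apply: w0; rewrite (le_trans (ltW My))// ler_norm.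
  right; have Mx' : x <= - M by lra.
  apply/esym/(derive_cst_itv dphi Mx') => y /andP[_ My].
  by apply: w0; rewrite ler_normr; apply/orP; right; lra.
split => //; first exact: bmeas_continuous.
have w'0 x : M < `|x| -> w' x = 0.
  move=> Mx; apply: (derive_unique (dw_ x)).
  apply: near_eq_is_derive (is_derive_cst (0 : R) x (1 : R)).
  have : \forall y \near x, M < `|y|.
    have cn : `|y| @[y --> x] --> `|x| by exact: norm_continuous.
    exact: cvgr_gt cn _ Mx.
  by apply: filterS => y My; rewrite w0// ltW.
have cL : continuous L.
  have -> : L = generator H eps w w' by exact/funext.
  move=> x; apply: cvgB.
    have [sw' _] := smooth_derivative sw; rewrite (is_derive_derive1 dw_) in sw'.
    exact: smooth_cont sw' x.
  apply: cvgM; last exact: is_derive_cont dw_ x.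
  by apply: cvgMr; exact: smooth_cont (dw_smooth1 dw) x.
have L0 x : M < `|x| -> L x = 0.
  by move=> Mx; rewrite LE /generator w'0// w0 ?(ltW Mx)// mulr0 subr0.
apply: bmeas_continuous => //.
have M1 : 0 <= M + 1 by lra.
apply: (cst_outside_bounded M1 cL) => x xM; left; rewrite !L0//; first by rewrite ger0_norm//; lra.
by apply: lt_trans xM; lra.
Qed.

Lemma generatorD {R : realType} (H : R -> R) (eps : R) (w1 w1' w2 w2' : R -> R) x :
  generator H eps (fun y => w1 y + w2 y) (fun y => w1' y + w2' y) x =
  generator H eps w1 w1' x + generator H eps w2 w2' x.
Proof. by rewrite /generator; ring. Qed.

Lemma generatorZ {R : realType} (H : R -> R) (eps c : R) (w w' : R -> R) x :
  generator H eps (fun y => c * w y) (fun y => c * w' y) x = c * generator H eps w w' x.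
Proof. by rewrite /generator; ring. Qed.

Lemma generator_reflect {R : realType} (H : R -> R) (eps : R) (w w' : R -> R) x :
  double_well H ->
  generator H eps (fun y => - w (- y)) (fun y => w' (- y)) x = generator H eps w w' (- x).
Proof. by move=> dw; rewrite /generator dw_derive_odd//; ring. Qed.

Lemma is_derive_reflect_slope {R : realType} (w w' : R -> R) :
  (forall x : R, is_derive x (1 : R) w (w' x)) ->
  forall x : R, is_derive x (1 : R) (fun y => - w (- y)) (w' (- x)).
Proof.
move=> h x; rewrite -[w' _]opprK; apply: is_deriveN.
exact: is_derive_reflect.
Qed.

Lemma mean_initial {R : realType} (H : R -> R) (eps : R) rho rho0 (phi : R -> R) :
  solution H eps rho rho0 -> mean (rho 0) phi = mean rho0 phi.
Proof. by move=> [_ h _ _]; congr mean; apply/funext. Qed.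

Lemma initial_density {R : realType} (H : R -> R) (eps : R) rho rho0 :
  solution H eps rho rho0 -> probability_density rho0.
Proof.
move=> [d h _ _]; have <- : rho 0 = rho0 by exact/funext.
exact: d.
Qed.

Lemma solution_density {R : realType} (H : R -> R) (eps t : R) rho rho0 :
  solution H eps rho rho0 -> 0 <= t -> probability_density (rho t).
Proof. by move=> [d _ _ _]; exact: d. Qed.

(** Only an inequality on averages against [rho t] is required, so that
    pointwise bounds on [L] may involve quantities controlled beforehand on
    average. *)
Lemma admissible_gronwall {R : realType} (H : R -> R) (eps : R) rho rho0
    (phi L : R -> R) (lam g del T : R) :
  double_well H -> 0 < eps -> solution H eps rho rho0 -> admissible H eps phi L ->
  0 <= lam -> 0 <= del -> 0 <= T ->
  (forall t, 0 < t < T ->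
     (tau eps)^-1 * mean (rho t) L <= - lam * (mean (rho t) phi - g) + del) ->
  mean (rho T) phi - g <= expR (- (lam * T)) * (mean rho0 phi - g) + del * T.
Proof.
move=> dw eps0 sol adm lam0 del0 T0 hL.
have [cphi bphi _ _] := admissible_bmeas dw adm.
rewrite -(mean_initial _ sol).
apply: (gronwall (y := fun s => mean (rho s) phi)) => //.
  exact: solution_continuous sol cphi bphi.
move=> t t0T; have /andP[t0 _] := t0T.
exists ((tau eps)^-1 * mean (rho t) L); last exact: hL.
have [w [w' [M [dphi dw_ sw [M0 w0 phiM] LE]]]] := adm.
have -> : L = (fun x => w' x - eps ^- 2 * derive1 H x * w x).
  by apply/funext => x; rewrite LE.
exact: (solution_derive eps0 sol dphi dw_ sw M0 w0 phiM t0).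
Qed.

(** * Escape, confinement and drift along solutions *)

Lemma tail_bound {R : realType} (H : R -> R) (eps : R) rho rho0 (Psi L : R -> R) (b T : R) :
  double_well H -> 0 < eps -> solution H eps rho rho0 -> admissible H eps Psi L ->
  0 <= b -> (forall x, L x <= tau eps * b) -> 0 <= T ->
  mean (rho T) Psi <= mean rho0 Psi + b * T.
Proof.
move=> dw eps0 sol adm b0 Lb T0.
have := admissible_gronwall (lam := 0) (g := 0) dw eps0 sol adm (lexx 0) b0 T0.
rewrite mul0r oppr0 expR0 mul1r !addr0; apply => t /andP[t0 _].
rewrite mul0r add0r.
have dt := solution_density sol (ltW t0).
have [_ _ _ bL] := admissible_bmeas dw adm.
rewrite mulrC ler_pdivrMr ?tau_gt0// mulrC -(mean_cst (tau eps * b) dt).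
by apply: mean_le => //; exact: bmeas_cst.
Qed.

(** The equation drives the average of [f] down at rate lam / tau against a
    forcing (delta + K theta) / tau. The two large factors cancel in the
    equilibrium level (delta + K theta) / lam, which is why the estimate is
    uniform in eps and in time. *)
Lemma confinement_bound {R : realType} (H : R -> R) (eps : R) rho rho0
    (f L Psi : R -> R) (lam delta K theta T : R) :
  double_well H -> 0 < eps -> solution H eps rho rho0 -> admissible H eps f L ->
  bmeas Psi -> 0 < lam -> 0 <= delta -> 0 <= K -> 0 <= theta -> 0 <= T ->
  (forall x, 0 <= f x) ->
  (forall x, L x <= - lam * f x + (delta + K * Psi x)) ->
  (forall t, 0 <= t <= T -> mean (rho t) Psi <= theta) ->
  mean (rho T) f <= mean rho0 f + (delta + K * theta) / lam.
Proof.
move=> dw eps0 sol adm bPsi lam0 delta0 K0 theta0 T0 f0 hL hPsi.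
pose g := (delta + K * theta) / lam.
have g0 : 0 <= g by rewrite divr_ge0 ?(ltW lam0)// addr_ge0// mulr_ge0.
have tau0 := tau_gt0 eps0.
have lt0 : 0 <= lam / tau eps by rewrite divr_ge0 ?ltW.
have [_ _ bf bL] := admissible_bmeas dw adm.
have := admissible_gronwall (g := g) dw eps0 sol adm lt0 (lexx 0) T0.
rewrite mul0r !addr0 => h.
have {}h : mean (rho T) f - g <= expR (- (lam / tau eps * T)) * (mean rho0 f - g).
  apply: h => t /andP[t0 tT]; have dt := solution_density sol (ltW t0).
  rewrite addr0 (_ : _ * (_ - g) = (tau eps)^-1 * (- lam * (mean (rho t) f - g))); last by ring.
  rewrite ler_pM2l ?invr_gt0//.
  apply: le_trans (mean_le dt bL _ hL) _.
    apply: bmeasD; first exact: bmeasZ.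
    by apply: bmeasD; [exact: bmeas_cst|exact: bmeasZ].
  rewrite meanD//; [|exact: bmeasZ|by apply: bmeasD; [exact: bmeas_cst|exact: bmeasZ]].
  rewrite meanD//; [|exact: bmeas_cst|exact: bmeasZ].
  rewrite mean_cst// !meanZ//.
  have -> : - lam * (mean (rho t) f - g) = - lam * mean (rho t) f + (delta + K * theta).
    by rewrite /g; field; rewrite gt_eqF.
  by rewrite !lerD2l ler_wpM2l// hPsi// (ltW t0) (ltW tT).
have A0 := mean_ge0 (initial_density sol) f0.
have e0 : 0 <= expR (- (lam / tau eps * T)) := expR_ge0 _.
have e1 : expR (- (lam / tau eps * T)) <= 1.
  by rewrite -expR0 ler_expR oppr_le0 mulr_ge0.
have : expR (- (lam / tau eps * T)) * (mean rho0 f - g) <= mean rho0 f.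
  apply: (@le_trans _ _ (expR (- (lam / tau eps * T)) * mean rho0 f)).
    by rewrite ler_wpM2l// gerBl.
  by rewrite ler_piMl.
by rewrite -/g; lra.
Qed.

(** If the generator sends [Phi] to at least -tau (k S + b) and [S] is close to
    [Phi] on average, then the average of [Phi] decays no faster than exp (-k
    t), up to a small error. The inequality is one-sided; it is applied to a
    test function close to the committor and to one close to its opposite. *)
Lemma drift_bound {R : realType} (H : R -> R) (eps : R) rho rho0
    (Phi L S f Psi : R -> R) (k b e B Q zeta theta T : R) :
  double_well H -> 0 < eps -> solution H eps rho rho0 -> admissible H eps Phi L ->
  bmeas S -> bmeas f -> bmeas Psi -> 0 <= k -> 0 <= b -> 0 <= e -> 0 <= B -> 0 <= Q ->
  0 <= zeta -> 0 <= theta -> 0 <= T ->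
  (forall x, - (tau eps * (k * S x + b)) <= L x) ->
  (forall x, `|S x - Phi x| <= e + (B * f x + Q * Psi x)) ->
  (forall t, 0 <= t <= T -> mean (rho t) f <= zeta) ->
  (forall t, 0 <= t <= T -> mean (rho t) Psi <= theta) ->
  expR (- (k * T)) * mean rho0 Phi - (k * (e + (B * zeta + Q * theta)) + b) * T
    <= mean (rho T) Phi.
Proof.
move=> dw eps0 sol adm bS bf bPsi k0 b0 e0 B0 Q0 zeta0 theta0 T0 hL hS hf hPsi.
have tau0 := tau_gt0 eps0.
have [_ _ bPhi bL] := admissible_bmeas dw adm.
have admN : admissible H eps (fun x => -1 * Phi x) (fun x => -1 * L x).
  have [w [w' [M [dphi dw_ sw [M0 w0 phiM] LE]]]] := adm.
  exists (fun x => -1 * w x), (fun x => -1 * w' x), M; split.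
  - by move=> x; exact: is_derive_scale.
  - by move=> x; exact: is_derive_scale.
  - exact: smoothZ.
  - by split=> // [x /w0 ->|]; rewrite ?mulr0// phiM.
  - by move=> x; rewrite generatorZ LE.
pose del := k * (e + (B * zeta + Q * theta)) + b.
have del0 : 0 <= del.
  by apply: addr_ge0 => //; apply: mulr_ge0 => //; apply: addr_ge0 => //;
    apply: addr_ge0; apply: mulr_ge0.
have := admissible_gronwall (lam := k) (g := 0) dw eps0 sol admN k0 del0 T0.
rewrite meanZ//; last exact: solution_density sol T0.
rewrite meanZ//; last exact: initial_density sol.
rewrite !subr0 !mulN1r mulrN => h; rewrite -/del.
suff : - mean (rho T) Phi <= - (expR (- (k * T)) * mean rho0 Phi) + del * T by lra.
apply: h => t /andP[t0 tT]; have dt := solution_density sol (ltW t0).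
rewrite subr0 !meanZ// mulN1r.
have h1 : - (tau eps * (k * mean (rho t) S + b)) <= mean (rho t) L.
  have -> : - (tau eps * (k * mean (rho t) S + b)) =
      mean (rho t) (fun x => (- tau eps) * (k * S x + b)).
    by rewrite meanZ ?meanD ?meanZ ?mean_cst ?mulNr//; [exact: bmeasZ|exact: bmeas_cst|
      apply: bmeasD; [exact: bmeasZ|exact: bmeas_cst]].
  apply: mean_le => //.
    by apply: bmeasZ; apply: bmeasD; [exact: bmeasZ|exact: bmeas_cst].
  by move=> x; rewrite mulNr.
have h2 : mean (rho t) S - mean (rho t) Phi <= e + (B * zeta + Q * theta).
  have bD : bmeas (fun x => B * f x + Q * Psi x) by apply: bmeasD; exact: bmeasZ.
  have bE : bmeas (fun x => e + (B * f x + Q * Psi x)).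
    by apply: bmeasD => //; exact: bmeas_cst.
  have : mean (rho t) S <= mean (rho t) (fun x => Phi x + (e + (B * f x + Q * Psi x))).
    apply: mean_le => //; first exact: bmeasD.
    by move=> x; have := hS x; rewrite ler_norml => /andP[_]; lra.
  rewrite meanD// meanD//; last exact: bmeas_cst.
  rewrite mean_cst// meanD//; [|exact: bmeasZ..].
  rewrite !meanZ//.
  have tT' : 0 <= t <= T by rewrite (ltW t0) (ltW tT).
  have := ler_wpM2l B0 (hf t tT'); have := ler_wpM2l Q0 (hPsi t tT'); lra.
have h3 : - mean (rho t) L / tau eps <= k * mean (rho t) S + b.
  by rewrite ler_pdivrMr// mulrC; lra.
have h4 := ler_wpM2l k0 h2.
rewrite mulrC mulN1r; apply: le_trans h3 _; rewrite /del.
by move: h4; rewrite mulrBr !mulrDr mulNr mulrN opprK; lra.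
Qed.

(** * The committor as a test function *)

Lemma dw_off_wells {R : realType} (H : R -> R) (r : R) : double_well H -> 0 < r < 1 ->
  exists2 c : R, 0 < c & forall x, r <= `| `|x| - 1 | -> c <= H x.
Proof.
move=> dw /andP[r0 r1]; exists (Num.min (H (1 - r)) (H (1 + r))).
  by rewrite lt_min !(dw_gt0 dw)//; try lra; apply/eqP; lra.
move=> x hx; have -> : H x = H `|x|.
  by have [x0|x0] := leP 0 x; [rewrite ger0_norm|rewrite ltr0_norm// dw_even].
have x0 : 0 <= `|x| by [].
move: x0 hx; move: `|x| => {x} x x0; rewrite ge_min ler_normr => /orP[h|h]; apply/orP.
  right; have : 1 + r <= x by lra.
  by rewrite le_eqVlt => /predU1P[->//|h']; apply/ltW/(dw_incr dw) => //; lra.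
left; have : x <= 1 - r by lra.
by rewrite le_eqVlt => /predU1P[->//|h']; apply/ltW/(dw_decr dw) => //; lra.
Qed.

Lemma dw_ge_outside {R : realType} (H : R -> R) (a x : R) : double_well H -> 1 <= a ->
  a <= `|x| -> H a <= H x.
Proof.
move=> dw a1 ax; have -> : H x = H `|x|.
  by have [x0|x0] := leP 0 x; [rewrite ger0_norm|rewrite ltr0_norm// dw_even].
by move: ax; rewrite le_eqVlt => /predU1P[->//|h']; apply/ltW/(dw_incr dw).
Qed.

(** By [committor_generator], the generator sends the committor to -tau k times
    this function, which is the sign of the well on each well. *)
Definition sign_profile {R : realType} (x : R) : R := bump x - bump (- x).

Lemma sign_profile_norm_le1 {R : realType} (x : R) : `|sign_profile x| <= 1.
Proof.
rewrite /sign_profile; have /andP[? ?] := bump_itv x; have /andP[? ?] := bump_itv (- x).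
by rewrite ler_norml; apply/andP; split; lra.
Qed.

Lemma bmeas_sign_profile {R : realType} : bmeas (@sign_profile R).
Proof.
apply: bmeas_continuous; last by exists 1; exact: sign_profile_norm_le1.
apply: smooth_cont; apply: smoothD; first exact: smooth_bump.
exact/smoothN/smooth_reflect/smooth_bump.
Qed.

Lemma bmeas_committor {R : realType} (H : R -> R) (eps : R) : double_well H -> 0 < eps ->
  bmeas (committor H eps).
Proof.
move=> dw eps0; apply: bmeas_continuous; first exact: is_derive_cont (committor_derive eps dw).
by exists (committor H eps (3/2)) => x; exact: committor_norm_le.
Qed.

Lemma committor_near_sign {R : realType} (H : R -> R) (eps x : R) : double_well H ->
  0 < eps -> `| `|x| - 1 | <= 1/4 ->
  `|sign_profile x - committor H eps x| <=
    `|1 - committor H eps (3/2)| + committor_gap H eps.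
Proof.
move=> dw eps0; wlog x0 : x / 0 <= x.
  move=> h; have [x0|x0] := leP 0 x; first exact: h.
  move=> hx; have -> : `|sign_profile x - committor H eps x| =
      `|sign_profile (- x) - committor H eps (- x)|.
    by rewrite committor_odd// /sign_profile opprK -normrN; congr `|_|; ring.
  by apply: h; [rewrite oppr_ge0 ltW|rewrite normrN].
rewrite (ger0_norm x0) ler_norml => /andP[x1 x2].
rewrite /sign_profile bump_eq1; last by apply/andP; split; lra.
rewrite bump_eq0 ?subr0; last by apply/orP; left; lra.
have x12 : 1/2 <= x by lra.
have h1 := committor_gapP dw eps0 x12.
have h2 := le_trans (ler_norm _) (committor_norm_le x dw eps0).
have h3 : 0 <= committor H eps (3/2) - committor H eps x <= committor_gap H eps.
  by apply/andP; split; lra.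
rewrite -[1 - _](subrKA (committor H eps (3/2))).
apply: le_trans (ler_normD _ _) _; rewrite lerD2l.
by move/andP: h3 => [h3 h4]; rewrite ger0_norm.
Qed.

(** [ps] passes by a total amount [sg] from one end of the line to the other
    while its generator is bounded above by tau b. With sg = 1 it is the
    function of [tail_function], with sg = -1 its mirror image; only the upper
    bound on the generator is available. *)
Definition tail_profile {R : realType} (H : R -> R) (eps b sg : R) (ps : R -> R) : Prop :=
  exists q q' : R -> R,
  [/\ forall x : R, is_derive x (1 : R) ps (q x),
      forall x : R, is_derive x (1 : R) q (q' x),
      smooth q,
      (forall x, 5 <= `|x| -> q x = 0) /\ ps 5 - ps (- 5) = sg &
      forall x, generator H eps q q' x <= tau eps * b].

Lemma tail_profile_reflect {R : realType} (H : R -> R) (eps b sg : R) (ps : R -> R) :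
  double_well H -> tail_profile H eps b sg ps ->
  tail_profile H eps b (- sg) (fun x => ps (- x)).
Proof.
move=> dw [q [q' [dps dq sq [qout ps5] genq]]].
exists (fun x => - q (- x)), (fun x => q' (- x)); split.
- exact: is_derive_reflect.
- exact: is_derive_reflect_slope.
- exact/smoothN/smooth_reflect.
- split=> [x x5|]; first by rewrite qout ?normrN// oppr0.
  by rewrite opprK -ps5 opprB.
- by move=> x; rewrite generator_reflect.
Qed.

(** Two opposite profiles take equal values at both ends, so their sum may be
    tested: it measures the mass escaping on either side. *)
Lemma tail_profile_sum {R : realType} (H : R -> R) (eps b sg : R) (ps1 ps2 : R -> R) :
  tail_profile H eps b sg ps1 -> tail_profile H eps b (- sg) ps2 ->
  exists2 L, admissible H eps (fun x => ps1 x + ps2 x) L &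
    forall x, L x <= tau eps * (2 * b).
Proof.
move=> [q1 [q1' [d1 dq1 sq1 [out1 e1] g1]]] [q2 [q2' [d2 dq2 sq2 [out2 e2] g2]]].
exists (generator H eps (fun x => q1 x + q2 x) (fun x => q1' x + q2' x)).
  exists (fun x => q1 x + q2 x), (fun x => q1' x + q2' x), 5; split.
  - by move=> x; exact: is_deriveD.
  - by move=> x; exact: is_deriveD.
  - exact: smoothD.
  - by split=> // [x x5|]; [rewrite out1// out2// addr0|lra].
  - by [].
by move=> x; rewrite generatorD; have := g1 x; have := g2 x; lra.
Qed.

(** The committor has the distinct values -m and m at the two ends and cannot
    be tested directly. Subtracting 2 m times a tail profile, which lives far
    from the wells, equalises the end values. Since the generator of the
    profile is only bounded above, this yields a lower bound on the generator,
    for the committor (sg = 1) and for its opposite (sg = -1) alike. *)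
Lemma signed_admissible {R : realType} (H : R -> R) (eps b sg m : R) (ps : R -> R) :
  double_well H -> m = committor H eps (3/2) -> 0 <= m ->
  tail_profile H eps b sg ps ->
  exists2 L, admissible H eps (fun x => sg * committor H eps x + (- (2 * m)) * ps x) L &
    forall x, - (tau eps * (kramers H * (sg * sign_profile x) + 2 * m * b)) <= L x.
Proof.
move=> dw mE m0 [q [q' [dps dq sq [qout ps5] genq]]].
pose W x := sg * committor_slope H eps x + (- (2 * m)) * q x.
pose W' x := sg * committor_slope' H eps x + (- (2 * m)) * q' x.
exists (generator H eps W W').
  exists W, W', 5; split.
  - move=> x; exact (is_deriveD (is_derive_scale sg (committor_derive eps dw x))
      (is_derive_scale (- (2 * m)) (dps x))).
  - move=> x; exact (is_deriveD (is_derive_scale sg (committor_slope_derive eps dw x))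
      (is_derive_scale (- (2 * m)) (dq x))).
  - exact (smoothD (smoothZ (c := sg) (smooth_committor_slope (eps := eps) dw))
      (smoothZ (c := - (2 * m)) sq)).
  - split=> // [x x5|].
      by rewrite /W qout// committor_slope_eq0 ?mulr0 ?addr0//; lra.
    rewrite committor_odd// committor_right//; last by lra.
    by rewrite -mE; move: ps5 => /eqP; rewrite subr_eq => /eqP ->; ring.
  - by [].
move=> x; rewrite generatorD !generatorZ committor_generator -/(sign_profile x).
have := ler_wpM2l (mulr_ge0 (ler0n _ 2) m0) (genq x).
by lra.
Qed.

(** With sg = 1 and sg = -1 this bounds the average of the committor from below
    and from above. *)
Lemma signed_drift {R : realType} (H : R -> R) (eps : R) rho rho0 (f Psi ps : R -> R)
    (b sg e B zeta theta T : R) :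
  double_well H -> 0 < eps -> solution H eps rho rho0 -> sg = 1 \/ sg = -1 ->
  tail_profile H eps b sg ps -> bmeas f -> bmeas Psi ->
  (forall x, 0 <= ps x <= Psi x) -> committor H eps (3/2) <= 2 ->
  (forall x, `|sign_profile x - committor H eps x| <= e + B * f x) ->
  0 <= b -> 0 <= e -> 0 <= B -> 0 <= zeta -> 0 <= theta -> 0 <= T ->
  (forall t, 0 <= t <= T -> mean (rho t) f <= zeta) ->
  (forall t, 0 <= t <= T -> mean (rho t) Psi <= theta) ->
  expR (- (kramers H * T)) * (sg * mean rho0 (committor H eps))
    - (4 * theta + (kramers H * (e + (B * zeta + 4 * theta)) + 4 * b) * T)
  <= sg * mean (rho T) (committor H eps).
Proof.
move=> dw eps0 sol sg1 prof bf bPsi psP.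
move: (erefl (committor H eps (3/2))); move: {2 3}(committor H eps (3/2)) => m mE m2.
move=> hS b0 e0 B0 zeta0 theta0 T0 hf hP.
have m0 : 0 <= m by rewrite -mE; apply: le_trans (committor_norm_le 0 dw eps0).
have [L adm genL] := signed_admissible dw (esym mE) m0 prof.
have bphi := bmeas_committor dw eps0.
have bps : bmeas ps.
  have [q [q' [dps _ _ _ _]]] := prof.
  apply: bmeas_continuous; first exact: is_derive_cont dps.
  have [_ [M hM]] := bPsi; exists M => x; have /andP[h1 h2] := psP x.
  by rewrite ger0_norm// (le_trans h2)// (le_trans (ler_norm _)).
have bsS : bmeas (fun x => sg * sign_profile x) by apply: bmeasZ; exact: bmeas_sign_profile.
have k0 := kramers_ge0 H.
have tau0 := tau_gt0 eps0.
have b40 : 0 <= 4 * b by rewrite mulr_ge0.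
have hL x : - (tau eps * (kramers H * (sg * sign_profile x) + 4 * b)) <= L x.
  apply: le_trans (genL x); rewrite lerN2 ler_pM2l// lerD2l ler_wpM2r//; clear -m2; lra.
have hD x : `|sg * sign_profile x - (sg * committor H eps x + - (2 * m) * ps x)|
    <= e + (B * f x + 4 * Psi x).
  have /andP[h1 h2] := psP x.
  have -> : sg * sign_profile x - (sg * committor H eps x + - (2 * m) * ps x) =
    sg * (sign_profile x - committor H eps x) + 2 * m * ps x by ring.
  apply: le_trans (ler_normD _ _) _; rewrite normrM.
  have -> : `|sg| = 1 by case: sg1 => ->; rewrite ?normrN normr1.
  rewrite mul1r [`|2 * m * ps x|]ger0_norm; last by rewrite !mulr_ge0.
  rewrite addrA; apply: lerD => //.
  by apply: ler_pM => //; [rewrite mulr_ge0|clear -m2; lra].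
have := drift_bound dw eps0 sol adm bsS bf bPsi k0 b40 e0 B0 (ler0n _ 4)
  zeta0 theta0 T0 hL hD hf hP.
have dT := solution_density sol T0; have d0 := initial_density sol.
rewrite (meanD dT (bmeasZ sg bphi) (bmeasZ (- (2 * m)) bps)).
rewrite (meanD d0 (bmeasZ sg bphi) (bmeasZ (- (2 * m)) bps)).
rewrite (meanZ sg dT bphi) (meanZ (- (2 * m)) dT bps).
rewrite (meanZ sg d0 bphi) (meanZ (- (2 * m)) d0 bps).
have ps_T : 0 <= mean (rho T) ps by apply: mean_ge0 => // x; have /andP[] := psP x.
have ps_0 : mean rho0 ps <= theta.
  apply: (@le_trans _ _ (mean rho0 Psi)).
    by apply: mean_le => // x; have /andP[] := psP x.
  by rewrite -(mean_initial _ sol); apply: hP; rewrite lexx.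
have ps_00 : 0 <= mean rho0 ps by apply: mean_ge0 => // x; have /andP[] := psP x.
have x1 : 0 <= 2 * m * mean (rho T) ps by rewrite !mulr_ge0.
have x2 : expR (- (kramers H * T)) * (2 * m * mean rho0 ps) <= 4 * theta.
  apply: (@le_trans _ _ (2 * m * mean rho0 ps)).
    by rewrite ler_piMl ?mulr_ge0// -expR0 ler_expR oppr_le0 mulr_ge0.
  by apply: ler_pM => //; [rewrite mulr_ge0|clear -m2; lra].
move=> h; clear -h x1 x2; lra.
Qed.

(** * Relaxation of solutions *)

(** The Lyapunov function [f] records the concentration at the wells. Once it
    is small initially, [tail_bound] keeps the mass outside small on [0, T],
    hence [confinement_bound] keeps [f] small, hence the profile [sign_profile]
    and the committor agree on average and [signed_drift] applies for both
    signs. The remaining properties of [f] convert smallness of its average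
    into concentration at the wells, and smallness of H into smallness of
    [f]. *)
Lemma dynamics {R : realType} (H : R -> R) : double_well H -> exists f : R -> R,
  [/\ bmeas f, forall x, 0 <= f x,
      forall r, 0 < r < 1 -> exists2 c : R, 0 < c &
        forall x, r <= `| `|x| - 1 | -> c <= f x,
      forall eta, 0 < eta -> exists2 m : R, 0 < m & forall x, eta <= f x -> m <= H x &
      forall T eta : R, 0 <= T -> 0 < eta -> exists2 alpha : R, 0 < alpha &
        \forall eps \near 0^'+, forall rho rho0, solution H eps rho rho0 ->
          mean rho0 f <= alpha -> forall t, 0 <= t <= T ->
          mean (rho t) f <= eta /\
          `|mean (rho t) (committor H eps) -
            expR (- (kramers H * t)) * mean rho0 (committor H eps)| <= eta].
Proof.
move=> dw.
have [a [m0 [K [a15 m00 K0 htail]]]] := tail_function dw.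
have /andP[a1 a54] := a15.
have [f [w [w' [lam [C [[df dw_ sw w0 f6] [lam0 f_in f_out fC] LC Ldelta]]]]]] :=
  concentration_function dw.
have f0 x : 0 <= f x by have /andP[] := fC x.
have C0 : 0 <= C by have /andP[/le_trans h /h] := fC 0.
have H5 : 0 < H 5 by apply: (dw_gt0 dw); [lra|apply/eqP; lra].
have f_low (c : R) x : 0 <= c -> c <= H x -> c <= H 5 -> c ^+ 2 <= f x.
  move=> c0 cx c5; have [x5|x5] := leP `|x| 5.
    by rewrite f_in// ler_sqr ?nnegrE// dw_ge0.
  by apply: le_trans (f_out _ (ltW x5)); rewrite ler_sqr ?nnegrE// ltW.
have f_off r : 0 < r < 1 -> exists2 c : R, 0 < c & forall x, r <= `| `|x| - 1 | -> c <= f x.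
  move=> r01; have [c c0 hc] := dw_off_wells dw r01.
  exists (Num.min c (H 5) ^+ 2); first by rewrite exprn_gt0// lt_min c0.
  move=> x hx; apply: f_low; first by rewrite le_min !ltW.
    by rewrite ge_min hc.
  by rewrite ge_min lexx orbT.
have admf eps : admissible H eps f (generator H eps w w').
  by exists w, w', 6; split.
have bf : bmeas f by have [_ _] := admissible_bmeas dw (admf 1).
exists f; split => //.
  move=> eta eta0; exists (Num.min (Num.sqrt eta) (H 5)).
    by rewrite lt_min sqrtr_gt0 eta0.
  move=> x hx; rewrite ge_min; have [x5|x5] := leP `|x| 5.
    move: hx; rewrite f_in// => hx; apply/orP; left.
    by rewrite -(ler_sqr (sqrtr_ge0 _)) ?nnegrE ?dw_ge0// sqr_sqrtr// ltW.
  by apply/orP; right; apply: dw_ge_outside => //; [lra|exact: ltW].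
move=> T eta T0 eta0.
pose fa := H a ^+ 2.
have Ha0 : 0 < H a by apply: (dw_gt0 dw); [lra|rewrite gt_eqF].
have fa0 : 0 < fa by rewrite exprn_gt0.
have f_a x : a <= `|x| -> fa <= f x.
  move=> ax; apply: f_low; first exact: ltW.
    by apply: dw_ge_outside => //; exact: ltW.
  by apply: dw_ge_outside => //; [exact: ltW|rewrite ger0_norm; lra].
have r14 : 0 < (1/4 : R) < 1 by apply/andP; split; lra.
have [c c0 hc] := f_off _ r14.
pose k := kramers H; have k0 : 0 <= k := kramers_ge0 H.
(* The sign profile is bounded by 1 and the committor by 2, so that away from
   the wells, where f >= c, they differ by at most 3 <= B * f. *)
pose B := 3 / c; have B0 : 0 <= B by rewrite divr_ge0 ?ltW.
(* The final error is at most BB times the common smallness s, whence s = eta /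
   BB. *)
pose BB := 4 + T * (k * (1 + (B + 4)) + 4).
have BB1 : 1 <= BB.
  have : 0 <= T * (k * (1 + (B + 4)) + 4).
    apply: mulr_ge0 => //; apply: addr_ge0 => //; apply: mulr_ge0 => //; lra.
  by rewrite /BB; lra.
have BB0 : 0 < BB by lra.
pose s := eta / BB; have s0 : 0 < s by rewrite divr_gt0.
have s_eta : s <= eta by rewrite ler_pdivrMr// ler_peMr// ltW.
have sBB : s * BB = eta by rewrite divfK// gt_eqF.
pose CC := C + lam * C; have CC0 : 0 <= CC by rewrite addr_ge0// mulr_ge0// ltW.
have CC1 : 0 < CC + 1 by rewrite ltr_wpDl.
(* theta bounds the escaped mass; the second term lets the forcing CC * theta
   of f be absorbed, as the confinement estimate divides it by lam. *)
pose theta := Num.min s (lam * s / (3 * (CC + 1))).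
have theta0 : 0 < theta.
  by rewrite lt_min s0 /=; apply: divr_gt0; apply: mulr_gt0.
have theta_s : theta <= s by rewrite ge_min lexx.
have theta_CC : CC * theta <= lam * s / 3.
  have h : theta <= lam * s / (3 * (CC + 1)) by rewrite ge_min lexx orbT.
  have h2 : CC * theta <= (CC + 1) * theta by rewrite ler_pM2r// lerDl.
  apply: le_trans h2 _; rewrite mulrC -ler_pdivlMr//.
  by apply: le_trans h _; rewrite invfM mulrA.
(* psi <= f / fa, so an initial average of f below theta * fa / 4 leaves at
   most theta / 2 of escaped mass, half of what is allowed. *)
pose alpha := Num.min (s / 3) (theta * fa / 4).
have alpha0 : 0 < alpha by rewrite lt_min !divr_gt0// mulr_gt0.
exists alpha => //.
pose delta := lam * s / 3; have delta0 : 0 < delta by rewrite divr_gt0// mulr_gt0.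
(* The rate of escape to infinity, in units of tau, given by the tail
   function. *)
pose kap (eps : R) := K * eps ^+ 2 * expR (- (m0 / eps ^+ 2)).
have kap_cvg : kap eps @[eps --> 0^'+] --> (0 : R).
  have e1 := @exp_beats_power R 0 _ m00.
  have e2 : K * eps ^+ 2 @[eps --> 0^'+] --> (K * 0 ^+ 2 : R).
    apply: cvgMr; apply: cvgM; exact: (cvg_at_right_filter cvg_id).
  have e3 : kap eps @[eps --> 0^'+] --> (K * 0 ^+ 2 * 0 : R).
    apply: cvgM; first exact: e2.
    by move: e1; under eq_fun do rewrite expr0 invr1 mul1r.
  by rewrite mulr0 in e3.
have kap_lim : Num.min s (theta / (4 * (T + 1))) > 0.
  by rewrite lt_min s0 divr_gt0// mulr_gt0// ltr_wpDl.
have s20 : 0 < s / 2 by rewrite divr_gt0.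
have n1 : \forall eps \near 0^'+, `|1 - committor H eps (3/2)| <= s / 2.
  have := committor_cvg dw; move/cvgrPdist_le; exact.
near=> eps => rho rho0 sol hA.
have eps0 : 0 < eps by near: eps; exact: nbhs_right_gt.
have tau0 := tau_gt0 eps0.
have hkap : kap eps <= Num.min s (theta / (4 * (T + 1))).
  near: eps; exact: cvgr_le kap_cvg _ kap_lim.
have kap0 : 0 <= kap eps by rewrite !mulr_ge0 ?expR_ge0 ?sqr_ge0.
have kap_s : kap eps <= s by apply: le_trans hkap _; rewrite ge_min lexx.
have kap_T : 2 * kap eps * T <= theta / 2.
  have h : kap eps <= theta / (4 * (T + 1)).
    by apply: le_trans hkap _; rewrite ge_min lexx orbT.
  move: h; rewrite ler_pdivlMr; last by rewrite mulr_gt0// ltr_wpDl.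
  by clear -kap0 theta0; lra.
have m1 : `|1 - committor H eps (3/2)| <= s / 2.
  by near: eps.
have m2 : committor H eps (3/2) <= 2.
  by near: eps; apply: cvgr_le (committor_cvg dw) _ _; rewrite ltr1n.
have om_s : committor_gap H eps <= s / 2.
  by near: eps; exact: cvgr_le (committor_gap_cvg dw) _ s20.
pose m := committor H eps (3/2); pose om := committor_gap H eps.
rewrite -/m in m1 m2; rewrite -/om in om_s.
have om0 : 0 <= om := committor_gap_ge0 dw eps0.
have hL : forall x, `|x| <= 5 -> generator H eps w w' x <= - lam * f x + delta.
  by near: eps; exact: Ldelta.
have m_ge0 : 0 <= m by apply: le_trans (committor_norm_le 0 dw eps0).
have [psi [p [p' [dpsi dp sp p0 [psi_l psi_r psi01 genpsi]]]]] := htail eps eps0.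
have psi_0 x : 0 <= psi x by have /andP[] := psi01 x.
have psi_f x : psi x <= fa^-1 * f x.
  have [xa|xa] := leP x a; first by rewrite psi_l// mulr_ge0// invr_ge0 ltW.
  have /andP[_ p1] := psi01 x; apply: le_trans p1 _.
  by rewrite mulrC ler_pdivlMr// mul1r f_a// (le_trans (ltW xa))// ler_norm.
have psi_fN x : psi (- x) <= fa^-1 * f x.
  have [xa|xa] := leP (- x) a; first by rewrite psi_l// mulr_ge0// invr_ge0 ltW.
  have /andP[_ p1] := psi01 (- x); apply: le_trans p1 _.
  by rewrite mulrC ler_pdivlMr// mul1r f_a// -normrN (le_trans (ltW xa))// ler_norm.
pose Psi x := psi x + psi (- x).
have pout x : 5 <= `|x| -> p x = 0.
  by rewrite ler_normr => /orP[h|h]; apply: p0; [rewrite h orbT|apply/orP; left; clear -h a1; lra].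
have prof : tail_profile H eps (kap eps) 1 psi.
  exists p, p'; split=> //; split=> //.
  by rewrite psi_r// psi_l ?subr0//; clear -a1; lra.
have profN := tail_profile_reflect dw prof.
have [LP admPsi LPle] := tail_profile_sum prof profN.
have [_ _ bPsi _] := admissible_bmeas dw admPsi.
have Psi0 x : 0 <= Psi x by rewrite addr_ge0.
have Psi_ge_l x : psi x <= Psi x by rewrite lerDl.
have Psi_ge_r x : psi (- x) <= Psi x by rewrite lerDr.
have dr0 := initial_density sol.
have Psi_init : mean rho0 Psi <= theta / 2.
  apply: (@le_trans _ _ (mean rho0 (fun x => (2 / fa) * f x))).
    apply: mean_le => //; first exact: bmeasZ.
    move=> x; have -> : 2 / fa * f x = fa^-1 * f x + fa^-1 * f x by ring.
    by apply: lerD.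
  rewrite meanZ//; apply: (@le_trans _ _ (2 / fa * alpha)).
    by rewrite ler_wpM2l// divr_ge0 ?ltW.
  have h : alpha <= theta * fa / 4 by rewrite ge_min lexx orbT.
  apply: (@le_trans _ _ (2 / fa * (theta * fa / 4))).
    by rewrite ler_wpM2l// divr_ge0 ?ltW.
  by rewrite le_eqVlt; apply/orP; left; apply/eqP; field; rewrite gt_eqF.
have Psi_t t : 0 <= t <= T -> mean (rho t) Psi <= theta.
  move=> /andP[t0 tT].
  have b0 : 0 <= 2 * kap eps by rewrite mulr_ge0.
  have h1 := tail_bound dw eps0 sol admPsi b0 LPle t0.
  have h2 : 2 * kap eps * t <= 2 * kap eps * T by rewrite ler_wpM2l.
  rewrite -/Psi in h1; clear -h1 h2 kap_T Psi_init; lra.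
have f_t t : 0 <= t <= T -> mean (rho t) f <= s.
  move=> /andP[t0 tT].
  have hP t' : 0 <= t' <= t -> mean (rho t') Psi <= theta.
    by move=> /andP[t'0 t't]; apply: Psi_t; rewrite t'0 (le_trans t't).
  have := confinement_bound dw eps0 sol (admf eps) bPsi lam0 (ltW delta0) CC0
    (ltW theta0) t0 f0 _ hP.
  move=> h; have {h} : mean (rho t) f <= mean rho0 f + (delta + CC * theta) / lam.
    apply: h => x; have [x5|x5] := leP `|x| 5.
      apply: le_trans (hL x x5) _; rewrite lerD2l lerDl.
      by apply: mulr_ge0; [exact: CC0|exact: Psi0].
    have Psi1 : 1 <= Psi x.
      move: x5; rewrite lter_normr /Psi => /orP[x5|x5].
        by rewrite (psi_r x (ltW x5)) lerDl.
      by rewrite (psi_r (- x) (ltW x5)) lerDr.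
    have h1 := LC eps eps0 x.
    have h2 : C + lam * C <= CC * Psi x by rewrite ler_peMr.
    have h3 : lam * f x <= lam * C by rewrite ler_pM2l//; have /andP[] := fC x.
    have h4 : C <= - lam * f x + CC * Psi x.
      by rewrite mulNr addrC lerBrDr; apply: le_trans h2; rewrite lerD2l.
    by apply: le_trans h1 (le_trans h4 _); rewrite lerD2l lerDr ltW.
  have h1 : alpha <= s / 3 by rewrite ge_min lexx.
  have h2 : (delta + CC * theta) / lam <= 2 / 3 * s.
    rewrite ler_pdivrMr// /delta; clear -theta_CC; lra.
  by move=> h; clear -h h1 h2 hA; lra.
move=> t tT; split; first exact: le_trans (f_t t tT) s_eta.
have /andP[t0 tT'] := tT.
have dt := solution_density sol t0.
have S_phi x : `|sign_profile x - committor H eps x| <= s + B * f x.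
  have Bf : 0 <= B * f x by rewrite mulr_ge0.
  have [h|h] := leP `| `|x| - 1 | (1/4).
    apply: le_trans (committor_near_sign dw eps0 h) _.
    by rewrite -/m -/om; clear -m1 om_s Bf; lra.
  have h1 : 3 <= B * f x by rewrite /B mulrAC ler_pdivlMr// ler_pM2l// hc// ltW.
  have h2 := ler_normB (sign_profile x) (committor H eps x).
  have h3 := @sign_profile_norm_le1 R x; have h4 := committor_norm_le x dw eps0.
  by rewrite -/m in h4; clear -s0 h1 h2 h3 h4 m2; lra.
have hf t' : 0 <= t' <= t -> mean (rho t') f <= s.
  by move=> /andP[t'0 t't]; apply: f_t; rewrite t'0 (le_trans t't).
have hP t' : 0 <= t' <= t -> mean (rho t') Psi <= theta.
  by move=> /andP[t'0 t't]; apply: Psi_t; rewrite t'0 (le_trans t't).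
have errE : 4 * theta + (k * (s + (B * s + 4 * theta)) + 4 * kap eps) * t <= eta.
  have -> : eta = 4 * s + (k * (s + (B * s + 4 * s)) + 4 * s) * T.
    by rewrite -sBB /BB; ring.
  apply: lerD; first by rewrite ler_pM2l.
  apply: ler_pM => //.
    apply: addr_ge0; last by rewrite mulr_ge0.
    apply: mulr_ge0 => //; apply: addr_ge0; first exact: ltW.
    by apply: addr_ge0; apply: mulr_ge0 => //; exact: ltW.
  apply: lerD; last by rewrite ler_pM2l.
  by rewrite ler_wpM2l// !lerD2l ler_pM2l.
have R1 := signed_drift dw eps0 sol (or_introl erefl) prof bf bPsi _ m2 S_phi kap0
  (ltW s0) B0 (ltW s0) (ltW theta0) t0 hf hP.
have R2 := signed_drift dw eps0 sol (or_intror erefl) profN bf bPsi _ m2 S_phi kap0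
  (ltW s0) B0 (ltW s0) (ltW theta0) t0 hf hP.
have {}R1 := R1 (fun x => introT andP (conj (psi_0 x) (Psi_ge_l x))).
have {}R2 := R2 (fun x => introT andP (conj (psi_0 (- x)) (Psi_ge_r x))).
rewrite -/k; move: R1 R2; rewrite -/k => R1 R2; clear -R1 R2 errE.
by rewrite ler_norml; apply/andP; split; lra.
Unshelve. all: by end_near. Qed.

(** * Gibbs measures and the initial data *)

Lemma two_wells_measureE {R : realType} (u : R) (u0 : 0 <= u) (v0 : 0 <= 2 - u)
    (h0 : 0 <= 2^-1 :> R) :
  two_wells u = mscale (NngNum h0)
    (measure_add (mscale (NngNum u0) (@dirac _ (measurableTypeR R) 1 R))
                 (mscale (NngNum v0) (@dirac _ (measurableTypeR R) (-1) R))).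
Proof.
apply/funext => A; rewrite /two_wells [RHS]/mscale.
by congr (_ * _)%E; apply/esym; exact: measure_addE.
Qed.

(** [two_wells] is a bare set function, so its integral is first rewritten over
    the corresponding combination of measures; the positive and negative parts
    of f are then recombined at each point. *)
Lemma integral_two_wells {R : realType} (u : R) (f : R -> R) : 0 <= u <= 2 ->
  measurable_fun setT f ->
  (\int[two_wells u]_x (f x)%:E)%E = (2^-1 * (u * f 1 + (2 - u) * f (-1)))%:E.
Proof.
move=> /andP[u0 u2] mf.
have v0 : 0 <= 2 - u by rewrite subr_ge0.
have h0 : 0 <= 2^-1 :> R by rewrite invr_ge0.
have mF : measurable_fun (setT : set (measurableTypeR R)) (EFin \o f) by exact/measurable_EFinP.
rewrite (two_wells_measureE u0 v0 h0) integralE.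
rewrite !ge0_integral_mscale//=; [|exact: measurable_funeneg|exact: measurable_funepos].
rewrite !ge0_integral_measure_add//; [|exact: measurable_funeneg|exact: measurable_funepos].
rewrite !ge0_integral_mscale//=; try exact: measurable_funeneg; try exact: measurable_funepos.
rewrite !integral_dirac//; try exact: measurable_funeneg; try exact: measurable_funepos.
rewrite !diracT !mul1e.
rewrite !funeposE !funenegE -!EFinN -!EFin_max; apply: (congr1 (@EFin R)).
have hm (y : R) : Num.max y 0 - Num.max (- y) 0 = y.
  by rewrite /Num.max; case: ltP => h1; case: ltP => h2; lra.
rewrite -[in RHS](hm (f 1)) -[in RHS](hm (f (-1))).
ring.
Qed.

Lemma measurable_gibbs {R : realType} (H : R -> R) (eps : R) : double_well H ->
  measurable_fun setT (gibbs H eps).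
Proof.
move=> dw; apply: continuous_measurable_fun; apply: smooth_cont.
exact: smooth_gibbs (dw_smooth dw).
Qed.

(** The mass of a short interval next to a well, on which H <= h, already gives
    this much. *)
Lemma Zpart_lower {R : realType} (H : R -> R) (eps h r : R) : double_well H ->
  (@lebesgue_measure R).-integrable setT (fun x => (gibbs H eps x)%:E) ->
  0 < r -> (forall x, 1 <= x <= 1 + r -> H x <= h) ->
  r * expR (- (h / eps ^+ 2)) <= Zpart H eps.
Proof.
move=> dw ig r0 hr.
have mg := measurable_gibbs eps dw.
rewrite /Zpart /Rintegral -lee_fin fineK; last exact: integrable_fin_num.
apply: (@le_trans _ _ (\int[@lebesgue_measure R]_(x in `[1%R, (1 + r)%R])
    (gibbs H eps x)%:E)%E); last first.
  apply: ge0_subset_integral => //; first exact/measurable_EFinP.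
  by move=> x _; rewrite lee_fin gibbs_ge0.
apply: (@le_trans _ _ (\int[@lebesgue_measure R]_(x in `[1%R, (1 + r)%R])
    (expR (- (h / eps ^+ 2)))%:E)%E).
  rewrite integral_cst//= lebesgue_measure_itv /= lte_fin ltrDl r0.
  by rewrite -EFinB -EFinM lee_fin addrAC subrr add0r mulrC.
apply: ge0_le_integral => //.
- by apply/measurable_EFinP; exact: measurable_funTS.
- move=> x; rewrite /= in_itv /= => hx; rewrite lee_fin ler_expR lerN2.
  by rewrite ler_wpM2r ?invr_ge0 ?sqr_ge0// hr.
Qed.

Lemma gamma_density {R : realType} (H : R -> R) (eps : R) : double_well H ->
  (@lebesgue_measure R).-integrable setT (fun x => (gibbs H eps x)%:E) ->
  0 < Zpart H eps -> probability_density (gamma H eps).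
Proof.
move=> dw ig Z0.
have mg := measurable_gibbs eps dw.
split.
- by apply: measurable_funM => //; exact: measurable_cst.
- by move=> x; rewrite mulr_ge0 ?gibbs_ge0// invr_ge0 ltW.
rewrite (_ : (fun x => _) = (fun x => (Zpart H eps)^-1%:E * (gibbs H eps x)%:E)%E); last first.
  by apply/funext => x; rewrite -EFinM.
rewrite integralZl//.
rewrite -[X in (_ * X)%E]fineK; last exact: integrable_fin_num.
by rewrite -EFinM mulVf// gt_eqF.
Qed.

(** Where f >= eta / 2, the potential is at least some m > 0, and there exp (-H
    / eps ^+ 2) is at most exp (m / eps1 ^+ 2 - m / eps ^+ 2) exp (-H / eps1 ^+
    2) for a fixed eps1 >= eps: the reference Gibbs weight at eps1 supplies the
    integrability at infinity, however slowly H grows. By [Zpart_lower] the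
    partition function decays at most like exp (-m / (2 eps ^+ 2)), so the
    ratio is small. *)
Lemma gamma_concentration {R : realType} (H f : R -> R) (eps0 : R) : double_well H ->
  0 < eps0 ->
  (forall eps : R, 0 < eps -> eps < eps0 ->
    (@lebesgue_measure R).-integrable setT (fun x => (gibbs H eps x)%:E)) ->
  bmeas f -> (forall x, 0 <= f x) ->
  (forall eta, 0 < eta -> exists2 m : R, 0 < m & forall x, eta <= f x -> m <= H x) ->
  forall eta, 0 < eta -> \forall eps \near 0^'+, mean (gamma H eps) f <= eta.
Proof.
move=> dw eps00 ig bf f0 hf eta eta0.
have eta20 : 0 < eta / 2 by rewrite divr_gt0.
have [m m0 hm] := hf _ eta20.
have [_ [M0 hM0]] := bf.
pose M := `|M0| + 1; have M_gt0 : 0 < M by rewrite ltr_wpDl.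
have fM x : f x <= M.
  rewrite (le_trans (ler_norm _))// (le_trans (hM0 x))// (le_trans (ler_norm _))//.
  by rewrite /M lerDl.
have cH := is_derive_cont (dw_derive dw).
have [r r0 hr] : exists2 r : R, 0 < r & forall x, 1 <= x <= 1 + r -> H x <= m / 2.
  have [H1 _] := dw_wells dw.
  have : \forall y \near (1 : R), H y <= m / 2.
    by apply: (cvgr_le _ (cH 1)); rewrite H1 divr_gt0.
  move=> [d /= d0 hd]; exists (d / 2); first by rewrite divr_gt0.
  move=> x /andP[x1 xd]; apply: hd; rewrite /= distrC ger0_norm ?subr_ge0//; lra.
pose eps1 := eps0 / 2; have eps10 : 0 < eps1 by rewrite divr_gt0.
have eps1_lt : eps1 < eps0 by rewrite ltr_pdivrMr// ltr_pMr// ltr1n.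
pose Z1 := Zpart H eps1.
have ig1 := ig _ eps10 eps1_lt.
have Z10 : 0 <= Z1 by apply: Rintegral_ge0 => x _; exact: gibbs_ge0.
pose K := M * expR (m / eps1 ^+ 2) * Z1 / r.
have K0 : 0 <= K by rewrite divr_ge0 ?(ltW r0)// !mulr_ge0 ?expR_ge0 ?(ltW M_gt0).
have m20 : 0 < m / 2 by rewrite divr_gt0.
have lim : K * expR (- (m / 2 / eps ^+ 2)) @[eps --> 0^'+] --> (0 : R).
  have e1 := @exp_beats_power R 0 _ m20.
  have e2 : K * (eps ^- 0 * expR (- (m / 2 / eps ^+ 2))) @[eps --> 0^'+] --> (K * 0 : R).
    exact: cvgMr.
  rewrite mulr0 in e2.
  by move: e2; under eq_fun do rewrite expr0 invr1 mul1r.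
have n1 : \forall eps \near 0^'+, K * expR (- (m / 2 / eps ^+ 2)) <= eta / 2.
  exact: cvgr_le lim _ eta20.
near=> eps.
have e0 : 0 < eps by near: eps; exact: nbhs_right_gt.
have e1 : eps < eps1 by near: eps; exact: nbhs_right_lt.
have nK : K * expR (- (m / 2 / eps ^+ 2)) <= eta / 2 by near: eps.
have ige := ig _ e0 (lt_trans e1 eps1_lt).
have Zl := Zpart_lower dw ige r0 hr.
have E0 : 0 < expR (- (m / 2 / eps ^+ 2)) by exact: expR_gt0.
have Z0 : 0 < Zpart H eps by apply: lt_le_trans Zl; rewrite mulr_gt0.
have dg := gamma_density dw ige Z0.
pose c := M * expR (m / eps1 ^+ 2) * expR (- (m / eps ^+ 2)).
have c0 : 0 <= c by rewrite !mulr_ge0 ?expR_ge0 ?(ltW M_gt0).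
have pt x : f x * gibbs H eps x <= eta / 2 * gibbs H eps x + c * gibbs H eps1 x.
  have g0 := gibbs_ge0 H eps x; have g1 := gibbs_ge0 H eps1 x.
  have [h|h] := leP (eta / 2) (f x); last first.
    apply: (@le_trans _ _ (eta / 2 * gibbs H eps x)); first by rewrite ler_wpM2r// ltW.
    by rewrite lerDl mulr_ge0.
  have mH := hm _ h.
  apply: (@le_trans _ _ (c * gibbs H eps1 x)); last by rewrite lerDr mulr_ge0// ltW.
  apply: (@le_trans _ _ (M * gibbs H eps x)); first by rewrite ler_wpM2r.
  rewrite /c -!mulrA ler_pM2l// /gibbs -!expRD ler_expR.
  have i1 : eps1 ^- 2 <= eps ^- 2.
    by rewrite lef_pV2 ?posrE ?exprn_gt0// ler_sqr ?nnegrE ?(ltW e0) ?(ltW eps10)// ltW.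
  have : 0 <= (H x - m) * (eps ^- 2 - eps1 ^- 2) by rewrite mulr_ge0// subr_ge0.
  clear; move: (H x) (eps ^- 2) (eps1 ^- 2) => a b d; lra.
have intle : \int[@lebesgue_measure R]_x (f x * gibbs H eps x) <=
    eta / 2 * Zpart H eps + c * Z1.
  have i2 : (@lebesgue_measure R).-integrable setT (EFin \o (fun x => eta / 2 * gibbs H eps x)).
    exact: (integrableZl measurableT (eta / 2) ige).
  have i3 : (@lebesgue_measure R).-integrable setT (EFin \o (fun x => c * gibbs H eps1 x)).
    exact: (integrableZl measurableT c ig1).
  rewrite /Z1 /Zpart -!RintegralZl// -RintegralD//.
  apply: le_Rintegral => //; last first.
    exact: (integrableD measurableT i2 i3).
  have := mean_integrable dg bf.
  move=> /(integrableZl measurableT (Zpart H eps)).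
  congr (integrable _ _ _); apply/funext => x /=; rewrite -EFinM; congr EFin.
  by rewrite /gamma; field; rewrite gt_eqF.
have -> : mean (gamma H eps) f =
    (Zpart H eps)^-1 * \int[@lebesgue_measure R]_x (f x * gibbs H eps x).
  rewrite -RintegralZl//.
    by apply: eq_Rintegral => x _; rewrite /gamma; ring.
  have := mean_integrable dg bf.
  move=> /(integrableZl measurableT (Zpart H eps)).
  congr (integrable _ _ _); apply/funext => x /=; rewrite -EFinM; congr EFin.
  by rewrite /gamma; field; rewrite gt_eqF.
rewrite mulrC ler_pdivrMr//; apply: le_trans intle _.
suff : c * Z1 <= eta / 2 * Zpart H eps by clear; lra.
apply: (@le_trans _ _ (eta / 2 * (r * expR (- (m / 2 / eps ^+ 2))))); last by rewrite ler_pM2l.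
have -> : c * Z1 = K * expR (- (m / 2 / eps ^+ 2)) * (r * expR (- (m / 2 / eps ^+ 2))).
  have -> : c = M * expR (m / eps1 ^+ 2) *
      (expR (- (m / 2 / eps ^+ 2)) * expR (- (m / 2 / eps ^+ 2))).
    by rewrite -expRD /c; congr (_ * expR _); lra.
  by rewrite /K; field; rewrite gt_eqF.
by rewrite ler_wpM2r// mulr_ge0// ltW.
Unshelve. all: by end_near. Qed.

(** Write rho0 = u0 * gamma. The energy bounds the average of u0 ^+ 2 under
    gamma, hence by Young's inequality f u0 <= s u0 ^+ 2 + f ^+ 2 / (4 s) the
    average of f under rho0 is at most s C plus a multiple of its average under
    gamma, which tends to 0. *)
Lemma initial_concentration {R : realType} (H f : R -> R) (eps0 C c : R)
    (rho0 : R -> R -> R) : double_well H -> 0 < eps0 ->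
  (forall eps : R, 0 < eps -> eps < eps0 ->
    (@lebesgue_measure R).-integrable setT (fun x => (gibbs H eps x)%:E)) ->
  bmeas f -> (forall x, 0 <= f x) ->
  (forall eta, 0 < eta -> exists2 m : R, 0 < m & forall x, eta <= f x -> m <= H x) ->
  0 < c ->
  (forall eps : R, 0 < eps -> eps < eps0 ->
    [/\ probability_density (rho0 eps),
        (\int[@lebesgue_measure R]_x
          (gamma H eps x * `|rho0 eps x / gamma H eps x| ^+ 2)%:E <= C%:E)%E &
        forall x, c <= rho0 eps x / gamma H eps x]) ->
  forall eta, 0 < eta -> \forall eps \near 0^'+, mean (rho0 eps) f <= eta.
Proof.
move=> dw eps00 ig bf f0 hf c0 hrho eta eta0.
have [_ [M0 hM0]] := bf.
pose M := `|M0| + 1; have M_gt0 : 0 < M by rewrite ltr_wpDl.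
have fM x : f x <= M.
  rewrite (le_trans (ler_norm _))// (le_trans (hM0 x))// (le_trans (ler_norm _))//.
  by rewrite /M lerDl.
pose C1 := `|C| + 1; have C10 : 0 < C1 by rewrite ltr_wpDl.
have CC1 : C <= C1 by rewrite (le_trans (ler_norm _))// /C1 lerDl.
pose s := eta / (2 * C1); have s0 : 0 < s by rewrite divr_gt0// mulr_gt0.
pose K := M / (4 * s); have K0 : 0 < K by rewrite divr_gt0// mulr_gt0.
have eK : 0 < eta / 2 / K by apply: divr_gt0 => //; apply: divr_gt0.
have gc := gamma_concentration dw eps00 ig bf f0 hf eK.
near=> eps.
have e0 : 0 < eps by near: eps; exact: nbhs_right_gt.
have e1 : eps < eps0 by near: eps; exact: nbhs_right_lt.
have gce : mean (gamma H eps) f <= eta / 2 / K by near: eps.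
have [dr0 hC hc] := hrho _ e0 e1.
have Zn0 : Zpart H eps != 0.
  (* Were the partition function 0, the conventions for division by 0 would
     give the quotient the value 0, below c. *)
  apply/eqP => Z0; have := hc 0; rewrite /gamma Z0 invr0 mul0r invr0 mulr0.
  by rewrite leNgt c0.
have Z0 : 0 < Zpart H eps.
  by rewrite lt_def Zn0 /=; apply: Rintegral_ge0 => x _; exact: gibbs_ge0.
have dg := gamma_density dw (ig _ e0 e1) Z0.
have g0 x : 0 < gamma H eps x by rewrite mulr_gt0 ?invr_gt0 ?expR_gt0.
pose w x := gamma H eps x * `|rho0 eps x / gamma H eps x| ^+ 2.
have wE x : w x = rho0 eps x ^+ 2 / gamma H eps x.
  by rewrite /w real_normK ?num_real//; field; rewrite gt_eqF.
have w0 x : 0 <= w x by rewrite mulr_ge0 ?sqr_ge0// ltW.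
have [mr0 r00 _] := dr0; have [mg _ _] := dg.
have mw : measurable_fun setT w.
  rewrite (_ : w = fun x => rho0 eps x ^+ 2 * expR (H x / eps ^+ 2) * Zpart H eps).
    apply: measurable_funM; last exact: measurable_cst.
    apply: measurable_funM; first exact: measurable_funX.
    apply: continuous_measurable_fun; apply: smooth_cont.
    exact: smooth_weight (dw_smooth dw).
  by apply/funext => x; rewrite wE /gamma /gibbs expRN invfM !invrK mulrA mulrAC.
have iw : (@lebesgue_measure R).-integrable setT (EFin \o w).
  apply/integrableP; split; first exact/measurable_EFinP.
  apply: (@le_lt_trans _ _ (\int[@lebesgue_measure R]_x (w x)%:E)%E).
    by rewrite le_eqVlt; apply/orP; left; apply/eqP/eq_integral => x _ /=; rewrite ger0_norm.
  by apply: le_lt_trans hC _; rewrite ltry.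
have wC : \int[@lebesgue_measure R]_x w x <= C.
  by rewrite -lee_fin /Rintegral fineK// integrable_fin_num.
have pt x : f x * rho0 eps x <= s * w x + K * (f x * gamma H eps x).
  rewrite wE; set g := gamma H eps x; set r := rho0 eps x; set y := f x.
  have gg : 0 < g by exact: g0.
  apply: (@le_trans _ _ (s * (r ^+ 2 / g) + y ^+ 2 / (4 * s) * g)).
    rewrite -subr_ge0.
    have -> : s * (r ^+ 2 / g) + y ^+ 2 / (4 * s) * g - y * r =
        s / g * (r - y * g / (2 * s)) ^+ 2.
      by field; rewrite !gt_eqF.
    by rewrite mulr_ge0 ?sqr_ge0// divr_ge0// ltW.
  have -> : K * (y * g) = M * y / (4 * s) * g by rewrite /K; ring.
  have s4 : 0 <= (4 * s)^-1 by rewrite invr_ge0 mulr_ge0// ltW.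
  by rewrite lerD2l ler_wpM2r ?(ltW gg)// ler_wpM2r// expr2 ler_wpM2r//; [exact: f0|exact: fM].
have i1 : (@lebesgue_measure R).-integrable setT (EFin \o (fun x => s * w x)).
  exact: (integrableZl measurableT s iw).
have i0 := mean_integrable dg bf.
have i2 : (@lebesgue_measure R).-integrable setT (EFin \o (fun x => K * (f x * gamma H eps x))).
  exact: (integrableZl measurableT K i0).
apply: (@le_trans _ _ (s * \int[@lebesgue_measure R]_x w x + K * mean (gamma H eps) f)).
  rewrite /mean -!RintegralZl// -RintegralD//.
  apply: le_Rintegral => //; first exact: mean_integrable.
  exact: (integrableD measurableT i1 i2).
have h1 : s * \int[@lebesgue_measure R]_x w x <= eta / 2.
  apply: (@le_trans _ _ (s * C1)); first by rewrite ler_pM2l// (le_trans wC).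
  by rewrite le_eqVlt; apply/orP; left; apply/eqP; rewrite /s; field; rewrite gt_eqF.
have h2 : K * mean (gamma H eps) f <= eta / 2 by rewrite mulrC -ler_pdivlMr.
by rewrite [leRHS](splitr eta); exact: lerD.
Unshelve. all: by end_near. Qed.

(** * Passing to the limit *)

Lemma step_gt0 {R : realType} (x : R) : 0 < x -> 0 < step x.
Proof.
move=> x0; have [x1|x1] := leP 1 x; first by rewrite step_eq1.
rewrite -[ltLHS](@step_eq0 R 0)//; apply: (derive_ltr step_derive x0) => y /andP[y0 yx].
rewrite divr_gt0 ?bell_mass_gt0// mulr_gt0// flat_gt0// subr_gt0.
exact: lt_trans x1.
Qed.

Lemma weakstar_mean {R : realType} (F : set_system R) (r : R -> R -> R)
    (P : probability (measurableTypeR R) R) (f : R -> R) : Filter F ->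
  weakstar_cvg F (fun eps => density_measure (r eps)) P ->
  (\forall eps \near F, probability_density (r eps)) ->
  continuous f -> (exists M : R, forall x, `|f x| <= M) ->
  mean (r eps) f @[eps --> F] --> \int[P]_x f x.
Proof.
move=> FF wc dr cf bf.
have bm : bmeas f by exact: bmeas_continuous.
have := wc f cf bf.
rewrite -(@fineK _ (\int[P]_x (f x)%:E)%E); last first.
  by apply: integrable_fin_num => //; exact: bounded_integrable_prob.
move=> /fine_cvg; apply: near_eq_lim; near=> eps.
by rewrite /= density_measure_integral//; near: eps.
Unshelve. all: by end_near. Qed.

(** The limit P of the initial data gives no mass to ]0, 3/4[: the continuous
    function [h], positive exactly there, is dominated by a multiple of [f],
    whose averages tend to 0. Hence P `]0, +oo[ is the integral of the
    continuous cutoff [g], that is the limit of the averages of [g] against the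
    initial data; and on the wells 2 g - 1 agrees with the limit -1 or 1 of the
    committor, the rest of the line being again controlled by [f]. *)
Lemma initial_limit {R : realType} (H f : R -> R) (rho0 : R -> R -> R)
    (P : probability (measurableTypeR R) R) : double_well H -> bmeas f ->
  (forall x, 0 <= f x) ->
  (forall r, 0 < r < 1 -> exists2 c : R, 0 < c &
     forall x, r <= `| `|x| - 1 | -> c <= f x) ->
  weakstar_cvg 0^'+ (fun eps => density_measure (rho0 eps)) P ->
  (\forall eps \near 0^'+, probability_density (rho0 eps)) ->
  (forall eta, 0 < eta -> \forall eps \near 0^'+, mean (rho0 eps) f <= eta) ->
  mean (rho0 eps) (committor H eps) @[eps --> 0^'+]
    --> 2 * fine (P `]0, +oo[) - 1.
Proof.
move=> dw bf f0 f_off wc dr small.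
have r14 : 0 < (1/4 : R) < 1 by apply/andP; split; lra.
have [c c0 hc] := f_off _ r14.
pose g (x : R) := step (2 * x + 0).
pose h (x : R) := step (4 * x + 0) * step (-4 * x + 3).
have cg : continuous g by apply: smooth_cont; apply: smooth_affine; exact: smooth_step.
have ch : continuous h.
  by apply: smooth_cont; apply: smoothM; apply: smooth_affine; exact: smooth_step.
have g01 x : 0 <= g x <= 1 by rewrite /g step_ge0 step_le1.
have h01 x : 0 <= h x <= 1.
  by rewrite /h mulr_ge0 ?step_ge0//= mulr_ile1 ?step_ge0 ?step_le1.
have bg : exists M : R, forall x, `|g x| <= M.
  by exists 1 => x; have /andP[? ?] := g01 x; rewrite ger0_norm.
have bh : exists M : R, forall x, `|h x| <= M.
  by exists 1 => x; have /andP[? ?] := h01 x; rewrite ger0_norm.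
have bmg := bmeas_continuous cg bg; have bmh := bmeas_continuous ch bh.
have FF : Filter (0^'+ : set_system R) by apply: filter_filter.
have lg := weakstar_mean FF wc dr cg bg.
have lh := weakstar_mean FF wc dr ch bh.
have h_supp x : (x <= 0) || (3/4 <= x) -> h x = 0.
  rewrite /h => /orP[x0|x3]; first by rewrite step_eq0 ?mul0r//; lra.
  by rewrite [step (-4 * x + 3)]step_eq0 ?mulr0//; lra.
have h_pos x : 0 < x < 3/4 -> 0 < h x.
  by move=> /andP[x0 x3]; rewrite mulr_gt0// step_gt0//; lra.
have hf x : h x <= c^-1 * f x.
  have [/andP[x0 x3]|hN] := boolP (0 < x < 3/4); last first.
    rewrite h_supp; first by rewrite mulr_ge0// invr_ge0 ltW.
    by move: hN; rewrite negb_and -!leNgt.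
  have /andP[_ h1] := h01 x; apply: le_trans h1 _.
  rewrite mulrC ler_pdivlMr// mul1r; apply: hc.
  by rewrite (gtr0_norm x0) ler_normr; apply/orP; right; lra.
have lf : mean (rho0 eps) f @[eps --> 0^'+] --> (0 : R).
  apply/cvgrPdist_le => e e0; near=> eps.
  have d : probability_density (rho0 eps) by near: eps.
  by rewrite sub0r normrN ger0_norm ?mean_ge0//; near: eps; exact: small.
have lh0 : mean (rho0 eps) h @[eps --> 0^'+] --> (0 : R).
  have lcf : c^-1 * mean (rho0 eps) f @[eps --> 0^'+] --> (c^-1 * 0 : R) by exact: cvgMr.
  rewrite mulr0 in lcf.
  apply: (squeeze_cvgr _ (cvg_cst 0) lcf); near=> eps.
  have d : probability_density (rho0 eps) by near: eps.
  rewrite mean_ge0//=; last by move=> x; have /andP[] := h01 x.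
  by rewrite -meanZ//; apply: mean_le => //; exact: bmeasZ.
have Ih : \int[P]_x h x = 0.
  by rewrite -(cvg_lim (@Rhausdorff R) lh) (cvg_lim (@Rhausdorff R) lh0).
have ih := bounded_integrable_prob P bmh.
have aeh : ae_eq P setT (EFin \o h) (cst 0%E).
  apply/ae_eq_integral_abs => //; first by apply/measurable_EFinP; case: bmh.
  transitivity (\int[P]_x (h x)%:E)%E.
    apply: eq_integral => x _ /=; rewrite ger0_norm//.
    by have /andP[] := h01 x.
  rewrite -(@fineK _ (\int[P]_x (h x)%:E)%E); last exact: integrable_fin_num.
  by rewrite -[X in X%:E = _]/(\int[P]_x h x) Ih.
have mI : measurable (`]0, +oo[ : set (measurableTypeR R)) by exact: measurable_itv.
have Ig : \int[P]_x g x = fine (P `]0, +oo[).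
  rewrite /Rintegral; congr fine.
  transitivity (\int[P]_x (\1_(`]0, +oo[ : set (measurableTypeR R)) x)%:E)%E; last first.
    by rewrite integral_indic// setIT.
  apply: ge0_ae_eq_integral => //.
  - by apply/measurable_EFinP; case: bmg.
  - exact/measurable_EFinP/measurable_indic.
  - by move=> x _; rewrite lee_fin; have /andP[] := g01 x.
  - apply: filterS aeh => x hx _; have {}hx := hx I.
    have {hx}hx : h x = 0 by case: hx.
    congr EFin; rewrite indicE; have [x0|x0] := leP x 0.
      rewrite memNset; last by rewrite /= in_itv /= andbT; apply/negP; rewrite -leNgt.
      by rewrite /g step_eq0//; lra.
    rewrite mem_set; last by rewrite /= in_itv /= x0.
    have [x3|x3] := leP (3/4) x; first by rewrite /g step_eq1//; lra.
    by have := h_pos x; rewrite x0 x3 hx ltxx => /(_ isT).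
rewrite Ig in lg.
have lg2 : 2 * mean (rho0 eps) g - 1 @[eps --> 0^'+] --> 2 * fine (P `]0, +oo[) - 1.
  by apply: cvgB; [exact: cvgMr|exact: cvg_cst].
apply/cvgrPdist_le => e e0.
have e20 : 0 < e / 4 by rewrite divr_gt0.
have n1 : \forall eps \near 0^'+, `|1 - committor H eps (3/2)| <= e / 4.
  by have := committor_cvg dw; move/cvgrPdist_le; exact.
have n2 : \forall eps \near 0^'+, committor_gap H eps <= e / 4.
  exact: cvgr_le (committor_gap_cvg dw) _ e20.
have n3 : \forall eps \near 0^'+, committor H eps (3/2) <= 2.
  by apply: cvgr_le (committor_cvg dw) _ _; rewrite ltr1n.
have n4 : \forall eps \near 0^'+,
    `|2 * fine (P `]0, +oo[) - 1 - (2 * mean (rho0 eps) g - 1)| <= e / 4.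
  by move/cvgrPdist_le : lg2; exact.
have ec : 0 < e / 4 / (3 / c) by rewrite !divr_gt0.
have n5 := small _ ec.
near=> eps.
have eps0 : 0 < eps by near: eps; exact: nbhs_right_gt.
have d : probability_density (rho0 eps) by near: eps.
have k1 : `|1 - committor H eps (3/2)| <= e / 4 by near: eps.
have k2 : committor_gap H eps <= e / 4 by near: eps.
have k3 : committor H eps (3/2) <= 2 by near: eps.
have k4 : `|2 * fine (P `]0, +oo[) - 1 - (2 * mean (rho0 eps) g - 1)| <= e / 4 by near: eps.
have k5 : mean (rho0 eps) f <= e / 4 / (3 / c) by near: eps.
have bphi := bmeas_committor dw eps0.
have pt x : `|2 * g x + (-1 + -1 * committor H eps x)| <= e / 2 + 3 / c * f x.
  have f3 : 0 <= 3 / c * f x by rewrite mulr_ge0// divr_ge0// ltW.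
  have -> : 2 * g x + (-1 + -1 * committor H eps x) = 2 * g x - 1 - committor H eps x by ring.
  have [hx|hx] := leP `| `|x| - 1 | (1/4).
    have -> : 2 * g x - 1 = sign_profile x.
      move: hx; rewrite ler_norml => /andP[]; have [x0|x0] := leP 0 x.
        rewrite ger0_norm// => x1 x2; rewrite /g /sign_profile step_eq1; last by clear -x1; lra.
        rewrite bump_eq1; last by apply/andP; split; clear -x1 x2; lra.
        by rewrite bump_eq0; [lra|apply/orP; left; clear -x0; lra].
      rewrite ltr0_norm// => x1 x2; rewrite /g /sign_profile step_eq0; last by clear -x0; lra.
      rewrite bump_eq0; last by apply/orP; left; clear -x0; lra.
      by rewrite bump_eq1; [lra|apply/andP; split; clear -x1 x2; lra].
    apply: le_trans (committor_near_sign dw eps0 hx) _.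
    by clear -k1 k2 f3; lra.
  have h3 : 3 <= 3 / c * f x by rewrite mulrAC ler_pdivlMr// ler_pM2l// hc// ltW.
  have h4 := le_trans (committor_norm_le x dw eps0) k3.
  have h5 : `|2 * g x - 1| <= 1.
    by have /andP[] := g01 x; clear; move=> ? ?; rewrite ler_norml; apply/andP; split; lra.
  have h6 := ler_normB (2 * g x - 1) (committor H eps x).
  by clear -h3 h4 h5 h6 e0; lra.
have bA : bmeas (fun x => 2 * g x + (-1 + -1 * committor H eps x)).
  apply: bmeasD; first exact: bmeasZ.
  by apply: bmeasD; [exact: bmeas_cst|exact: bmeasZ].
have bB : bmeas (fun x => e / 2 + 3 / c * f x).
  by apply: bmeasD; [exact: bmeas_cst|exact: bmeasZ].
have := mean_norm_le d bA bB pt.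
rewrite (meanD d (bmeasZ 2 bmg) (bmeasD (bmeas_cst (-1)) (bmeasZ (-1) bphi))).
rewrite (meanD d (bmeas_cst (-1)) (bmeasZ (-1) bphi)).
rewrite (meanD d (bmeas_cst (e / 2)) (bmeasZ (3 / c) bf)).
rewrite !mean_cst// (meanZ 2 d bmg) (meanZ (-1) d bphi) (meanZ (3 / c) d bf) => k6.
have k7 : 3 / c * mean (rho0 eps) f <= e / 4.
  by rewrite mulrC -ler_pdivlMr// divr_gt0.
have := ler_normD (2 * fine (P `]0, +oo[) - 1 - (2 * mean (rho0 eps) g - 1))
  (2 * mean (rho0 eps) g + (-1 + -1 * mean (rho0 eps) (committor H eps))).
rewrite (_ : _ - _ + _ = 2 * fine (P `]0, +oo[) - 1 -
  mean (rho0 eps) (committor H eps)); last by ring.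
by move=> k8; clear -k4 k6 k7 k8; lra.
Unshelve. all: by end_near. Qed.

(** Near the wells [G] is close to the function of the committor that
    interpolates affinely between the values of [G] at -1 and 1. Away from the
    wells both are bounded, and the mass there is controlled by [f]. *)
Lemma observable_bound {R : realType} (H f G rho : R -> R) (eps M r c eta : R) :
  double_well H -> 0 < eps -> probability_density rho -> bmeas f -> (forall x, 0 <= f x) ->
  continuous G -> (forall x, `|G x| <= M) -> r <= 1/4 -> 0 < c -> 0 <= eta ->
  (forall x, r <= `| `|x| - 1 | -> c <= f x) ->
  (forall x, `|x - 1| < r -> `|G x - G 1| <= eta) ->
  (forall x, `|x + 1| < r -> `|G x - G (-1)| <= eta) ->
  committor H eps (3/2) <= 2 ->
  let Y := mean rho (committor H eps) in
  `|mean rho G - 2^-1 * ((1 + Y) * G 1 + (1 - Y) * G (-1))| <=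
    eta + M * (`|1 - committor H eps (3/2)| + committor_gap H eps)
      + 4 * M / c * mean rho f.
Proof.
move=> dw eps0 d bf f0 cG GM r14 c0 eta0 hc hG1 hGN m2 /=; set Y := mean rho _.
have M0 : 0 <= M by exact: le_trans (normr_ge0 _) (GM 0).
have bG : bmeas G by apply: bmeas_continuous => //; exists M.
have bphi := bmeas_committor dw eps0.
(* A + D * y interpolates G (-1) and G 1 at y = -1 and y = 1. *)
pose D := (G 1 - G (-1)) / 2; pose A := (G 1 + G (-1)) / 2.
have DM : `|D| <= M.
  rewrite /D normrM [`|2^-1|]ger0_norm ?invr_ge0// ler_pdivrMr//.
  apply: le_trans (ler_normB _ _) _; rewrite mulr_natr mulr2n; exact: lerD.
have AM : `|A| <= M.
  rewrite /A normrM [`|2^-1|]ger0_norm ?invr_ge0// ler_pdivrMr//.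
  apply: le_trans (ler_normD _ _) _; rewrite mulr_natr mulr2n; exact: lerD.
set nu := `|1 - _| + _.
have nu0 : 0 <= nu by rewrite addr_ge0// committor_gap_ge0.
have pt x : `|G x + (- A + (- D) * committor H eps x)| <=
    (eta + M * nu) + 4 * M / c * f x.
  have f4 : 0 <= 4 * M / c * f x by rewrite mulr_ge0// divr_ge0 ?(ltW c0)// mulr_ge0.
  have Mnu : 0 <= M * nu by rewrite mulr_ge0.
  have [hx|hx] := leP r `| `|x| - 1 |.
    have h1 : 4 * M <= 4 * M / c * f x.
      by rewrite mulrAC ler_pdivlMr// ler_wpM2l ?hc// mulr_ge0.
    have h2 := le_trans (committor_norm_le x dw eps0) m2.
    have h3 : `|(- D) * committor H eps x| <= M * 2.
      by rewrite normrM normrN ler_pM.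
    have h4 := ler_normD (G x) (- A + (- D) * committor H eps x).
    have h5 := ler_normD (- A) ((- D) * committor H eps x); rewrite normrN in h5.
    by have := GM x; clear -h1 h3 h4 h5 AM eta0 Mnu; lra.
  have hx4 : `| `|x| - 1 | <= 1/4 by apply: le_trans r14; exact: ltW.
  have S := committor_near_sign dw eps0 hx4; rewrite -/nu in S.
  have key sg : sign_profile x = sg -> sg = 1 \/ sg = -1 -> `|G x - G sg| <= eta ->
      `|G x + (- A + (- D) * committor H eps x)| <= eta + M * nu + 4 * M / c * f x.
    move=> sE sg1 hG.
    have -> : G x + (- A + (- D) * committor H eps x) =
        (G x - G sg) + D * (sign_profile x - committor H eps x).
      by rewrite sE /A /D; case: sg1 => ->; lra.
    apply: le_trans (ler_normD _ _) _; rewrite normrM.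
    have : `|D| * `|sign_profile x - committor H eps x| <= M * nu by rewrite ler_pM.
    by clear -hG f4; lra.
  move: hx4 (hx); rewrite ler_norml ltr_norml => /andP[]; have [x0|x0] := leP 0 x.
    rewrite ger0_norm// => x1 x2 /andP[x3 x4]; apply: (key 1); [|by left|].
      rewrite /sign_profile bump_eq1; last by apply/andP; split; clear -x1 x2; lra.
      by rewrite bump_eq0 ?subr0//; apply/orP; left; clear -x0; lra.
    by apply: hG1; rewrite ltr_norml x3 x4.
  rewrite ltr0_norm// => x1 x2 /andP[x3 x4]; apply: (key (-1)); [|by right|].
    rewrite /sign_profile bump_eq0; last by apply/orP; left; clear -x0; lra.
    by rewrite bump_eq1 ?sub0r//; apply/andP; split; clear -x1 x2; lra.
  by apply: hGN; rewrite ltr_norml; apply/andP; split; clear -x3 x4; lra.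
have bX : bmeas (fun x => G x + (- A + (- D) * committor H eps x)).
  by apply: bmeasD => //; apply: bmeasD; [exact: bmeas_cst|exact: bmeasZ].
have bB : bmeas (fun x => (eta + M * nu) + 4 * M / c * f x).
  by apply: bmeasD; [exact: bmeas_cst|exact: bmeasZ].
have := mean_norm_le d bX bB pt.
rewrite (meanD d bG (bmeasD (bmeas_cst (- A)) (bmeasZ (- D) bphi))).
rewrite (meanD d (bmeas_cst (- A)) (bmeasZ (- D) bphi)).
rewrite (meanD d (bmeas_cst (eta + M * nu)) (bmeasZ (4 * M / c) bf)).
rewrite !mean_cst// (meanZ (- D) d bphi) (meanZ (4 * M / c) d bf).
congr (`|_| <= _); rewrite /A /D -/Y; lra.
Qed.

(** * Convergence to the two-state dynamics *)

Lemma decay_itv {R : realType} (H : R -> R) (t : R) : 0 <= t ->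
  0 < expR (- (kramers H * t)) <= 1.
Proof.
by move=> t0; rewrite expR_gt0/= -expR0 ler_expR oppr_le0 mulr_ge0// kramers_ge0.
Qed.

(** By [observable_bound] the average of [G] is, up to o (1), an affine
    function of the average of the committor, which follows its exponential
    decay towards 0 from the limit initial value [q]. *)
Lemma relaxation_cvg {R : realType} (H G : R -> R) (eps0 t q : R)
    (rho : R -> R -> R -> R) (rho0 : R -> R -> R) (f : R -> R) :
  double_well H -> 0 < eps0 ->
  (forall eps : R, 0 < eps -> eps < eps0 -> solution H eps (rho eps) (rho0 eps)) ->
  bmeas f -> (forall x, 0 <= f x) ->
  (forall r, 0 < r < 1 -> exists2 c : R, 0 < c &
     forall x, r <= `| `|x| - 1 | -> c <= f x) ->
  (forall T eta : R, 0 <= T -> 0 < eta -> exists2 alpha : R, 0 < alpha &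
     \forall eps \near 0^'+, forall rho rho0, solution H eps rho rho0 ->
       mean rho0 f <= alpha -> forall t, 0 <= t <= T ->
       mean (rho t) f <= eta /\
       `|mean (rho t) (committor H eps) -
         expR (- (kramers H * t)) * mean rho0 (committor H eps)| <= eta) ->
  (forall eta, 0 < eta -> \forall eps \near 0^'+, mean (rho0 eps) f <= eta) ->
  mean (rho0 eps) (committor H eps) @[eps --> 0^'+] --> q ->
  0 <= t -> continuous G -> (exists M : R, forall x, `|G x| <= M) ->
  let Q := expR (- (kramers H * t)) * q in
  mean (rho eps t) G @[eps --> 0^'+]
    --> 2^-1 * ((1 + Q) * G 1 + (1 - Q) * G (-1)).
Proof.
move=> dw eps00 sol bf f0 f_off dyn small limq t0 cG [M GM] /=; set Q := _ * q.
have M0 : 0 <= M by exact: le_trans (normr_ge0 _) (GM 0).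
apply/cvgrPdist_le => e e0.
have e40 : 0 < e / 4 by rewrite divr_gt0.
have [r [r0 r14 hG1 hGN]] : exists r : R, [/\ 0 < r, r <= 1/4,
    forall x, `|x - 1| < r -> `|G x - G 1| <= e / 4 &
    forall x, `|x + 1| < r -> `|G x - G (-1)| <= e / 4].
  have /cvgrPdist_le/(_ _ e40)[d1 /= d10 hd1] := cG 1.
  have /cvgrPdist_le/(_ _ e40)[d2 /= d20 hd2] := cG (-1).
  exists (Num.min (Num.min d1 d2) (1/4)); split.
  - by rewrite !lt_min d10 d20 divr_gt0.
  - by rewrite ge_min lexx orbT.
  - move=> x; rewrite !lt_min => /andP[/andP[x1 _] _]; rewrite distrC.
    by apply: hd1; rewrite /= distrC.
  - move=> x; rewrite !lt_min => /andP[/andP[_ x2] _]; rewrite distrC; apply: hd2.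
    by rewrite /= distrC opprK.
have r1 : 0 < r < 1 by rewrite r0 /=; lra.
have [c c0 hc] := f_off _ r1.
pose K := 4 * M / c + M + M + 1.
have K0 : 0 < K by rewrite ltr_wpDl// !addr_ge0// divr_ge0 ?(ltW c0)// mulr_ge0.
pose s := e / 4 / K; have s0 : 0 < s by rewrite divr_gt0.
have sK : K * s = e / 4 by rewrite /s mulrC divfK// gt_eqF.
have [al al0 hdyn] := dyn t s t0 s0.
have M10 : 0 < M + 1 by rewrite ltr_wpDl.
have eM0 : 0 < e / 8 / (M + 1) by rewrite !divr_gt0.
have n1 : \forall eps \near 0^'+, `|1 - committor H eps (3/2)| <= e / 8 / (M + 1).
  by have := committor_cvg dw; move/cvgrPdist_le; exact.
have n2 : \forall eps \near 0^'+, committor_gap H eps <= e / 8 / (M + 1).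
  exact: cvgr_le (committor_gap_cvg dw) _ eM0.
have n3 : \forall eps \near 0^'+, committor H eps (3/2) <= 2.
  by apply: cvgr_le (committor_cvg dw) _ _; rewrite ltr1n.
have n4 : \forall eps \near 0^'+, `|q - mean (rho0 eps) (committor H eps)| <= s.
  by move/cvgrPdist_le : limq; exact.
have n5 := small _ al0.
near=> eps.
have e1 : 0 < eps by near: eps; exact: nbhs_right_gt.
have e2 : eps < eps0 by near: eps; exact: nbhs_right_lt.
have k1 : `|1 - committor H eps (3/2)| <= e / 8 / (M + 1) by near: eps.
have k2 : committor_gap H eps <= e / 8 / (M + 1) by near: eps.
have k3 : committor H eps (3/2) <= 2 by near: eps.
have k4 : `|q - mean (rho0 eps) (committor H eps)| <= s by near: eps.
have k5 : mean (rho0 eps) f <= al by near: eps.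
have hd : forall rho rho0, solution H eps rho rho0 -> mean rho0 f <= al ->
    forall t', 0 <= t' <= t -> mean (rho t') f <= s /\
    `|mean (rho t') (committor H eps) -
      expR (- (kramers H * t')) * mean rho0 (committor H eps)| <= s by near: eps.
have tt : 0 <= t <= t by rewrite t0 lexx.
have [k6 k7] := hd _ _ (sol _ e1 e2) k5 t tt.
have d := solution_density (sol _ e1 e2) t0.
have ob := observable_bound dw e1 d bf f0 cG GM r14 c0 (ltW e40) hc hG1 hGN k3.
rewrite /= in ob.
set Y := mean (rho eps t) (committor H eps) in k7 ob.
set y0 := mean (rho0 eps) (committor H eps) in k4 k7.
have /andP[x0 x1] := decay_itv H t0.
have YQ : `|Y - Q| <= 2 * s.
  have -> : Y - Q = (Y - expR (- (kramers H * t)) * y0) - expR (- (kramers H * t)) * (q - y0).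
    by rewrite /Q; ring.
  apply: le_trans (ler_normB _ _) _; rewrite normrM gtr0_norm//.
  have : expR (- (kramers H * t)) * `|q - y0| <= s.
    by apply: le_trans k4; rewrite ler_piMl.
  by clear -k7; lra.
have Mnu : M * (`|1 - committor H eps (3/2)| + committor_gap H eps) <= e / 4.
  apply: (@le_trans _ _ (M * (e / 4 / (M + 1)))).
    by rewrite ler_wpM2l//; clear -k1 k2; lra.
  by rewrite mulrCA ler_piMr ?(ltW e40)// ler_pdivrMr// mul1r lerDl ler01.
have kf : 4 * M / c * mean (rho eps t) f <= 4 * M / c * s.
  by rewrite ler_wpM2l// divr_ge0 ?(ltW c0)// mulr_ge0.
have kY : `|2^-1 * ((1 + Y) * G 1 + (1 - Y) * G (-1)) -
    2^-1 * ((1 + Q) * G 1 + (1 - Q) * G (-1))| <= (M + M) * s.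
  have -> : 2^-1 * ((1 + Y) * G 1 + (1 - Y) * G (-1)) -
    2^-1 * ((1 + Q) * G 1 + (1 - Q) * G (-1)) = (Y - Q) * ((G 1 - G (-1)) / 2) by field.
  have DM : `|(G 1 - G (-1)) / 2| <= M.
    rewrite normrM [`|2^-1|]ger0_norm ?invr_ge0// ler_pdivrMr//.
    by apply: le_trans (ler_normB _ _) _; rewrite mulr_natr mulr2n; exact: lerD.
  rewrite normrM; apply: (@le_trans _ _ (2 * s * M)); first exact: ler_pM.
  by rewrite le_eqVlt; apply/orP; left; apply/eqP; ring.
rewrite distrC.
set mG := mean (rho eps t) G in ob *.
set V := 2^-1 * ((1 + Q) * _ + _) in kY *; set W := 2^-1 * ((1 + Y) * _ + _) in ob kY.
have := ler_normD (mG - W) (W - V); rewrite addrA subrK => h.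
have sK' : 4 * M / c * s + (M + M) * s <= e / 4.
  by rewrite -sK /K; clear -s0; lra.
by clear -h ob kY kf Mnu sK' e0; lra.
Unshelve. all: by end_near. Qed.

Theorem theorem1p1 (R : realType) (H : R -> R) (eps0 : R)
    (rho : R -> R -> R -> R) (rho0 : R -> R -> R)
    (rho0lim : probability (measurableTypeR R) R) (C c : R) :
  double_well H ->
  0 < eps0 ->
  (forall eps : R, 0 < eps -> eps < eps0 ->
    (@lebesgue_measure R).-integrable setT (fun x => (gibbs H eps x)%:E)) ->
  (forall eps : R, 0 < eps -> eps < eps0 ->
    solution H eps (rho eps) (rho0 eps)) ->
  weakstar_cvg 0^'+ (fun eps : R => density_measure (rho0 eps)) rho0lim ->
  0 < c ->
  (forall eps : R, 0 < eps -> eps < eps0 ->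
    let u0 := fun x : R => rho0 eps x / gamma H eps x in
    (exists2 v : R -> R, weak_derivative u0 v &
      (\int[@lebesgue_measure R]_x (gamma H eps x * `|u0 x| ^+ 2)%:E
       + \int[@lebesgue_measure R]_x (gamma H eps x * `|v x| ^+ 2 / tau eps)%:E
       <= C%:E)%E) /\
    (forall x : R, c <= u0 x)) ->
  exists u : R -> R,
    [/\ forall t : R, 0 <= t -> 0 <= u t <= 2,
        forall t : R, 0 <= t -> is_derive t 1 u (- kramers H * (u t - 1)),
        u 0 = 2 * fine (rho0lim `]0, +oo[) &
        forall t : R, 0 <= t ->
          weakstar_cvg 0^'+ (fun eps : R => density_measure (rho eps t))
            (two_wells (u t))].
Proof.
move=> dw eps00 ig sol wc c0 hrho.
have [f [bf f0 f_off f_H dyn]] := dynamics dw.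
set p := fine (rho0lim `]0, +oo[).
have p01 : 0 <= p <= 1.
  rewrite /p fine_ge0//= -lee_fin fineK ?probability_le1 ?fin_num_measure//.
pose k := kramers H.
(* The explicit solution of the linear equation with u 0 = 2 * p. *)
pose u (t : R) : R := 1 + (2 * p - 1) * expR (- k * t).
have dsol eps : 0 < eps -> eps < eps0 -> probability_density (rho0 eps).
  by move=> e0 e1; exact: initial_density (sol _ e0 e1).
have dnear : \forall eps \near 0^'+, probability_density (rho0 eps).
  near=> eps; apply: dsol; first by near: eps; exact: nbhs_right_gt.
  by near: eps; exact: nbhs_right_lt.
have small : forall eta, 0 < eta -> \forall eps \near 0^'+, mean (rho0 eps) f <= eta.
  apply: (initial_concentration (C := C) dw eps00 ig bf f0 f_H c0) => eps e0 e1.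
  have [[v _ hC] hc] := hrho _ e0 e1; split => //; first exact: dsol.
  apply: le_trans hC; rewrite leeDl//; apply: integral_ge0 => x _; rewrite lee_fin.
  rewrite divr_ge0 ?(ltW (tau_gt0 e0))// mulr_ge0 ?sqr_ge0//.
  rewrite mulr_ge0 ?gibbs_ge0// invr_ge0; apply: Rintegral_ge0 => y _.
  exact: gibbs_ge0.
have lim0 := initial_limit dw bf f0 f_off wc dnear small; rewrite -/p in lim0.
have u02 t : 0 <= t -> 0 <= u t <= 2.
  move=> t0; have /andP[x0 x1] := decay_itv H t0; rewrite -/k -mulNr in x0 x1.
  have q1 : `|(2 * p - 1) * expR (- k * t)| <= 1.
    have a1 : `|2 * p - 1| <= 1.
      by have /andP[? ?] := p01; rewrite ler_norml; apply/andP; split; lra.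
    by rewrite normrM (gtr0_norm x0); apply: mulr_ile1 => //; exact: ltW.
  move: q1; rewrite /u ler_norml => /andP[? ?]; apply/andP; split; lra.
exists u; split => //.
- move=> t _.
  have h1 := is_derive_scale (- k) (is_derive_id t (1 : R)); rewrite mulr1 in h1.
  have h2 := @is_derive1_comp _ expR _ t _ _ (is_derive_expR _) h1.
  have h3 := is_deriveD (is_derive_cst (1 : R) t (1 : R)) (is_derive_scale (2 * p - 1) h2).
  apply: is_derive_eq h3 _; rewrite /u -/k add0r; ring.
- by rewrite /u mulr0 expR0 mulr1 addrC subrK.
move=> t t0 G cG bG.
have mG : measurable_fun setT G by exact: continuous_measurable_fun.
rewrite (integral_two_wells (u02 t t0) mG).
have bmG : bmeas G by exact: bmeas_continuous.
have := relaxation_cvg dw eps00 sol bf f0 f_off dyn small lim0 t0 cG bG.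
rewrite /= (_ : 2^-1 * _ = 2^-1 * (u t * G 1 + (2 - u t) * G (-1))); last first.
  by rewrite /u /k mulNr; ring.
move=> lim; apply/fine_cvgP; split.
  near=> eps; rewrite density_measure_integral//.
  apply: (@solution_density _ H eps t _ (rho0 eps)) => //; apply: sol.
    by near: eps; exact: nbhs_right_gt.
  by near: eps; exact: nbhs_right_lt.
have FF : Filter (0^'+ : set_system R) by apply: filter_filter.
apply: (near_eq_lim FF _ lim); near=> eps.
rewrite /= density_measure_integral//.
apply: (@solution_density _ H eps t _ (rho0 eps)) => //; apply: sol.
  by near: eps; exact: nbhs_right_gt.
by near: eps; exact: nbhs_right_lt.
Unshelve. all: by end_near. Qed.
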